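(* Let $S:\mathbb{R}^n\times\mathbb{R}^m\to\mathbb{R}$ be convex-concave and continuously differentiable, with at least one saddle point, and with absolutely continuous gradient $\nabla S$. Let $\rho>0$, define $\tilde S(u,y):=\min_{x\in\mathbb{R}^n}\{S(x,y)+\frac{\rho}{2}\|x-u\|^2\}$, and let $\tilde x(u,y)$ be the unique minimizer. Suppose that for constants $\mu,l,\sigma,\kappa>0$: (a) $S(x,y)$ is $\mu$-strongly convex in $x$ with $l$-Lipschitz gradient in $x$, i.e. $lI\succeq\partial^2_{xx}S(x,y)\succeq\mu I$ for all $(x,y)$ wherever $\partial^2_{xx}S(x,y)$ is defined; (b) the $m\times n$ matrix $J(u,y)$ of mixed second-order partial derivatives, $J(u,y):=\partial_x(\nabla_yS)(\tilde x(u,y),y)$, has full row rank with $\sigma I\succeq J(u,y)J(u,y)^T\succeq\kappa I$ for all $(u,y)$ wherever the second-order partial derivatives are defined. Then the proximal saddle flow dynamics $$\dot u=-\nabla_u\tilde S(u,y)=-(\rho u-\rho\tilde x(u,y)),\qquad \dot y=+\nabla_y\tilde S(u,y)=\nabla_yS(\tilde x(u,y),y)$$ are globally exponentially stable. More precisely, writing $w:=(u,y)$, given the (unique) saddle point $w_\star$ of $\tilde S$ and any initial point $w(0)$, $$\|w(t)-w_\star\|\le\|w(0)-w_\star\|e^{-ct}$$ holds (for all $t\ge0$) with the rate $$c=\min\left\{\frac{\mu\rho}{\mu+\rho},\frac{\kappa}{l+\rho}\right\}>0 .$$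
   Context: $S$ is convex-concave if $S(\cdot,y)$ is convex for every $y$ and $S(x,\cdot)$ is concave for every $x$. A saddle point of $T:\mathbb{R}^n\times\mathbb{R}^m\to\mathbb{R}$ is a point $(x_\star,y_\star)$ with $T(x_\star,y)\le T(x_\star,y_\star)\le T(x,y_\star)$ for all $x,y$. Under the hypotheses, $\tilde S$ is convex in $u$, concave in $y$ and continuously differentiable with the gradient shown, and $(x_\star,y_\star)$ is a saddle point of $S$ iff it is a saddle point of $\tilde S$. Absolute continuity of $\nabla S$ (weaker than Lipschitz continuity) is understood along line segments, so that the fundamental theorem of calculus applies to $\nabla S$ along segments. $A\succeq B$ denotes the Loewner order on symmetric matrices. *)

(* Defs.v *)
From HB Require Import structures.
From mathcomp Require Export all_boot all_order all_algebra.
From mathcomp Require Export all_classical all_reals all_analysis.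

Set Implicit Arguments.
Unset Strict Implicit.
Unset Printing Implicit Defensive.

Export Order.TTheory GRing.Theory Num.Theory.
Export numFieldNormedType.Exports.

Open Scope classical_set_scope.
Open Scope ring_scope.

(* The library norm `|_| on row vectors is the sup norm, hence the Euclidean
   norms below; the topology (limits, derivatives) is the same for both. *)
Definition enorm {R : realType} {n : nat} (v : 'rV[R]_n) : R :=
  Num.sqrt (\sum_(i < n) v 0 i ^+ 2).

Definition enorm_pair {R : realType} {n m : nat}
    (w : 'rV[R]_n * 'rV[R]_m) : R :=
  Num.sqrt (enorm w.1 ^+ 2 + enorm w.2 ^+ 2).

Definition gradient {R : realType} {n : nat} (f : 'rV[R]_n -> R)
    (x : 'rV[R]_n) : 'rV[R]_n :=
  \row_(j < n) 'D_(delta_mx 0 j) f x.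

Definition partials_defined {R : realType} {n p : nat}
    (g : 'rV[R]_n -> 'rV[R]_p) (x : 'rV[R]_n) : Prop :=
  forall (i : 'I_p) (j : 'I_n),
    derivable (fun z => g z 0 i : R) x (delta_mx 0 j).

(* Entries are partial derivatives, for g not necessarily Frechet
   differentiable; rows are indexed by the components of g (the library's 'J is
   the transpose of this and is based on the Frechet differential). *)
Definition partials_mx {R : realType} {n p : nat}
    (g : 'rV[R]_n -> 'rV[R]_p) (x : 'rV[R]_n) : 'M[R]_(p, n) :=
  \matrix_(i < p, j < n) 'D_(delta_mx 0 j) (fun z => g z 0 i : R) x.

Section TwoVariables.
Context {R : realType} {n m : nat}.
Implicit Types (S T : 'rV[R]_n -> 'rV[R]_m -> R).

Definition grad_x S (x : 'rV[R]_n) (y : 'rV[R]_m) : 'rV[R]_n :=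
  gradient (fun x' => S x' y) x.

Definition grad_y S (x : 'rV[R]_n) (y : 'rV[R]_m) : 'rV[R]_m :=
  gradient (fun y' => S x y') y.

Definition full_gradient S (w : 'rV[R]_n * 'rV[R]_m) : 'rV[R]_n * 'rV[R]_m :=
  (grad_x S w.1 w.2, grad_y S w.1 w.2).

Definition convex_concave S : Prop :=
  (forall y, convex_function (E := 'rV[R]_n) setT (fun x => S x y)) /\
  (forall x, convex_function (E := 'rV[R]_m) setT (fun y => - S x y)).

Definition continuously_differentiable S : Prop :=
  (forall w : 'rV[R]_n * 'rV[R]_m,
     differentiable (fun w' : 'rV[R]_n * 'rV[R]_m => S w'.1 w'.2) w) /\
  continuous (full_gradient S).

Definition saddle_point T (w : 'rV[R]_n * 'rV[R]_m) : Prop :=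
  forall x y, T w.1 y <= T w.1 w.2 /\ T w.1 w.2 <= T x w.2.

End TwoVariables.

Definition absolutely_continuous {R : realType} {V : normedModType R}
    (a b : R) (f : R -> V) : Prop :=
  forall e : R, 0 < e -> exists2 d : R, 0 < d &
    forall (k : nat) (I : 'I_k -> R * R),
      (forall i, a <= (I i).1 /\ (I i).1 <= (I i).2 /\ (I i).2 <= b) ->
      trivIset setT (fun i => `](I i).1, (I i).2[%classic) ->
      \sum_(i < k) ((I i).2 - (I i).1) < d ->
      \sum_(i < k) `|f (I i).2 - f (I i).1| < e.

Definition abs_continuous_along_segments {R : realType}
    {V W : normedModType R} (g : V -> W) : Prop :=
  forall a b : V, absolutely_continuous 0 1 (fun t : R => g (a + t *: (b - a))).

Definition strongly_convex {R : realType} {n : nat} (mu : R)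
    (f : 'rV[R]_n -> R) : Prop :=
  convex_function (E := 'rV[R]_n) setT (fun x => f x - mu / 2 * enorm x ^+ 2).

Definition lipschitz_gradient {R : realType} {n : nat} (l : R)
    (f : 'rV[R]_n -> R) : Prop :=
  forall x x', enorm (gradient f x - gradient f x') <= l * enorm (x - x').

(* On symmetric matrices this is the Loewner order.  Symmetry is not demanded,
   since a matrix of second-order partial derivatives may fail to be symmetric
   at exceptional points. *)
Definition loewner_le {R : realType} {p : nat} (A B : 'M[R]_p) : Prop :=
  forall v : 'rV[R]_p, 0 <= (v *m (B - A) *m v^T) 0 0.

Section ProximalSaddleFlow.
Context {R : realType} {n m : nat}.
Variables (rho : R) (S : 'rV[R]_n -> 'rV[R]_m -> R).

Definition prox_objective (u : 'rV[R]_n) (y : 'rV[R]_m) (x : 'rV[R]_n) : R :=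
  S x y + rho / 2 * enorm (x - u) ^+ 2.

Definition prox_point (u : 'rV[R]_n) (y : 'rV[R]_m) : 'rV[R]_n :=
  get [set x | forall z, prox_objective u y x <= prox_objective u y z].

(* For S convex in x and rho > 0 the infimum is attained, only at
   prox_point u y. *)
Definition prox_envelope (u : 'rV[R]_n) (y : 'rV[R]_m) : R :=
  inf (range (prox_objective u y)).

Definition J_mixed (u : 'rV[R]_n) (y : 'rV[R]_m) : 'M[R]_(m, n) :=
  partials_mx (fun x => grad_y S x y) (prox_point u y).

Definition J_mixed_defined (u : 'rV[R]_n) (y : 'rV[R]_m) : Prop :=
  partials_defined (fun x => grad_y S x y) (prox_point u y).

End ProximalSaddleFlow.

Definition saddle_flow {R : realType} {n m : nat}
    (T : 'rV[R]_n -> 'rV[R]_m -> R) (w : 'rV[R]_n * 'rV[R]_m) :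
    'rV[R]_n * 'rV[R]_m :=
  (- grad_x T w.1 w.2, grad_y T w.1 w.2).

Definition trajectory {R : realType} {V : normedModType R} (F : V -> V)
    (w : R -> V) : Prop :=
  w @ 0^'+ --> w 0 /\ (forall t : R, 0 < t -> is_derive t 1 w (F (w t))).

Definition globally_exponentially_stable {R : realType} {n m : nat}
    (F : 'rV[R]_n * 'rV[R]_m -> 'rV[R]_n * 'rV[R]_m)
    (weq : 'rV[R]_n * 'rV[R]_m) : Prop :=
  F weq = 0 /\
  exists M a : R, 0 < M /\ 0 < a /\
    forall w : R -> 'rV[R]_n * 'rV[R]_m, trajectory F w ->
    forall t : R, 0 <= t ->
      enorm_pair (w t - weq) <= M * enorm_pair (w 0 - weq) * expR (- a * t).

(* Main.v *)
(** Write [T] for the envelope, [xt] for the minimizer and [G := grad_x S].  The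
    gradients of [T] are [rho (u - xt)] and [grad_y S xt y], and [T] is
    [mu rho / (mu + rho)]-strongly convex in [u].  Once [T u] is known to be
    [kappa / (l + rho)]-strongly concave, the flow is strongly monotone towards the
    saddle point and the squared distance decays at the rate [2 c].

    The descent lemma applied at [xt u y] gives
    [T u y' <= T u y + <grad_y T u y, y' - y> - |G (xt u y) y' - G (xt u y) y|^2 / (2 (l + rho))],
    so strong concavity amounts to a lower bound for the increments of [G] in [y],
    which (b) controls only through derivatives that exist almost everywhere, while a
    curve [b |-> (xt u (y + b v), y + b v)] may stay in the exceptional null set.
    Absolute continuity and Fubini show that for almost every [(x, b)] the derivative
    of [b |-> G x (y + b v)] exists and has square norm at least [kappa |v|^2].  Hence
    the set of [(x, b)] at which the increment of [G] over a step [1/K] is too small has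
    measure tending to [0] as [K] grows.  As [u |-> xt u y] expands distances up to a
    factor and [G] is Lipschitz, small cubes around the points [(xt u b, b)], for [(u, b)]
    in a grid of mesh proportional to [1/K], are disjoint and lie in a similar set as soon as
    their centres do; comparing volumes, some [u] of the grid, arbitrarily close to the given
    one, has few such [b], and summing the above inequality along [b] gives the
    decrement of [<grad_y T, v>] for this [u], hence for the given one by continuity. *)

(* Formally the Hessian of the envelope in [y] is [S_yy - J (S_xx + rho I)^-1 J^T], which explains
   the rate [kappa / (l + rho)]; but [T] need not be twice differentiable. The gap inequality
   replaces the Hessian: it uses only concavity in [y] and the Lipschitz gradient in [x]. Used in
   both directions between two points it counts the coefficient [1 / (2 (l + rho))] twice, so no
   factor is lost. Hypothesis (b) speaks of the points [(xt u y, y)], but these are all points,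
   since [x + rho^-1 grad_x S x y] is sent to [x]. This inverse of the proximal map is Lipschitz and
   hence preserves null sets; the comparison of volumes is a discrete form of this fact, without a
   change of variables. Absolute continuity gives derivatives of [grad_y S] in [x], whereas
   increments of [grad_x S] in [y] are wanted. The exchange of mixed partials is itself proved only
   almost everywhere, through difference quotients and dominated convergence. The constant [sigma]
   makes [grad_x S] Lipschitz in [y], so that a whole cube around a bad point is nearly bad. *)
From HB Require Import structures.
Require Import Defs.
From mathcomp Require Import ring lra measurable_realfun unstable.

Set Implicit Arguments.
Unset Strict Implicit.
Unset Printing Implicit Defensive.

(** * Absolutely continuous functions of one variable *)

Section AbsolutelyContinuous.
Context {R : realType}.
Implicit Types (f F : R -> R) (s : seq (R * R)).

Definition nonoverlap (p q : R * R) := (p.2 <= q.1) || (q.2 <= p.1).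

Definition subitv (a b : R) (p : R * R) := [&& a <= p.1, p.1 <= p.2 & p.2 <= b].

(** Lists replace the families indexed by ['I_k] because the bound on total variations flattens one
    list of intervals per member of another list. *)
Definition seq_abs_continuous f := forall e : R, 0 < e -> exists2 d : R, 0 < d &
  forall s, all (subitv 0 1) s -> pairwise nonoverlap s ->
    \sum_(p <- s) (p.2 - p.1) < d -> \sum_(p <- s) `|f p.2 - f p.1| < e.

Lemma abs_continuous_seq f : absolutely_continuous 0 1 f -> seq_abs_continuous f.
Proof.
move=> acf e e0; have [d d0 H] := acf e e0; exists d => // s s01 sd sl.
pose x0 : R * R := (0, 0).
have := H (size s) (fun i => nth x0 s i).
rewrite !(big_nth x0) !big_mkord in sl *; apply => //.
- by move=> i; have /(all_nthP x0)/(_ i (ltn_ord i))/and3P[] := s01.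
- apply/trivIsetP => i j _ _ ij.
  have nij : nonoverlap (nth x0 s i) (nth x0 s j).
    move: ij; rewrite -val_eqE neq_ltn => /orP[ij|ij].
      by have /(pairwiseP x0)/(_ i j (ltn_ord i) (ltn_ord j) ij) := sd.
    rewrite /nonoverlap orbC.
    by have /(pairwiseP x0)/(_ j i (ltn_ord j) (ltn_ord i) ij) := sd.
  apply/seteqP; split => // x [] /=; rewrite !in_itv/= => /andP[x1 x2] /andP[x3 x4].
  case/orP: nij => /= h.
    by have := lt_trans (lt_le_trans x2 h) x3; rewrite ltxx.
  by have := lt_trans (lt_le_trans x4 h) x1; rewrite ltxx.
Qed.

Definition consecutive (a : R) (t : seq R) : seq (R * R) :=
  [seq (p.2, p.1) | p <- zip t (a :: t)].

Lemma variation_consecutive a b f t : itv_partition a b t ->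
  variation a b f t = \sum_(p <- consecutive a t) `|f p.2 - f p.1|.
Proof. by move=> abt; rewrite variation_zip// big_map. Qed.

Lemma consecutive_nonoverlap (a : R) t : path <%R a t ->
  [/\ all (subitv a (last a t)) (consecutive a t),
      pairwise nonoverlap (consecutive a t) &
      \sum_(p <- consecutive a t) (p.2 - p.1) = last a t - a].
Proof.
elim: t a => [|b t IH] a /=; first by rewrite big_nil subrr.
move=> /andP[ab pbt]; have [h1 h2 h3] := IH _ pbt.
have bl : b <= last b t by exact: path_lt_le_last.
rewrite /consecutive /= -/(consecutive b t).
split; last by rewrite big_cons/= h3; ring.
- apply/andP; split; first by rewrite /subitv/= lexx (ltW ab).
  apply: sub_all h1 => p /and3P[p1 p2 p3]; rewrite /subitv p2 p3 !andbT.
  by rewrite (le_trans (ltW ab)).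
- rewrite h2 andbT; apply: sub_all h1 => p /and3P[p1 p2 p3].
  by rewrite /nonoverlap /= p1.
Qed.

Lemma flatten_nonoverlap s (c : R * R -> seq (R * R)) :
  all (subitv 0 1) s -> pairwise nonoverlap s ->
  (forall p, p \in s -> all (subitv p.1 p.2) (c p) /\ pairwise nonoverlap (c p)) ->
  all (subitv 0 1) (flatten [seq c p | p <- s]) /\
  pairwise nonoverlap (flatten [seq c p | p <- s]).
Proof.
elim: s => [//|p s IH] /= /andP[p01 s01] /andP[ps sd] H.
have [h1 h2] := IH s01 sd (fun q qs => H q (mem_behead (s := p :: s) qs)).
have [k1 k2] := H p (mem_head _ _).
have k01 : all (subitv 0 1) (c p).
  apply: sub_all k1 => q /and3P[q1 q2 q3].
  case/and3P: p01 => p1 p2 p3.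
  by rewrite /subitv (le_trans p1 q1) q2 (le_trans q3 p3).
split; first by rewrite all_cat h1 k01.
rewrite pairwise_cat k2 h2 !andbT; apply/allrelP => q r qp.
move=> /flatten_mapP[p' p's rp'].
have [/allP/(_ _ rp')/and3P[r1 r2 r3] _] := H p' (mem_behead (s := p :: s) p's).
move: k1 => /allP/(_ _ qp)/and3P[q1 q2 q3].
move: ps => /allP/(_ _ p's)/orP[h|h]; rewrite /nonoverlap.
  by rewrite (le_trans q3 (le_trans h r1)).
by rewrite (le_trans r3 (le_trans h q1)) orbT.
Qed.

Local Notation TV := (@total_variation R).

Lemma total_variation_near a b f (e : R) : 0 < e -> a <= b ->
    bounded_variation a b f ->
  exists t, itv_partition a b t /\
    fine (TV a b f) - e < \sum_(p <- consecutive a t) `|f p.2 - f p.1|.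
Proof.
move=> e0 ab bv; have fn : TV a b f \is a fin_num by apply/bounded_variationP.
have [y [z [t pt <-] <-]] := ub_ereal_sup_adherent e0 fn.
rewrite -/(TV a b f) -(fineK fn) -EFinB lte_fin => h.
by exists t; rewrite -(variation_consecutive _ pt).
Qed.

(** Each interval is replaced by a partition whose increments almost exhaust its total variation.
    The flattened family has the same total length, so the estimate for increments passes to total
    variations, with a non-strict inequality. *)
Lemma total_variation_sum_le f (e d : R) : bounded_variation 0 1 f ->
  (forall s, all (subitv 0 1) s -> pairwise nonoverlap s ->
    \sum_(p <- s) (p.2 - p.1) < d -> \sum_(p <- s) `|f p.2 - f p.1| < e) ->
  forall s, all (subitv 0 1) s -> pairwise nonoverlap s ->
    \sum_(p <- s) (p.2 - p.1) < d ->
    \sum_(p <- s) fine (TV p.1 p.2 f) <= e.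
Proof.
move=> bv H s s01 sd sl; apply/ler_addgt0Pr => x x0.
(* The slack [x] is shared among the intervals; the successor keeps [k] positive when the list is
   empty. *)
pose k : R := x / (size s).+1%:R.
have k0 : 0 < k by rewrite divr_gt0.
have ex (p : R * R) : exists t, p \in s -> itv_partition p.1 p.2 t /\
    fine (TV p.1 p.2 f) - k < \sum_(q <- consecutive p.1 t) `|f q.2 - f q.1|.
  have [ps|ps] := boolP (p \in s); last by exists [::].
  have /allP/(_ _ ps)/and3P[p1 p2 p3] := s01.
  have [|t ht] := @total_variation_near p.1 p.2 f k k0 p2; last by exists t.
  apply: (bounded_variationr p1 p2).
    exact: bounded_variationl (le_trans p1 p2) p3 bv.
have [t ht] := choice ex.
pose c p := consecutive p.1 (t p).
have hc p : p \in s -> [/\ all (subitv p.1 p.2) (c p), pairwise nonoverlap (c p) &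
    \sum_(q <- c p) (q.2 - q.1) = p.2 - p.1].
  move=> ps; have [[pt /eqP pl] _] := ht p ps.
  by have [] := consecutive_nonoverlap pt; rewrite pl.
have [|||g1 g2] := @flatten_nonoverlap s c => //.
  by move=> p ps; have [] := hc p ps.
have lt : \sum_(p <- flatten [seq c p | p <- s]) `|f p.2 - f p.1| < e.
  apply: H => //; rewrite big_flatten/= big_map.
  by rewrite (eq_big_seq (fun p => p.2 - p.1))// => p ps; have [] := hc p ps.
rewrite big_flatten/= big_map in lt.
apply: (@le_trans _ _ (\sum_(p <- s) (\sum_(q <- c p) `|f q.2 - f q.1| + k))).
  rewrite big_seq [leRHS]big_seq; apply: ler_sum => p ps.
  by have [_ /ltW] := ht p ps; rewrite lerBlDr.
rewrite big_split/= lerD ?(ltW lt)// big_const_seq count_predT iter_addr_0.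
rewrite -mulr_natr /k mulrAC ler_pdivrMr// ler_wpM2l ?(ltW x0)//.
by rewrite ler_nat.
Qed.

(** On an interval shorter than the [d] belonging to [e = 1] the variation is at most 1, and
    [[0, 1]] is a finite concatenation of such intervals, of length [1 / (N + 1)]. *)
Lemma seq_abs_continuous_bounded_variation f :
  seq_abs_continuous f -> bounded_variation 0 1 f.
Proof.
move=> /(_ 1 ltr01)[d d0 H].
have small a b : 0 <= a -> a <= b -> b <= 1 -> b - a < d -> bounded_variation a b f.
  move=> a0 ab b1 bad; exists 1 => _ [t pt <-].
  rewrite variation_consecutive//; case: pt => pt /eqP pl.
  have [h1 h2 h3] := consecutive_nonoverlap pt.
  rewrite pl in h1 h3; apply/ltW/H => //; last by rewrite h3.
  apply: sub_all h1 => p /and3P[p1 p2 p3].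
  by rewrite /subitv (le_trans a0 p1) p2 (le_trans p3 b1).
have [N Nd] : exists N : nat, N.+1%:R^-1 < d.
  near \oo => N; exists N; near: N; exact: near_infty_natSinv_lt (PosNum d0).
have step k : (k <= N.+1)%N -> bounded_variation 0 (k%:R / N.+1%:R) f.
  elim: k => [|k IH] kN.
    by rewrite mul0r; exact: bounded_variationxx.
  have k0 : 0 <= k%:R / N.+1%:R :> R by rewrite divr_ge0.
  have kk : k%:R / N.+1%:R <= k.+1%:R / N.+1%:R :> R.
    by rewrite ler_pM2r ?invr_gt0// ler_nat.
  apply/bounded_variationP; first exact: le_trans kk.
  rewrite (total_variationD _ k0 kk) fin_numD; apply/andP; split.
    exact/bounded_variationP/IH/ltnW.
  apply/bounded_variationP => //; apply: small => //.
    by rewrite ler_pdivrMr// mul1r ler_nat.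
  by rewrite -mulrBl -natrB// subSnn mul1r.
by have := step N.+1 (leqnn _); rewrite divff.
Unshelve. all: by end_near. Qed.

End AbsolutelyContinuous.

(** * Densities of absolutely continuous functions by Radon-Nikodym *)

Section Density.
Context {R : realType}.
Implicit Types (f F : R -> R) (s : seq (R * R)).
Local Notation mu := (@lebesgue_measure R).

(** Precomposition with this retraction onto [[0, 1]] extends monotone functions to the whole line,
    where Lebesgue-Stieltjes measures live. *)
Definition clamp01 (t : R) : R := if t <= 0 then 0 else if 1 <= t then 1 else t.

Lemma clamp01_id t : 0 <= t <= 1 -> clamp01 t = t.
Proof. by rewrite /clamp01; case: (leP t 0); case: (leP 1 t); lra. Qed.

Lemma clamp01_in t : 0 <= clamp01 t <= 1.
Proof. by rewrite /clamp01; case: (leP t 0); case: (leP 1 t); lra. Qed.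

Lemma clamp01_le t u : t <= u -> clamp01 t <= clamp01 u.
Proof.
rewrite /clamp01.
by case: (leP t 0); case: (leP 1 t); case: (leP u 0); case: (leP 1 u); lra.
Qed.

Lemma clamp01_sub t u : t <= u -> clamp01 u - clamp01 t <= u - t.
Proof.
rewrite /clamp01.
by case: (leP t 0); case: (leP 1 t); case: (leP u 0); case: (leP 1 u); lra.
Qed.

(** Finite measure excludes unbounded intervals and openness excludes closed ends. *)
Lemma open_itv_lebesgue (A : set R) (d : R) : open A -> is_interval A -> A !=set0 ->
  (mu A < d%:E)%E -> exists a b, [/\ a < b, A = `]a, b[%classic & mu A = (b - a)%:E].
Proof.
move=> oA /is_intervalP; move: (Rhull A) => i Ai A0.
rewrite {1}Ai lebesgue_measure_itv.
have {}Ai : A = [set` i]° by rewrite -Ai; apply/esym/interior_id.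
case: A0 => z Az; move: (Az); rewrite {1}Ai => /interior_subset/=.
case: i Ai => [[x a|[]] [y b|[]]]; rewrite ?interior_itv => Ai;
  rewrite ?itv_boundlr/= ?bnd_simp ?andbF ?ltry ?ltNyr//.
move=> _ _; have ab : a < b.
  by move: Az; rewrite Ai/= in_itv/= => /andP[]; exact: lt_trans.
exists a, b; split => //.
by rewrite Ai lebesgue_measure_itv/= lte_fin ab EFinB.
Qed.

Lemma disjoint_oo (a b c d : R) : `]a, b[ `&` `]c, d[ = set0 :> set R ->
  a < b -> c < d -> (b <= c) || (d <= a).
Proof.
move=> abcd ab cd; apply/negPn; rewrite negb_or -!ltNge; apply/negP => /andP[cb ad].
have : (`]a, b[ `&` `]c, d[)%classic ((Num.max a c + Num.min b d) / 2).
  by split; rewrite /= in_itv/=; case: (leP a c); case: (leP b d) => *; lra.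
by rewrite abcd.
Qed.

Section nondecreasing.
Variable F : R -> R.
Hypothesis ndF : {homo F : x y / x <= y}.
Hypothesis F01 : forall t, F t = F (clamp01 t).
Hypothesis acF : forall e : R, 0 < e -> exists2 d : R, 0 < d &
  forall s, all (subitv 0 1) s -> pairwise nonoverlap s ->
    \sum_(p <- s) (p.2 - p.1) < d -> \sum_(p <- s) (F p.2 - F p.1) <= e.

Let cF : continuous F.
Proof.
move=> t; apply/cvgrPdist_le => e e0; have [d d0 H] := acF e0.
have small x y : x <= y -> y - x < d -> F y - F x <= e.
  move=> xy yx; have := H [:: (clamp01 x, clamp01 y)]; rewrite !big_seq1/= -!F01.
  apply => //; last by apply: le_lt_trans yx; exact: clamp01_sub.
  rewrite andbT /subitv/= clamp01_le//=.
  by have /andP[-> _] := clamp01_in x; have /andP[_ ->] := clamp01_in y.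
near=> u.
have : `|t - u| < d by near: u; exact: (@nbhsx_ballx R R t d d0).
have [tu|/ltW ut] := leP t u.
- by rewrite distrC ger0_norm ?subr_ge0// distrC ger0_norm ?subr_ge0 ?ndF// => /small; apply.
- by rewrite ger0_norm ?subr_ge0// ger0_norm ?subr_ge0 ?ndF// => /small; apply.
Unshelve. all: by end_near. Qed.

HB.instance Definition _ := isCumulative.Build R _ R F ndF (right_continuousW cF).

Let nu : {measure set (measurableTypeR R) -> \bar R} :=
  lebesgue_stieltjes_measure F.

Let nu_oc a b : a <= b -> nu `]a, b]%classic = (F b - F a)%:E.
Proof.
move=> ab; rewrite /nu/= /lebesgue_stieltjes_measure /measure_extension.
rewrite measurable_mu_extE/=; last exact: is_ocitv.
by rewrite wlength_itv_bnd.
Qed.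

(** A null set lies in an open set of measure less than [d], which is a disjoint union of open
    intervals. Finitely many of them, clamped to [[0, 1]], form an admissible family for [acF], so
    every partial sum of their [nu]-measures is at most [e]. *)
Let nu_dominated : nu `<< mu.
Proof.
apply/null_content_dominatesP => A mA A0.
apply/eqP; rewrite eq_le measure_ge0 andbT; apply/lee_addgt0Pr => e e0.
rewrite add0e; have [d d0 H] := acF e0.
have [|U [oU AU mU]] := lebesgue_regularity_outer mA _ d0.
  by rewrite A0.
have mUU : @measurable _ (measurableTypeR R) U := open_measurable oU.
have {mU} mU : (mu U < d%:E)%E.
  have mUA : measurable (U `\` A) by exact: measurableD.
  have : (mu U <= mu A + mu (U `\` A))%E.
    rewrite -{1}(setDUK AU); apply: measureU2 => //.
  by rewrite A0 add0e => /le_lt_trans; apply.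
apply: (@le_trans _ _ (nu U)); first by apply: le_measure; rewrite ?inE.
pose I := open_disjoint_itv oU.
have UI : U = \bigcup_i I i := open_disjoint_itv_bigcup oU.
have mI i : @measurable _ (measurableTypeR R) (I i) by apply: open_measurable; exact: open_disjoint_itv_open.
have tI : trivIset setT I := @open_disjoint_itv_trivIset _ _ oU.
have IU i : (mu (I i) < d%:E)%E.
  have IsU : I i `<=` U by rewrite UI; exact: bigcup_sup.
  by apply: le_lt_trans mU; apply: le_measure; rewrite ?inE//.
have ex i : exists p : R * R, I i !=set0 ->
    [/\ p.1 < p.2, I i = `]p.1, p.2[%classic & mu (I i) = (p.2 - p.1)%:E].
  have [I0|I0] := pselect (I i !=set0); last by exists (0, 0).
  have [a [b h]] := open_itv_lebesgue (@open_disjoint_itv_open _ _ oU i)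
    (@open_disjoint_itv_is_interval _ _ oU i) I0 (IU i).
  by exists (a, b).
have [p hp] := choice ex.
pose c (i : nat) := (clamp01 (p i).1, clamp01 (p i).2).
rewrite UI (measure_bigcup nu)//; apply: lime_le; first exact: is_cvg_nneseries.
apply: nearW => n.
(* The endpoints [p i] are meaningful for nonempty components only; the empty ones have [nu]-measure
   0. *)
pose l := [seq i <- iota 0 n | `[< I i !=set0 >]].
have lI i : i \in l -> I i !=set0 by rewrite mem_filter => /andP[/asboolP].
have ul : uniq l by rewrite filter_uniq// iota_uniq.
have lt : \sum_(q <- [seq c i | i <- l]) (q.2 - q.1) < d.
  rewrite big_map -lte_fin; apply: le_lt_trans mU.
  rewrite UI -sumEFin.
  apply: (@le_trans _ _ (\sum_(i <- l) mu (I i))%E).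
    rewrite big_seq [leRHS]big_seq; apply: lee_sum => i /lI/hp[p1 p2 ->].
    by rewrite lee_fin clamp01_sub// ltW.
  apply: (@le_trans _ _ (\sum_(i < n) mu (I i))%E).
    rewrite -(big_mkord xpredT (mu \o I)) /l big_filter/= big_mkcond/=.
    rewrite /index_iota subn0; apply: lee_sum => i _.
    by case: ifP => // _; exact: measure_ge0.
  rewrite -(measure_bigsetU mu)//; apply: le_measure; rewrite ?inE.
  - exact: bigsetU_measurable.
  - by rewrite -UI.
  - exact: bigsetU_bigcup.
apply: (@le_trans _ _ (\sum_(q <- [seq c i | i <- l]) (F q.2 - F q.1))%:E).
  rewrite big_map -sumEFin /l big_filter/= big_mkcond/= [leRHS]big_mkcond/=.
  rewrite /index_iota subn0.
  apply: lee_sum => i _; rewrite mem_set//; case: asboolP => I0; last first.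
    by move/set0P/negP: I0; rewrite negbK => /eqP ->; rewrite measure0.
  have [p1 p2 _] := hp _ I0.
  rewrite /c/= -!F01 -nu_oc ?(ltW p1)//.
  apply: (@le_measure _ _ _ nu); rewrite ?inE.
  - exact: mI.
  - exact: (measurable_itv `](p i).1, (p i).2]).
  - by rewrite p2; exact: subset_itv_oo_oc.
rewrite lee_fin; apply: H => //.
  apply/allP => _ /mapP[i /lI/hp[p1 _ _] ->].
  have /andP[h1 _] := clamp01_in (p i).1; have /andP[_ h2] := clamp01_in (p i).2.
  by rewrite /subitv/= h1 h2 clamp01_le// ltW.
rewrite pairwise_map; apply/(pairwiseP 0%N) => i j il jl ij /=.
have [[i0 i1 _] [j0 j1 _]] := (hp _ (lI _ (mem_nth 0%N il)), hp _ (lI _ (mem_nth 0%N jl))).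
have nij : nth 0%N l i != nth 0%N l j by rewrite nth_uniq// ltn_eqF.
have /trivIsetP/(_ _ _ Logic.I Logic.I nij) := tI; rewrite i1 j1 => /disjoint_oo.
by move=> /(_ i0 j0)/orP[h|h]; apply/orP; [left|right]; exact: clamp01_le.
Qed.

(* The Lebesgue-Stieltjes measure of [F] is dominated by the Lebesgue measure;
   [g] is its Radon-Nikodym derivative. *)
Lemma nondecreasing_density : exists g : R -> R,
  [/\ mu.-integrable setT (EFin \o g) &
    forall t, 0 <= t <= 1 -> (F t - F 0)%:E = (\int[mu]_(x in `[0%R, t]) (g x)%:E)%E].
Proof.
have mD : measurable (`]0%R, 1%R]%classic : set (measurableTypeR R)).
  exact: (measurable_itv `]0%R, 1%R]).
have foo : (nu `]0%R, 1%R]%classic < +oo)%E by rewrite nu_oc// ltry.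
(* Restriction to []0, 1]] yields a finite measure, to which Radon-Nikodym applies, with the same
   value on each []0, t]]. *)
pose nu' : {finite_measure set (measurableTypeR R) -> \bar R} := mfrestr mD foo.
have dom : nu' `<< mu.
  apply/null_content_dominatesP => A mA A0.
  have nuA : nu A = 0 by move/null_content_dominatesP : nu_dominated; apply.
  apply/eqP; rewrite eq_le measure_ge0 andbT -nuA.
  by apply: (@le_measure _ _ _ nu); rewrite ?inE//; exact: measurableI.
have [f [f0 ffin intf fE]] := radon_nikodym_sigma_finite dom.
have fK : EFin \o (fine \o f) = f by apply/funext => x /=; rewrite fineK.
exists (fine \o f); split; first by rewrite fK.
move=> t /andP[t0 t1].
rewrite -(nu_oc t0).
have -> : nu `]0, t]%classic = nu' `]0, t]%classic.
  congr (nu _); apply/esym/setIidPl; apply: subset_itvl; by rewrite bnd_simp.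
rewrite fE; last exact: (measurable_itv `]0%R, t]).
rewrite -(integral_itv_obnd_cbnd (f := EFin \o (fine \o f))).
  by rewrite fK.
by rewrite fK; apply: measurable_funTS; case/integrableP: intf.
Qed.

End nondecreasing.

(** Jordan decomposition: the variation function [tv 0] and [tv 0 - f] are nondecreasing and
    absolutely continuous, and the difference of their densities is a density of [f]. *)
Theorem abs_continuous_density f : absolutely_continuous 0 1 f ->
  exists2 g : R -> R, mu.-integrable setT (EFin \o g) &
    forall t, 0 <= t <= 1 -> f t = f 0 + (\int[mu]_(x in `[0, t]) g x)%R.
Proof.
move=> /abs_continuous_seq acf.
have bv := seq_abs_continuous_bounded_variation acf.
pose tv a b := fine (total_variation a b f).
have tvD x y : 0 <= x -> x <= y -> y <= 1 -> tv 0 y - tv 0 x = tv x y.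
  move=> x0 xy y1; rewrite /tv (total_variationD f x0 xy) fineD; first by ring.
  - by apply/bounded_variationP => //; exact: bounded_variationl (le_trans xy y1) bv.
  - apply/bounded_variationP => //; apply: (bounded_variationr x0 xy).
    exact: bounded_variationl (le_trans x0 xy) y1 bv.
have tv_ge x y : 0 <= x -> x <= y -> y <= 1 -> `|f y - f x| <= tv x y.
  move=> x0 xy y1; rewrite -lee_fin fineK; first exact: total_variation_ge.
  apply/bounded_variationP => //; apply: (bounded_variationr x0 xy).
  exact: bounded_variationl (le_trans x0 xy) y1 bv.
have tvc x y : x <= y ->
    `|f (clamp01 y) - f (clamp01 x)| <= tv 0 (clamp01 y) - tv 0 (clamp01 x).
  move=> xy; have /andP[x0 _] := clamp01_in x; have /andP[_ y1] := clamp01_in y.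
  by rewrite tvD ?tv_ge ?clamp01_le.
have cc t : clamp01 (clamp01 t) = clamp01 t by rewrite clamp01_id// clamp01_in.
have tvs (e : R) : 0 < e -> exists2 d : R, 0 < d &
    forall s, all (subitv 0 1) s -> pairwise nonoverlap s ->
      \sum_(p <- s) (p.2 - p.1) < d ->
      \sum_(p <- s) (tv 0 (clamp01 p.2) - tv 0 (clamp01 p.1)) <= e.
  move=> e0; have [d d0 H] := acf e e0; exists d => // s s01 sd sl.
  have := total_variation_sum_le bv H s01 sd sl; apply: le_trans.
  rewrite big_seq [leRHS]big_seq; apply: ler_sum => p.
  move=> /(allP s01)/and3P[p1 p2 p3].
  have p21 := le_trans p2 p3; have p02 := le_trans p1 p2.
  by rewrite !clamp01_id ?p1 ?p3 ?p21 ?p02// tvD.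
have [|||g1 [i1 h1]] := @nondecreasing_density (fun t => tv 0 (clamp01 t)).
- move=> x y xy; rewrite -subr_ge0; exact: le_trans (tvc x y xy).
- by move=> t; rewrite cc.
- exact: tvs.
have [|||g2 [i2 h2]] :=
  @nondecreasing_density (fun t => tv 0 (clamp01 t) - f (clamp01 t)).
- move=> x y xy; have := tvc x y xy; have := ler_norm (f (clamp01 y) - f (clamp01 x)).
  by lra.
- by move=> t; rewrite cc.
- move=> e e0; have e20 : 0 < e / 2 by rewrite divr_gt0.
  have [d1 d10 H1] := tvs _ e20; have [d2 d20 H2] := acf _ e20.
  exists (Num.min d1 d2); first by rewrite lt_min d10.
  move=> s s01 sd; rewrite lt_min => /andP[sl1 sl2].
  rewrite (splitr e).
  apply: le_trans (lerD (H1 s s01 sd sl1) (ltW (H2 s s01 sd sl2))).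
  rewrite -big_split/= big_seq [leRHS]big_seq; apply: ler_sum => p.
  move=> /(allP s01)/and3P[p1 p2 p3].
  have p21 := le_trans p2 p3; have p02 := le_trans p1 p2.
  rewrite !clamp01_id ?p1 ?p3 ?p21 ?p02//.
  by have := ler_norm (- (f p.2 - f p.1)); rewrite normrN; lra.
exists (g1 \- g2).
  rewrite (_ : _ \o _ = (EFin \o g1) \- (EFin \o g2))%E; first exact: integrableB.
  by apply/funext => x /=; rewrite EFinB.
move=> t t01; rewrite RintegralB//.
- have r01 : 0 <= (0:R) <= 1 by rewrite lexx ler01.
  have := h1 t t01; have := h2 t t01; rewrite !clamp01_id//.
  by move=> /(congr1 fine) /= h2' /(congr1 fine) /= h1'; rewrite /Rintegral -h1' -h2'; ring.
- by apply: integrableS i1.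
- by apply: integrableS i2.
Qed.

End Density.

(** * Lebesgue differentiation and limits of derivatives *)

Section AlmostEverywhere.
Context {R : realType}.
Local Notation mu := (@lebesgue_measure R).

#[global] Instance ae_filter_lebesgue : Filter (nbhs (almost_everywhere mu)) :=
  ae_filter_ringOfSetsType mu.

Lemma ae_neq01 : {ae mu, forall t : R, t != 0 /\ t != 1}.
Proof.
exists [set 0; 1]; split.
- by apply: measurableU; exact: measurable_set1.
- by apply: countable_lebesgue_measure0; exact: finite_set_countable.
- move=> t /= /not_andP[|] /negP; rewrite negbK => /eqP ->; [by left|by right].
Qed.

(** Lebesgue differentiation theorem. The conclusion stays inside [0 < t < 1] because [F] is
    prescribed on [[0, 1]] only. *)
Lemma integral_ae_is_derive (F g : R -> R) : mu.-integrable setT (EFin \o g) ->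
  (forall t : R, 0 <= t <= 1 -> F t = F 0 + (\int[mu]_(x in `[0, t]) g x)%R) ->
  {ae mu, forall t : R, 0 < t < 1 -> is_derive t 1 F (g t)}.
Proof.
move=> ig Fg; have := lebesgue_differentiation (open_integrable_locally openT ig).
apply: filterS => t lt /andP[t0 t1].
have [|dF DF] := @FTC1_lebesgue_pt _ g (BLeft 0) t 1 t1 _ t0 lt.
  exact: integrableS ig.
pose H := (fun y => F 0 + (\int[mu]_(x in `[0, y]) g x)%R).
have dH : is_derive t 1 H (g t).
  rewrite -[g t]add0r; apply: is_deriveD.
  by rewrite -DF derive1E; apply: derivableP.
apply: near_eq_is_derive dH; near=> y; rewrite /H -Fg//.
have : y \in `]0, 1[ by near: y; apply: near_in_itvoo; rewrite in_itv/= t0.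
by rewrite in_itv/= => /andP[/ltW-> /ltW->].
Unshelve. all: by end_near. Qed.

Lemma abs_continuous_ae_derivable (f : R -> R) : absolutely_continuous 0 1 f ->
  {ae mu, forall t : R, 0 < t < 1 -> derivable f t 1}.
Proof.
move=> /abs_continuous_density[g ig fg].
by apply: filterS (integral_ae_is_derive ig fg) => t h /h[].
Qed.

Lemma abs_continuous_derive_bound (f : R -> R) (L : R) : 0 <= L ->
  absolutely_continuous 0 1 f ->
  {ae mu, forall t : R, 0 < t < 1 -> `|'D_1 f t| <= L} -> `|f 1 - f 0| <= L.
Proof.
move=> L0 /abs_continuous_density[g ig fg] fL.
have -> : f 1 - f 0 = (\int[mu]_(x in `[0, 1]) g x)%R.
  by rewrite (fg 1) ?lexx ?ler01//; ring.
have aeL : {ae mu, forall t : R, `[0, 1]%classic t -> (`|(g t)%:E| <= L%:E)%E}.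
  apply: filterS3 ae_neq01 fL (integral_ae_is_derive ig fg) => t [t0 t1] h1 h2 /=.
  rewrite in_itv/= lee_fin => /andP[t0' t1'].
  have t01 : 0 < t < 1 by rewrite !lt_neqAle t0' t1' (eq_sym 0) t0 t1.
  by have := h1 t01; have -> := @derive_val _ _ _ _ _ _ _ (h2 t01).
have i01 : mu.-integrable `[0, 1] (EFin \o g) by exact: integrableS ig.
rewrite -lee_fin /Rintegral -abse_EFin fineK ?integrable_fin_num//.
apply: (le_trans (le_abse_integral _ _ _)) => //.
  by case/integrableP: i01.
apply: (@le_trans _ _ (\int[mu]_(x in `[0%R, 1%R]) (cst L%:E x))%E).
  apply: ae_ge0_le_integral => //.
  by apply: measurableT_comp => //; case/integrableP: i01.
by rewrite integral_cst//= lebesgue_measure_itv/= lte_fin ltr01 oppr0 adde0 mule1.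
Qed.

(** Dominated convergence, with the constant [L] as bound, writes [G] as the integral of the limit
    of the [dphi k]; Lebesgue differentiation then recovers that limit as the derivative of [G]. *)
Lemma limit_ae_is_derive (phi dphi : nat -> R -> R) (G : R -> R) (L : R) :
  (forall k (t : R), is_derive t 1 (phi k) (dphi k t)) ->
  (forall k, continuous (dphi k)) ->
  (forall k t, `|dphi k t| <= L) ->
  (forall t : R, phi k t @[k --> \oo] --> G t) ->
  {ae mu, forall t : R, 0 < t < 1 -> cvgn (dphi ^~ t)} ->
  {ae mu, forall t : R, 0 < t < 1 -> is_derive t 1 G (limn (dphi ^~ t))}.
Proof.
move=> dp cd bd pG cv.
(* The upper limit is defined and measurable on the whole line and agrees with the limit wherever
   the latter exists. *)
pose g0 t := limn_sup (dphi ^~ t).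
have mg0 : measurable_fun setT g0.
  apply: measurable_fun_limn_sup => // [t _|t _|k].
  - by exists L => _ [k _ <-]; exact: le_trans (ler_norm _) (bd k t).
  - by exists (- L) => _ [k _ <-]; have := bd k t; rewrite ler_norml => /andP[].
  - exact: continuous_measurable_fun.
have intG t : 0 <= t <= 1 -> mu.-integrable `[0, t] (EFin \o g0) /\
    (\int[mu]_(x in `[0%R, t]) (g0 x)%:E = (G t - G 0)%:E)%E.
  move=> /andP[t0 t1].
  have mE (k : R -> R) : measurable_fun setT k ->
      measurable_fun (`[0, t]%classic : set (measurableTypeR R)) (EFin \o k).
    by move=> mk; apply: measurableT_comp => //; exact: measurable_funTS.
  have := @dominated_convergence _ _ R mu `[0, t]%classic (measurable_itv _)
    (fun k => EFin \o dphi k) (EFin \o g0) (cst L%:E).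
  case=> //.
  - by move=> k; apply: mE; exact: continuous_measurable_fun.
  - exact: mE.
  - apply: filterS2 ae_neq01 cv => x [x0 x1] cx /=.
    rewrite in_itv/= le_eqVlt eq_sym (negbTE x0)/= => /andP[x0' xt].
    have xlt1 : x < 1 by rewrite lt_neqAle x1 (le_trans xt).
    have {}cx : cvgn (dphi ^~ x) by apply: cx; rewrite x0' xlt1.
    by apply/cvg_EFin; [exact: nearW|rewrite /g0 cvg_limn_supE].
  - apply/integrableP; split => //.
    rewrite integral_cst//= lebesgue_measure_itv/=.
    by case: ifP => _; rewrite ?mule0 ?ltry// -EFinB -EFinM ltry.
  - by apply: nearW => x n _ /=; rewrite lee_fin.
  move=> ig _ cI; split => //.
  apply: (@cvg_unique _ _ _ _ _ _ cI) => //.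
  have [->|tn0] := eqVneq t 0.
    rewrite subrr set_itv1 (_ : (fun _ => _) = cst 0%E); first exact: cvg_cst.
    by apply/funext => k /=; rewrite integral_set1.
  have tgt0 : 0 < t by rewrite lt_neqAle eq_sym tn0.
  rewrite (_ : (fun _ => _) = (fun k => (phi k t - phi k 0)%:E)).
    apply/cvg_EFin; first exact: nearW.
    exact: cvgB (pG t) (pG 0).
  apply/funext => k; rewrite (continuous_FTC2 (F := phi k))// ?EFinB//.
  - by apply: continuous_subspaceT.
  - have cp x : {for x, continuous (phi k)}.
      by apply: differentiable_continuous; apply/derivable1_diffP.
    split; first by move=> x _; exact: ex_derive.
    + by apply: cvg_at_right_filter; exact: cp.
    + by apply: cvg_at_left_filter; exact: cp.
  - by move=> x _; rewrite derive1E; exact: (@derive_val _ _ _ _ _ _ _ (dp k x)).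
pose g := g0 \_ `[0, 1].
have ig : mu.-integrable setT (EFin \o g).
  have r01 : 0 <= (1 : R) <= 1 by rewrite lexx ler01.
  have [i1 _] := intG 1 r01.
  by rewrite /g -restrict_EFin; apply: (iffLR (integrable_mkcond _ _)) i1.
have Gg t : 0 <= t <= 1 -> G t = G 0 + (\int[mu]_(x in `[0, t]) g x)%R.
  move=> t01; have [_ h] := intG t t01; rewrite /Rintegral.
  rewrite (_ : integral _ _ _ = (\int[mu]_(x in `[0%R, t]) (g0 x)%:E)%E).
    by rewrite h/=; ring.
  apply: eq_integral => x; rewrite inE/= in_itv/= => /andP[x0 xt].
  rewrite /g patchE mem_set//= in_itv/= x0 (le_trans xt)//.
  by case/andP: t01.
apply: filterS2 cv (integral_ae_is_derive ig Gg) => t ct dt t01.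
have := dt t01; rewrite /g patchE mem_set/=; last first.
  by case/andP: t01 => t0 t1; rewrite in_itv/= !ltW.
by rewrite /g0 cvg_limn_supE//; exact: ct.
Qed.

End AlmostEverywhere.

(** * Null sets along coordinate lines *)

Section CountableUnion.
Context {d} {T : measurableType d}.

Lemma countType_bigcup_measurable (I : countType) (F : I -> set T) :
  (forall i, measurable (F i)) -> measurable (\bigcup_i F i).
Proof.
move=> mF; have -> : \bigcup_i F i =
    \bigcup_k (if unpickle k is Some i then F i else set0).
  apply/seteqP; split => [x [i _ Fi]|x [k _]].
    by exists (pickle i) => //; rewrite pickleK.
  by case: unpickle => // i Fi; exists i.
by apply: bigcupT_measurable => k; case: unpickle.
Qed.

Lemma countType_bigcap_measurable (I : countType) (F : I -> set T) :
  (forall i, measurable (F i)) -> measurable (\bigcap_i F i).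
Proof.
move=> mF; rewrite -(setCK (\bigcap_i F i)) setC_bigcap; apply: measurableC.
by apply: countType_bigcup_measurable => i; exact: measurableC.
Qed.

End CountableUnion.

Section ContinuousMeasurable.
Context {R : realType} {n : nat} {d} {T : measurableType d}.

(** The preimage of an open interval is a union, over the rational boxes contained in the open set
    [O], of sets cut out by coordinate conditions. Measurability is thus expressed through
    coordinates, without a sigma-algebra on row vectors. *)
Lemma measurable_fun_continuous_vec (F : 'rV[R]_n * R -> R) (phi : T -> 'rV[R]_n)
    (beta : T -> R) : continuous F ->
  (forall i, measurable_fun setT (fun w => phi w 0 i)) ->
  measurable_fun setT beta ->
  measurable_fun setT (fun w => F (phi w, beta w)).
Proof.
move=> cF mphi mbeta; apply: (measurability _ (RGenOpens.measurableE R)).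
move=> _ [_ [a [b ->] <-]]; rewrite setTI.
set O := F @^-1` `]a, b[%classic.
have oO : open O by move/continuousP : cF; apply; exact: interval_open.
pose r k : R := k.+1%:R^-1.
pose B (q : 'rV[rat]_n * rat * nat) : set ('rV[R]_n * R) :=
  [set x : 'rV[R]_n * R | (forall i : 'I_n, `|(ratr (q.1.1 0 i) : R) - x.1 0 i| < r q.2) /\
    `|(ratr q.1.2 : R) - x.2| < r q.2].
pose C q : set T := if `[< B q `<=` O >] then
  [set w | B q (phi w, beta w)] else set0.
have -> : (fun w => F (phi w, beta w)) @^-1` `]a, b[%classic = \bigcup_q C q.
  apply/seteqP; split => [w Ow|w [q _]]; last first.
    by rewrite /C; case: asboolP => // h /h.
  have : nbhs (phi w, beta w) O by exact: open_nbhs_nbhs.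
  rewrite -nbhs_ballE => -[e /= e0 eO].
  have [k ke] : exists k, r k < e / 2.
    near \oo => k; exists k; near: k.
    by apply: (near_infty_natSinv_lt (PosNum (divr_gt0 e0 (ltr0n _ 2)))).
  have r0 : 0 < r k by rewrite invr_gt0.
  have rat_near (x : R) : exists q : rat, `|ratr q - x| < r k.
    have [q] := rat_in_itvoo (ltr_pwDr r0 (lexx x)).
    rewrite in_itv/= => /andP[q1 q2]; exists q.
    by rewrite ltr_norml; apply/andP; split; lra.
  have [c hc] := choice rat_near.
  exists (\row_i c (phi w 0 i), c (beta w), k) => //.
  rewrite /C; case: asboolP => [_|].
    by split => [i|] /=; rewrite ?mxE.
  case => x [/= h1 h2]; apply: eO; split.
    split => // i j; rewrite (ord1 i) /ball/=.
    have := h1 j; rewrite mxE => h3; have := hc (phi w 0 j).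
    rewrite distrC => h4.
    rewrite -(subrKA (ratr (c (phi w 0 j)))) (le_lt_trans (ler_normD _ _))//.
    by move: h3 h4 ke; lra.
  have := hc (beta w); rewrite distrC => h4; rewrite /ball/=.
  rewrite -(subrKA (ratr (c (beta w)))) (le_lt_trans (ler_normD _ _))//.
  by move: h2 h4 ke; lra.
apply: countType_bigcup_measurable => q.
rewrite /C; case: ifP => // _.
have mlt (g : T -> R) (c : R) e : measurable_fun setT g ->
    measurable [set w | `|c - g w| < e].
  move=> mg; rewrite (_ : [set _ | _] = g @^-1` (ball c e)).
    by rewrite -[X in measurable X]setTI; apply: mg => //; exact: measurable_ball.
  by apply/seteqP; split => w.
rewrite (_ : [set w | _] = (\bigcap_i [set w | `|(ratr (q.1.1 0 i) : R) - phi w 0 i| < r q.2])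
   `&` [set w | `|(ratr q.1.2 : R) - beta w| < r q.2]); last first.
  by apply/seteqP; split => [w [h1 h2]|w [h1 h2]]; split => // i; [move=> _|]; apply: h1.
by apply: measurableI; [apply: countType_bigcap_measurable => i|]; exact: mlt.
Unshelve. all: by end_near. Qed.

End ContinuousMeasurable.

Section ProductNull.
Context {d1 d2} {T1 : measurableType d1} {T2 : measurableType d2} {R : realType}.
Variables (m1 : {sigma_finite_measure set T1 -> \bar R})
  (m2 : {sigma_finite_measure set T2 -> \bar R}).
Implicit Type A : set (T1 * T2).

(** Tonelli: the product measure is defined by integrating over the first factor, while several
    arguments below fix the second variable first. *)
Lemma product_measure_ysection A : measurable A ->
  (m1 \x m2)%E A = (\int[m2]_y m1 (ysection A y))%E.
Proof.
move=> mA; have := indic_fubini_tonelli m1 m2 mA.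
by rewrite indic_fubini_tonelli_FE// indic_fubini_tonelli_GE.
Qed.

Lemma product_null_ysection A : measurable A ->
  (forall y, m1 (ysection A y) = 0%E) -> (m1 \x m2)%E A = 0%E.
Proof.
move=> mA A0; rewrite product_measure_ysection//.
by under eq_integral do rewrite A0; rewrite integral0.
Qed.

Lemma product_null_xsection A : measurable A ->
  (forall x, m2 (xsection A x) = 0%E) -> (m1 \x m2)%E A = 0%E.
Proof.
move=> mA A0; rewrite /product_measure1.
by under eq_integral do rewrite /= A0; rewrite integral0.
Qed.

Lemma ae_xsection_null A : measurable A -> (m1 \x m2)%E A = 0%E ->
  {ae m1, forall x, m2 (xsection A x) = 0%E}.
Proof.
move=> mA A0.
have := (@ae_eq_integral_abs _ _ _ m1 setT measurableT (m2 \o xsection A)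
  (measurable_fun_xsection m2 mA)).1.
under eq_integral do rewrite gee0_abs//=.
move=> /(_ A0)[N [mN N0 sN]]; exists N; split => // x /= h.
by apply: sN => /= h'; apply: h; exact: h'.
Qed.

End ProductNull.

(** * Uniform probability on boxes *)

Section BoxMeasure.
Context {R : realType} {n : nat}.

(** Tuples carry the product sigma-algebra and row vectors the norm; [vec] passes from the former to
    the latter. *)
Definition vec (w : n.-tuple R) : 'rV[R]_n := \row_i tnth w i.

Definition unif01 : probability (measurableTypeR R) R := uniform_prob (@ltr01 R).

(** The coordinate is a natural number so that [box_prob] can recurse on it; for [k >= n] nothing
    moves. *)
Definition shift_coord (k : nat) (s : R) (w : n.-tuple R) (t : R) : n.-tuple R :=
  [tuple tnth w i + (if i == k :> nat then s * t else 0) | i < n].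

Lemma tnth_shift k s w t i :
  tnth (shift_coord k s w t) i = tnth w i + (if i == k :> nat then s * t else 0).
Proof. by rewrite tnth_mktuple. Qed.

Definition shift_pair k s (z : n.-tuple R * measurableTypeR R) := shift_coord k s z.1 z.2.

Lemma measurable_shift_pair k s : measurable_fun setT (shift_pair k s).
Proof.
apply/measurable_fun_tnthP => i.
rewrite (_ : _ \o _ = (fun z : n.-tuple R * measurableTypeR R =>
  tnth z.1 i + (if i == k :> nat then s * z.2 else 0))); last first.
  by apply/funext => z /=; rewrite tnth_shift.
apply: measurable_funD.
  by apply: (measurableT_comp (measurable_tnth i)).
case: eqP => _ //.
apply: measurable_funM => //.
Qed.

HB.instance Definition _ k s := isMeasurableFun.Build _ _ _ _ (shift_pair k s)
  (measurable_shift_pair k s).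

(* Uniform on [a + [0, s]^k x {0}^(n - k)], built one coordinate at a time so that
   Fubini applies along every coordinate line. *)
Fixpoint box_prob (a : n.-tuple R) (s : R) (k : nat) : probability (n.-tuple R) R :=
  match k with
  | 0 => \d_a
  | j.+1 => distribution (box_prob a s j \x unif01)%E (shift_pair j s)
  end.

Lemma box_probS a s k A :
  box_prob a s k.+1 A = (box_prob a s k \x unif01)%E (shift_pair k s @^-1` A).
Proof. by []. Qed.

Lemma unif01E A : measurable A -> unif01 A = lebesgue_measure (A `&` `[0, 1]%classic).
Proof.
move=> mA; rewrite /unif01/= /uniform_prob integral_uniform_pdf.
have mI : measurable (A `&` `[0%R, 1%R]%classic : set (measurableTypeR R)).
  by apply: measurableI => //; exact: (measurable_itv `[0%R, 1%R]).
rewrite (eq_integral (cst 1%E)); first by rewrite integral_cst// mul1e.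
move=> x; rewrite inE => -[_ /=]; rewrite in_itv/= /uniform_pdf => ->.
by rewrite subr0 invr1.
Qed.

Lemma unif01_ae_null (P : R -> Prop) : measurable (~` [set t | P t]) ->
  {ae lebesgue_measure, forall t : R, 0 < t < 1 -> P t} ->
  unif01 (~` [set t | P t]) = 0%E.
Proof.
move=> mP aeP; rewrite unif01E//; apply/eqP; rewrite eq_le measure_ge0 andbT.
have [N [mN N0 sN]] : {ae lebesgue_measure, forall t : R, 0 <= t <= 1 -> P t}.
  apply: filterS2 ae_neq01 aeP => t [t0 t1] h /andP[t0' t1']; apply: h.
  by rewrite !lt_neqAle t0' t1' (eq_sym 0) t0 t1.
rewrite -N0; apply: le_measure; rewrite ?inE//.
  by apply: measurableI => //; exact: measurable_itv.
move=> t [/= nPt]; rewrite in_itv/= => t01; apply: sN => /= h; exact/nPt/h.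
Qed.

Lemma shiftC j k s w t u : shift_coord k s (shift_coord j s w u) t = shift_coord j s (shift_coord k s w t) u.
Proof. by apply/eq_from_tnth => i; rewrite !tnth_shift addrAC. Qed.

Lemma measurable_shift_pre k s A : measurable A -> measurable (shift_pair k s @^-1` A).
Proof. by move=> mA; rewrite -[X in measurable X]setTI; exact: measurable_shift_pair. Qed.

(** Coordinate [j] is drawn uniformly and independently of the others. When it is the last one
    drawn, the assumption concerns exactly the sections of the product; coordinates drawn later are
    frozen, since shifts commute. *)
Lemma box_prob_null a s j k A : (j < k)%N -> measurable A ->
  (forall w, unif01 [set t | A (shift_coord j s w t)] = 0%E) -> box_prob a s k A = 0%E.
Proof.
elim: k A => // k IH A; rewrite ltnS leq_eqVlt => /predU1P[<-|jk] mA A0.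
  rewrite box_probS; apply: product_null_xsection.
    exact: measurable_shift_pre.
  move=> w; rewrite -[RHS](A0 w); congr (unif01 _).
  by apply/seteqP; split => t; rewrite /xsection /= inE.
rewrite box_probS; apply: product_null_ysection.
  exact: measurable_shift_pre.
move=> t; apply: IH => //.
  by apply: measurable_ysection; exact: measurable_shift_pre.
move=> w; rewrite -[RHS](A0 (shift_coord k s w t)); congr (unif01 _).
by apply/seteqP; split => u; rewrite /ysection /= inE /shift_pair/= shiftC.
Qed.

Definition box (c : n.-tuple R) (r : R) : set (n.-tuple R) :=
  [set w | forall i, tnth c i <= tnth w i < tnth c i + r].

Lemma measurable_box c r : measurable (box c r).
Proof.
rewrite (_ : box c r = \bigcap_(i : 'I_n) (fun w : n.-tuple R => tnth w i) @^-1`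
    `[tnth c i, tnth c i + r[%classic); last first.
  apply/seteqP; split => w /= h i; first by move=> _ /=; rewrite in_itv/=.
  by have := h i Logic.I; rewrite /= in_itv.
apply: countType_bigcap_measurable => i; rewrite -[X in measurable X]setTI.
by apply: measurable_tnth => //; exact: measurable_itv.
Qed.

(** After [k] steps the first [k] coordinates are uniform on intervals of length [s], whence the
    power of [r / s], while the others still equal those of [a]; this is the case distinction in the
    assumption. *)
Lemma box_prob_box_ge a s c r k : (k <= n)%N -> 0 < s -> 0 < r ->
  (forall i : 'I_n, if (i < k)%N then
     tnth a i <= tnth c i /\ tnth c i + r <= tnth a i + s
   else tnth c i <= tnth a i < tnth c i + r) ->
  (((r / s) ^+ k)%:E <= box_prob a s k (box c r))%E.
Proof.
move=> + s0 r0; elim: k c => [|k IH] c kn ac.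
  by rewrite expr0 /= diracE mem_set.
rewrite box_probS product_measure_ysection; last first.
  by apply: measurable_shift_pre; exact: measurable_box.
pose k0 := Ordinal kn.
have [a1 a2] : tnth a k0 <= tnth c k0 /\ tnth c k0 + r <= tnth a k0 + s.
  by have := ac k0; rewrite ltnSn.
set u := (tnth c k0 - tnth a k0) / s.
have ur : u + r / s <= 1.
  by rewrite /u -mulrDl ler_pdivrMr// mul1r; lra.
have u0 : 0 <= u by rewrite divr_ge0 ?(ltW s0)// subr_ge0.
have rs0 : 0 < r / s by rewrite divr_gt0.
pose J := `[u, u + r / s[%classic : set (measurableTypeR R).
have mJ : measurable J by exact: (measurable_itv `[u, u + r / s[).
have UJ : unif01 J = (r / s)%:E.
  rewrite unif01E// setIidl.
    by rewrite lebesgue_measure_itv/= lte_fin ltrDl rs0 -EFinB addrAC subrr add0r.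
  move=> t /=; rewrite !in_itv/= => /andP[t1 t2].
  by rewrite (le_trans u0)//= (le_trans (ltW t2)).
apply: (@le_trans _ _ (\int[unif01]_(t in J) ((r / s) ^+ k)%:E)%E).
  by rewrite integral_cst// [X in (_ * X)%E]UJ -EFinM -exprSr.
have mf : measurable_fun setT (fun t => box_prob a s k
    (ysection (shift_pair k s @^-1` box c r) t)).
  apply: measurable_fun_ysection.
  by apply: measurable_shift_pre; exact: measurable_box.
apply: (@le_trans _ _ (\int[unif01]_(t in J) box_prob a s k
    (ysection (shift_pair k s @^-1` box c r) t))%E); last first.
  exact: ge0_subset_integral.
apply: ge0_le_integral => //.
- by move=> t _; rewrite lee_fin exprn_ge0// ltW.
- exact: measurable_funS mf.
move=> t; rewrite /J/= in_itv/= => /andP[t1 t2].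
(* Freezing the variable of coordinate [k] at [t] moves the box back by [s * t] in that coordinate;
   for [t] in [J] the coordinate of [a] falls inside the moved box. *)
pose c' := shift_coord k s c (- t).
have -> : ysection (shift_pair k s @^-1` box c r) t = box c' r.
  apply/seteqP; split => w; rewrite /ysection/= inE /shift_pair/=;
    move=> h i; have := h i; rewrite !tnth_shift; case: eqP => // _; lra.
apply: IH => [|i]; first exact: ltnW.
have := ac i; rewrite /c' tnth_shift ltnS leq_eqVlt.
case: eqP => [ik _|_] /=; last by rewrite addr0.
have -> : i = k0 by exact: val_inj.
rewrite ltnn; move: t1 t2; rewrite /u -mulrDl ler_pdivrMr// ltr_pdivlMr//.
by move=> t1 t2; apply/andP; split; lra.
Qed.

End BoxMeasure.

(** * Convexity and the proximal envelope *)

Section Dot.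
Context {R : realType} {n : nat}.
Implicit Types x y z v : 'rV[R]_n.

Definition dot x y : R := \sum_i x 0 i * y 0 i.

Lemma dotC x y : dot x y = dot y x.
Proof. by apply: eq_bigr => i _; rewrite mulrC. Qed.

Lemma dotDl x y z : dot (x + y) z = dot x z + dot y z.
Proof. by rewrite /dot -big_split; apply: eq_bigr => i _; rewrite mxE mulrDl. Qed.

Lemma dotZl (a : R) x y : dot (a *: x) y = a * dot x y.
Proof. by rewrite /dot mulr_sumr; apply: eq_bigr => i _; rewrite mxE mulrA. Qed.

Lemma dotNl x y : dot (- x) y = - dot x y.
Proof. by rewrite -scaleN1r dotZl mulN1r. Qed.

Lemma dotBl x y z : dot (x - y) z = dot x z - dot y z.
Proof. by rewrite dotDl dotNl. Qed.

Lemma dotDr x y z : dot z (x + y) = dot z x + dot z y.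
Proof. by rewrite !(dotC z) dotDl. Qed.

Lemma dotZr (a : R) x y : dot y (a *: x) = a * dot y x.
Proof. by rewrite !(dotC y) dotZl. Qed.

Lemma dotNr x y : dot y (- x) = - dot y x.
Proof. by rewrite !(dotC y) dotNl. Qed.

Lemma dotBr x y z : dot z (x - y) = dot z x - dot z y.
Proof. by rewrite dotDr dotNr. Qed.

Lemma dot0l x : dot 0 x = 0.
Proof. by rewrite -(scale0r x) dotZl mul0r. Qed.

Lemma dot0r x : dot x 0 = 0.
Proof. by rewrite dotC dot0l. Qed.

Lemma dot_ge0 x : 0 <= dot x x.
Proof. by apply: sumr_ge0 => i _; rewrite -expr2 sqr_ge0. Qed.

Lemma dot_eq0 x : dot x x = 0 -> x = 0.
Proof.
move=> /eqP; rewrite psumr_eq0 => [/allP h|i _]; last by rewrite -expr2 sqr_ge0.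
apply/rowP => i; rewrite mxE; apply/eqP.
by have := h i (mem_index_enum i); rewrite -expr2 sqrf_eq0.
Qed.

Lemma enorm_sqr x : enorm x ^+ 2 = dot x x.
Proof.
rewrite /enorm sqr_sqrtr; first by apply: eq_bigr => i _; rewrite expr2.
by apply: sumr_ge0 => i _; exact: sqr_ge0.
Qed.

Lemma enorm_ge0 x : 0 <= enorm x.
Proof. exact: sqrtr_ge0. Qed.

Definition dotE := (dotDl, dotDr, dotBl, dotBr, dotZl, dotZr, dotNl, dotNr).

(** Cauchy-Schwarz, from the nonnegative square of [dot y y *: x - dot x y *: y]. *)
Lemma dot_enorm x y : dot x y <= enorm x * enorm y.
Proof.
have [y0|y0] := eqVneq y 0.
  by rewrite y0 dot0r mulr_ge0 ?enorm_ge0.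
have yy : 0 < dot y y.
  by rewrite lt_neqAle dot_ge0 andbT eq_sym; apply: contra y0 => /eqP/dot_eq0->.
have := dot_ge0 (dot y y *: x - dot x y *: y).
rewrite !dotE (dotC y x) => h.
rewrite (le_trans (ler_norm _))// -[leRHS]ger0_norm ?mulr_ge0 ?enorm_ge0//.
rewrite -ler_sqr ?nnegrE// !real_normK ?num_real// exprMn !enorm_sqr.
by rewrite -(ler_pM2r yy); nra.
Qed.

Lemma enorm_le_dot (a : R) x : 0 <= a -> (enorm x <= a) = (dot x x <= a ^+ 2).
Proof. by move=> a0; rewrite -enorm_sqr ler_sqr ?nnegrE ?enorm_ge0. Qed.

Lemma coord_le_enorm x i : `|x 0 i| <= enorm x.
Proof.
rewrite -ler_sqr ?nnegrE ?enorm_ge0// real_normK ?num_real// enorm_sqr /dot (bigD1 i)//= -expr2.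
by rewrite lerDl sumr_ge0// => j _; rewrite -expr2 sqr_ge0.
Qed.

Lemma dot_le_coord x (e : R) : (forall i, `|x 0 i| <= e) -> dot x x <= n%:R * e ^+ 2.
Proof.
move=> xe; apply: (@le_trans _ _ (\sum_(i < n) e ^+ 2)).
  apply: ler_sum => i _; rewrite -expr2 -real_normK ?num_real// ler_sqr ?nnegrE//.
  exact: le_trans (xe i).
by rewrite sumr_const card_ord mulr_natl.
Qed.

End Dot.

Section OneDim.
Context {R : realType}.

Lemma mvt01 (f df : R -> R) : (forall t : R, is_derive t 1 f (df t)) ->
  exists2 c, 0 < c < 1 & f 1 - f 0 = df c.
Proof.
move=> fd; have [|c] := @MVT R f df 0 1 ltr01 (fun t _ => fd t).
  apply: derivable_within_continuous => t _; exact: (@ex_derive _ _ _ _ _ _ _ (fd t)).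
by rewrite in_itv/= subr0 mulr1 => c01 ->; exists c.
Qed.

(** A form without division, in which [h = 0] is allowed; most estimates of derivatives below are
    carried out in it. *)
Lemma is_derive_epsP {V : normedModType R} (f : V -> R) (a v : V) (d : R) :
  is_derive a v f d <-> forall e : R, 0 < e -> exists2 r : R, 0 < r &
    forall h : R, `|h| < r -> `|f (a + h *: v) - f a - d * h| <= e * `|h|.
Proof.
set q := fun h : R => h^-1 *: ((f \o shift a) (h *: v) - f a).
have qE (h : R) : h != 0 -> f (a + h *: v) - f a - d * h = - (d - q h) * h.
  move=> h0; have -> : q h = h^-1 * (f (a + h *: v) - f a).
    by rewrite /q /shift/= (addrC _ a).
  by field.
have -> : is_derive a v f d <-> q @ 0^' --> d.
  split=> [[df <-]|qd]; first exact: df.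
  by split; [apply/cvg_ex; exists d|exact/cvg_lim].
split=> [qd e e0|H].
  have /cvgrPdist_le/(_ e e0) := qd; rewrite near_withinE -nbhs_ballE => -[r /= r0 rH].
  exists r => // h hr; have [->|h0] := eqVneq h 0.
    by rewrite scale0r addr0 subrr mulr0 subr0 normr0 mulr0.
  rewrite qE// normrM normrN ler_wpM2r//; apply: rH => //.
  by rewrite /ball/= sub0r normrN.
apply/cvgrPdist_le => e e0; have [r r0 rH] := H e e0.
rewrite near_withinE -nbhs_ballE; exists r => //= h.
rewrite /ball/= sub0r normrN => hr h0.
by have := rH h hr; rewrite qE// normrM normrN ler_pM2r// normr_gt0.
Qed.

Lemma is_derive_quadratic (a b t : R) :
  is_derive t 1 (fun s => a * s + b * s ^+ 2) (a + 2 * b * t).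
Proof.
apply/is_derive_epsP => e e0; have b0 : 0 < `|b| + 1 by rewrite ltr_wpDl.
exists (e / (`|b| + 1)); first by rewrite divr_gt0.
move=> h; rewrite ltr_pdivlMr// [h *: 1]mulr1 => hb.
rewrite (_ : _ - _ = b * h * h); last by ring.
rewrite !normrM ler_wpM2r// mulrC (le_trans _ (ltW hb))// ler_wpM2l//.
by rewrite lerDl.
Qed.

Lemma derive_le0_right_max (f : R -> R) (d : R) : is_derive (0 : R) 1 f d ->
  (forall t, 0 < t <= 1 -> f t <= f 0) -> d <= 0.
Proof.
move=> /is_derive_epsP fd fle; apply/ler_addgt0Pr => e e0; rewrite add0r.
have [r r0 H] := fd e e0.
pose h := Num.min (r / 2) 1.
have h0 : 0 < h by rewrite lt_min ltr01 divr_gt0.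
have hr : `|h| < r.
  by rewrite gtr0_norm// gt_min; apply/orP; left; lra.
have := H h hr; rewrite add0r [h *: 1]mulr1 (gtr0_norm h0) ler_norml => /andP[h1 _].
have := fle h; rewrite h0 ge_min lexx orbT => /(_ isT) h2.
by rewrite -(ler_pM2r h0); lra.
Qed.

End OneDim.

Section Gradient.
Context {R : realType} {n : nat}.
Implicit Types (f : 'rV[R]_n -> R) (x v : 'rV[R]_n).

Lemma derive_gradient f x v : differentiable f x -> 'D_v f x = dot (gradient f x) v.
Proof.
move=> df; rewrite deriveE// {1}(row_sum_delta v) linear_sum.
apply: eq_bigr => i _; rewrite linearZ/= mxE deriveE//.
by rewrite mulrC.
Qed.

Lemma is_derive_line f x v t : differentiable f (x + t *: v) ->
  is_derive t 1 (fun s => f (x + s *: v)) (dot (gradient f (x + t *: v)) v).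
Proof.
move=> df.
have /is_derive_epsP dv : is_derive (x + t *: v) v f (dot (gradient f (x + t *: v)) v).
  by split; [exact: diff_derivable|exact: derive_gradient].
apply/is_derive_epsP => e e0; have [r r0 H] := dv e e0; exists r => // h /H.
by rewrite [h *: 1]mulr1 scalerDl addrA.
Qed.

Lemma strongly_convexP (mu : R) f x v (t : R) : strongly_convex mu f -> 0 <= t <= 1 ->
  f (x + t *: v) <= f x + t * (f (x + v) - f x) - mu / 2 * (t * (1 - t)) * dot v v.
Proof.
move=> cf t01; have /andP[t0 t1] := t01.
pose i : {i01 R} := Itv01 t0 t1.
have := cf i (x + v) x (in_setT _) (in_setT _).
have -> : conv i (x + v : convex_lmodType _) x = x + t *: v.
  transitivity (t *: (x + v) + (1 - t) *: x : 'rV[R]_n); first by [].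
  by apply/rowP => j; rewrite !mxE; ring.
have -> a b : conv i (a : R^o) b = t * a + (1 - t) * b by [].
rewrite !enorm_sqr !dotE (dotC v x).
by move=> h; nra.
Qed.

(** Up to a constant, [psi] is [f] along the segment minus the chord with its quadratic correction.
    Strong convexity puts its maximum over [[0, 1]] at 0, so its derivative there is nonpositive. *)
Lemma strongly_convex_gradient (mu : R) f x x' : (forall z, differentiable f z) ->
  strongly_convex mu f ->
  f x + dot (gradient f x) (x' - x) + mu / 2 * dot (x' - x) (x' - x) <= f x'.
Proof.
move=> df cf; set v := x' - x.
pose psi (t : R) := f (x + t *: v) +
  ((f x - f x' + mu / 2 * dot v v) * t + (- (mu / 2 * dot v v)) * t ^+ 2).
have dpsi : is_derive (0 : R) 1 psi
    (dot (gradient f x) v + ((f x - f x') + mu / 2 * dot v v)).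
  apply: is_deriveD.
    by have := @is_derive_line f x v 0; rewrite scale0r addr0; apply.
  have := is_derive_quadratic (f x - f x' + mu / 2 * dot v v) (- (mu / 2 * dot v v)) 0.
  by rewrite mulr0 addr0.
have := derive_le0_right_max dpsi.
have psile t : 0 < t <= 1 -> psi t <= psi 0.
  move=> /andP[t0 t1]; rewrite /psi scale0r addr0.
  have := @strongly_convexP mu f x v t cf; rewrite t1 (ltW t0) => /(_ isT).
  have -> : x + v = x' by rewrite /v addrC subrK.
  lra.
by move=> /(_ psile); lra.
Qed.

(** Descent lemma: at every [c] in []0, 1[] the derivative of [phi] is nonpositive, since the
    gradient has moved by at most [l * c * enorm v]; the mean value theorem concludes. *)
Lemma descent_gradient (l : R) f x v : (forall z, differentiable f z) ->
  0 <= l -> lipschitz_gradient l f ->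
  f (x + v) <= f x + dot (gradient f x) v + l / 2 * dot v v.
Proof.
move=> df l0 lf.
pose phi (t : R) := f (x + t *: v) +
  (- dot (gradient f x) v * t + (- (l / 2 * dot v v)) * t ^+ 2).
pose dphi (t : R) := dot (gradient f (x + t *: v)) v +
  (- dot (gradient f x) v + 2 * - (l / 2 * dot v v) * t).
have dp (t : R) : is_derive t 1 phi (dphi t).
  apply: is_deriveD; first exact: is_derive_line.
  exact: is_derive_quadratic.
have [c /andP[c0 c1] h] := mvt01 dp.
move: h; rewrite /phi /dphi scale1r scale0r addr0 => h.
have := dot_enorm (gradient f (x + c *: v) - gradient f x) v.
have := lf (x + c *: v) x; rewrite addrAC subrr add0r => h1.
have h2 : enorm (c *: v) = c * enorm v.
  apply/eqP; rewrite -(eqrXn2 (n := 2))// ?enorm_ge0 ?mulr_ge0 ?enorm_ge0 ?(ltW c0)//.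
  by rewrite exprMn !enorm_sqr !dotE; apply/eqP; ring.
rewrite h2 in h1; rewrite dotBl => h3.
have h4 : enorm v ^+ 2 = dot v v := enorm_sqr v.
have := ler_wpM2r (enorm_ge0 v) h1; rewrite -h4 in h *.
by nra.
Qed.

End Gradient.

Section EuclideanNorm.
Context {R : realType} {n : nat}.
Implicit Types x y : 'rV[R]_n.

Lemma enorm_le_add x y : enorm (x + y) <= enorm x + enorm y.
Proof.
rewrite enorm_le_dot ?addr_ge0 ?enorm_ge0// !dotE (dotC y x) sqrrD !enorm_sqr.
by have := dot_enorm x y; lra.
Qed.

Lemma enormZ (a : R) x : enorm (a *: x) = `|a| * enorm x.
Proof.
apply/eqP; rewrite -(eqrXn2 (n := 2))// ?enorm_ge0 ?mulr_ge0 ?enorm_ge0//.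
by rewrite exprMn real_normK ?num_real// !enorm_sqr !dotE; apply/eqP; ring.
Qed.

Lemma enormN x : enorm (- x) = enorm x.
Proof. by rewrite -scaleN1r enormZ normrN1 mul1r. Qed.

Lemma enorm_sub_sym x y : enorm (x - y) = enorm (y - x).
Proof. by rewrite -enormN opprB. Qed.

Lemma dot_delta x j : dot x (delta_mx 0 j) = x 0 j.
Proof.
rewrite /dot (bigD1 j)//= big1 => [|i ij]; rewrite mxE eqxx/=.
  by rewrite eqxx mulr1 addr0.
by rewrite (negbTE ij) mulr0.
Qed.

Lemma rnorm_le x (e : R) : 0 <= e -> (forall i, `|x 0 i| <= e) -> `|x| <= e.
Proof.
move=> e0 xe; rewrite -[`|x|]/(mx_norm x) mx_normrE; apply/bigmax_leP; split => //.
by move=> [i j] _ /=; rewrite (ord1 i).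
Qed.

Lemma coord_le_rnorm x i : `|x 0 i| <= `|x|.
Proof.
rewrite -[`|x|]/(mx_norm x) mx_normrE.
exact: (le_bigmax _ (fun ij : 'I_1 * 'I_n => `|x ij.1 ij.2|) (0, i)).
Qed.

Lemma rnorm_le_enorm x : `|x| <= enorm x.
Proof. by apply: rnorm_le => [|i]; [exact: enorm_ge0|exact: coord_le_enorm]. Qed.

Lemma enorm_le_rnorm x : enorm x <= n%:R * `|x|.
Proof.
rewrite enorm_le_dot ?mulr_ge0//.
apply: (le_trans (dot_le_coord (coord_le_rnorm x))).
rewrite exprMn ler_wpM2r ?sqr_ge0// -natrX ler_nat.
by case: (n) => // k; rewrite expnS expn1 leq_pmulr.
Qed.

Lemma cvg_sumr {T : Type} {F : set_system T} {FF : Filter F} {I : Type} (r : seq I)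
    (f : I -> T -> R) (a : I -> R) : (forall i, f i x @[x --> F] --> a i) ->
  (\sum_(i <- r) f i x) @[x --> F] --> \sum_(i <- r) a i.
Proof.
move=> fa; elim: r => [|i r IH].
  under eq_fun do rewrite big_nil.
  by rewrite big_nil; exact: cvg_cst.
under eq_fun do rewrite big_cons.
by rewrite big_cons; apply: cvgD.
Qed.

Lemma cvg_coord {T : Type} {F : set_system T} {FF : Filter F} (f : T -> 'rV[R]_n)
  (a : 'rV[R]_n) i : f @ F --> a -> f x 0 i @[x --> F] --> a 0 i.
Proof.
move=> fa; apply: (@cvg_comp _ _ _ f (fun M : 'rV[R]_n => M 0 i) _ _ _ fa).
exact: coord_continuous.
 Qed.

Lemma cvg_dot {T : Type} {F : set_system T} {FF : Filter F} (f g : T -> 'rV[R]_n)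
    (a b : 'rV[R]_n) : f @ F --> a -> g @ F --> b ->
  dot (f x) (g x) @[x --> F] --> dot a b.
Proof. by move=> fa gb; apply: cvg_sumr => i; apply: cvgM; exact: cvg_coord. Qed.

Lemma cvg_enorm0 {T : Type} {F : set_system T} {FF : Filter F} (f : T -> 'rV[R]_n)
  (a : 'rV[R]_n) : f @ F --> a <-> enorm (f x - a) @[x --> F] --> (0 : R).
Proof.
split=> [fa|fa].
  apply/cvgrPdist_le => e e0.
  have n0 : 0 < n%:R + 1 :> R by rewrite ltr_wpDl.
  have e1 : 0 < e / (n%:R + 1) by rewrite divr_gt0.
  move/cvgrPdist_le : fa => /(_ _ e1); apply: filterS => x xe.
  rewrite sub0r normrN ger0_norm ?enorm_ge0// enorm_sub_sym.
  apply: (le_trans (enorm_le_rnorm _)).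
  move: xe; rewrite ler_pdivlMr// => xe; apply: le_trans xe.
  by rewrite mulrC ler_wpM2l// lerDl.
apply/cvgrPdist_le => e e0.
move/cvgrPdist_le : fa => /(_ _ e0); apply: filterS => x.
rewrite sub0r normrN ger0_norm ?enorm_ge0// enorm_sub_sym; apply: le_trans.
exact: rnorm_le_enorm.
Qed.

End EuclideanNorm.

(** * The proximal map *)

Section Prox.
Context {R : realType} {n m : nat}.
Variables (S : 'rV[R]_n -> 'rV[R]_m -> R) (rho mu : R).
Hypotheses (hcc : convex_concave S) (hC1 : continuously_differentiable S).
Hypotheses (hrho : 0 < rho) (hmu : 0 < mu).
Hypothesis ha_sc : forall y, strongly_convex mu (fun x => S x y).
Local Notation T := (prox_envelope rho S).
Local Notation xt := (prox_point rho S).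
Local Notation obj := (prox_objective rho S).

Lemma differentiable_left y x : differentiable (fun x => S x y) x.
Proof.
have [dS _] := hC1.
exact: (@differentiable_comp _ _ _ _ (fun x => (x, y)) (fun w => S w.1 w.2)).
Qed.

Lemma differentiable_right x y : differentiable (S x) y.
Proof.
have [dS _] := hC1.
exact: (@differentiable_comp _ _ _ _ (fun y => (x, y)) (fun w => S w.1 w.2)).
Qed.

Lemma continuous_grad_x : continuous (fun w : 'rV[R]_n * 'rV[R]_m => grad_x S w.1 w.2).
Proof.
move=> w; have [_ cS] := hC1.
apply: (@continuous_comp _ _ _ (full_gradient S) fst w (cS w)).
by case: (full_gradient S w) => a b; exact: cvg_fst.
 Qed.

Lemma continuous_grad_y : continuous (fun w : 'rV[R]_n * 'rV[R]_m => grad_y S w.1 w.2).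
Proof.
move=> w; have [_ cS] := hC1.
apply: (@continuous_comp _ _ _ (full_gradient S) snd w (cS w)).
by case: (full_gradient S w) => a b; exact: cvg_snd.
 Qed.

Lemma left_ge x x' y :
  S x y + dot (grad_x S x y) (x' - x) + mu / 2 * dot (x' - x) (x' - x) <= S x' y.
Proof.
exact: (strongly_convex_gradient x x' (differentiable_left y) (ha_sc y)).
Qed.

Lemma right_le x y y' : S x y' <= S x y + dot (grad_y S x y) (y' - y).
Proof.
have [_ /(_ x) cS] := hcc.
have sc0 : strongly_convex 0 (fun y => - S x y).
  move: cS; rewrite /strongly_convex; congr (convex_function _ _).
  by apply/funext => z; rewrite !mul0r subr0.
have dN z : differentiable (fun y => - S x y) z.
  by apply: differentiableN; exact: differentiable_right.
have := strongly_convex_gradient y y' dN sc0.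
have -> : gradient (fun y => - S x y) y = - grad_y S x y.
  apply/rowP => j; rewrite !mxE deriveN//.
  by apply: diff_derivable; exact: differentiable_right.
by rewrite dotNl !mul0r addr0; lra.
Qed.

Lemma grad_x_monotone x x' y :
  mu * dot (x' - x) (x' - x) <= dot (grad_x S x' y - grad_x S x y) (x' - x).
Proof.
have h1 := left_ge x x' y; have h2 := left_ge x' x y.
have e : x - x' = - (x' - x) by rewrite opprB.
by rewrite e !dotNr !dotNl opprK in h2; rewrite dotBl; lra.
Qed.

Lemma prox_objective_continuous u y : continuous (obj u y).
Proof.
have -> : obj u y = (fun x => S x y + rho / 2 * dot (x - u) (x - u)).
  by apply/funext => x; rewrite /prox_objective enorm_sqr.
move=> x.
have FF : Filter (nbhs x) := nbhs_filter x.
have h1 : (fun x => S x y) z @[z --> nbhs x] --> S x y.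
  exact: (differentiable_continuous (differentiable_left y x)).
have h3 : (fun x => x - u) z @[z --> nbhs x] --> x - u.
  by apply: (@cvgB _ _ _ (nbhs x) FF id (cst u)); [exact: cvg_id|exact: cvg_cst].
have h2 : rho / 2 * dot (z - u) (z - u) @[z --> nbhs x] --> rho / 2 * dot (x - u) (x - u).
  by apply: cvgMl_tmp; exact: cvg_dot.
exact: (cvgD h1 h2).
Qed.

(** Quadratic growth around a critical point: the hypothesis says that the gradient of the objective
    vanishes at [x], and the objective is [(mu + rho)]-strongly convex. *)
Lemma prox_objective_dist u x y z : grad_x S x y = rho *: (u - x) ->
  obj u y x + (mu + rho) / 2 * dot (z - x) (z - x) <= obj u y z.
Proof.
move=> gE; have := left_ge x z y; rewrite gE /prox_objective !enorm_sqr.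
have -> : z - u = (z - x) - (u - x) by rewrite opprB addrA subrK.
rewrite -(opprB u x); move: (z - x) (u - x) => d e.
by rewrite !dotE (dotC e d); lra.
Qed.

Lemma prox_exists u y : exists x, forall z, obj u y x <= obj u y z.
Proof.
set g := grad_x S u y.
(* Beyond this distance from [u] the quadratic term of the strong convexity bound outweighs the
   linear term in [g], so a minimizer over the cube [A] is a global one. *)
pose r := 2 * enorm g / (mu + rho).
have mr0 : 0 < mu + rho by exact: addr_gt0.
have r0 : 0 <= r by rewrite divr_ge0 ?mulr_ge0 ?enorm_ge0 ?(ltW mr0).
pose A : set 'rV[R]_n := [set x | forall i, `[u 0 i - r, u 0 i + r]%classic (x 0 i)].
have Au : A u by move=> i /=; rewrite in_itv/=; apply/andP; split; lra.
have cA : compact A.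
  apply: (@rV_compact R n (fun i => `[u 0 i - r, u 0 i + r]%classic)) => i.
  exact: segment_compact.
have [|x /set_mem Ax xmin] := EVT_min_rV _ cA
  (continuous_subspaceT (prox_objective_continuous (u := u) (y := y))).
  by exists u.
exists x => z; have [Az|nAz] := pselect (A z); first by apply: xmin; rewrite inE.
apply: (le_trans (xmin u _)); first by rewrite inE.
have rz : r < enorm (z - u).
  move/existsNP : nAz => [i]; rewrite /= in_itv/= => h.
  apply: lt_le_trans (coord_le_enorm (z - u) i).
  rewrite !mxE ltNge ler_norml; apply/negP => /andP[h1 h2]; apply: h.
  by apply/andP; split; lra.
have := left_ge u z y; rewrite -/g /prox_objective subrr !enorm_sqr dot0l mulr0 addr0.
have := dot_enorm (- g) (z - u); rewrite dotNl enormN => h1 h2.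
have e0 := enorm_ge0 (z - u).
have h3 : 2 * enorm g <= (mu + rho) * enorm (z - u).
  by move: rz; rewrite /r ltr_pdivrMr// (mulrC _ (mu + rho)) => /ltW.
have h4 := ler_wpM2r e0 h3.
have h5 := enorm_sqr (z - u).
by rewrite -h5 in h2 *; nra.
Qed.

Lemma is_derive_sqdist (x u v : 'rV[R]_n) :
  is_derive (0 : R) 1 (fun t => rho / 2 * dot (x + t *: v - u) (x + t *: v - u))
    (rho * dot (x - u) v).
Proof.
set w := x - u.
have -> : (fun t => rho / 2 * dot (x + t *: v - u) (x + t *: v - u)) =
    (fun t => rho / 2 * dot w w + (rho * dot w v * t + rho / 2 * dot v v * t ^+ 2)).
  apply/funext => t; rewrite addrAC -/w; move: w => z.
  by rewrite !dotE (dotC v z); field.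
have d1 := is_derive_quadratic (rho * dot w v) (rho / 2 * dot v v) 0.
have d2 := is_deriveD (is_derive_cst (rho / 2 * dot w w) (0 : R) 1) d1.
apply: (is_derive_eq d2); ring.
Qed.

Lemma prox_opt u y : grad_x S (xt u y) y = rho *: (u - xt u y).
Proof.
have xmin : forall z, obj u y (xt u y) <= obj u y z := getPex (prox_exists u y).
set x := xt u y in xmin *.
set w := grad_x S x y + rho *: (x - u).
have key v : 0 <= dot w v.
  have d1 : is_derive (0 : R) 1 (fun t => S (x + t *: v) y) (dot (grad_x S x y) v).
    have := @is_derive_line _ _ (fun x => S x y) x v 0; rewrite scale0r addr0; apply.
    exact: differentiable_left.
  have d2 := is_deriveN (is_deriveD d1 (is_derive_sqdist x u v)).
  rewrite -oppr_le0 /w dotDl dotZl.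
  apply: (derive_le0_right_max d2) => t _.
  have := xmin (x + t *: v); rewrite /prox_objective !enorm_sqr.
  have opE (f g : R -> R) z : (- (f + g)) z = - (f z + g z) by [].
  by rewrite !opE scale0r addr0 lerN2.
have w0 : w = 0.
  apply/dot_eq0/eqP; rewrite eq_le dot_ge0 andbT.
  by have := key (- w); rewrite dotNr oppr_ge0.
by move: w0 => /eqP; rewrite addr_eq0 -scalerN opprB => /eqP.
Qed.

Lemma prox_min u y z :
  obj u y (xt u y) + (mu + rho) / 2 * dot (z - xt u y) (z - xt u y) <= obj u y z.
Proof. exact: prox_objective_dist (prox_opt u y). Qed.

Lemma prox_unique u x y : grad_x S x y = rho *: (u - x) -> xt u y = x.
Proof.
move=> gE; have h1 := @prox_objective_dist u x y (xt u y) gE; have h2 := prox_min u y x.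
apply/eqP; rewrite -subr_eq0; apply/eqP/dot_eq0/eqP; rewrite eq_le dot_ge0 andbT.
have e : x - xt u y = - (xt u y - x) by rewrite opprB.
rewrite e dotNl dotNr opprK in h2.
have := dot_ge0 (xt u y - x); have : 0 < mu + rho by exact: addr_gt0.
by move: h1 h2; move: (dot _ _) => D; nra.
Qed.

(* Hypotheses on the points [(xt u y, y)] thus hold at every [(x, y)]. *)
Lemma prox_surj x y : xt (x + rho^-1 *: grad_x S x y) y = x.
Proof.
apply: prox_unique; rewrite addrAC subrr add0r scalerA divff ?scale1r//.
by rewrite gt_eqF.
Qed.

Lemma envelopeE u y : T u y = obj u y (xt u y).
Proof.
have h z : obj u y (xt u y) <= obj u y z.
  apply: le_trans (prox_min u y z); rewrite lerDl mulr_ge0 ?dot_ge0//.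
  by rewrite divr_ge0// addr_ge0 ?(ltW hmu) ?(ltW hrho).
rewrite /prox_envelope; apply/eqP; rewrite eq_le; apply/andP; split.
  apply: ge_inf; last by exists (xt u y).
  by exists (obj u y (xt u y)) => _ [z _ <-].
apply: lb_le_inf; first by exists (obj u y (xt u y)), (xt u y).
by move=> _ [z _ <-].
Qed.

Lemma envelope_le u y z : T u y <= obj u y z.
Proof.
rewrite envelopeE; apply: le_trans (prox_min u y z); rewrite lerDl mulr_ge0 ?dot_ge0//.
by rewrite divr_ge0// addr_ge0 ?(ltW hmu) ?(ltW hrho).
Qed.

(** Monotonicity of [grad_x S] in [x], applied to the two optimality conditions, gives
    [dot d d <= dot e d] for the displacements [d] of the minimizer and [e] of [u]: the proximal map
    is firmly nonexpansive. *)
Lemma prox_nonexpansive u u' y :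
  dot (xt u' y - xt u y) (xt u' y - xt u y) <= dot (u' - u) (u' - u).
Proof.
have := grad_x_monotone (xt u y) (xt u' y) y; rewrite !prox_opt.
set d := xt u' y - xt u y.
have -> : rho *: (u' - xt u' y) - rho *: (u - xt u y) = rho *: ((u' - u) - d).
  by apply/rowP => i; rewrite !mxE; ring.
rewrite dotZl dotBl => h.
move: h; move: d (u' - u) => d e h.
have h2 := dot_ge0 (e - d); rewrite !dotE (dotC d e) in h2.
have h3 := mulr_ge0 (ltW hmu) (dot_ge0 d).
have : dot d d <= dot e d by rewrite -subr_ge0 -(pmulr_rge0 _ hrho); lra.
lra.
Qed.

(** The map [x |-> grad_x S x y' + rho *: x] is strongly monotone with modulus [mu + rho], and
    between the two minimizers its increment is, up to sign, the change of [grad_x S] at the old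
    minimizer. *)
Lemma prox_lipschitz_y u y y' :
  (mu + rho) * enorm (xt u y' - xt u y) <=
  enorm (grad_x S (xt u y) y' - grad_x S (xt u y) y).
Proof.
set x := xt u y; set d := xt u y' - x; set D := _ - _.
have [d0|d0] := eqVneq (enorm d) 0.
  by rewrite d0 mulr0 enorm_ge0.
have dpos : 0 < enorm d by rewrite lt_neqAle eq_sym d0 enorm_ge0.
rewrite -(ler_pM2r dpos).
have := grad_x_monotone x (xt u y') y'; rewrite prox_opt -/d.
have -> : rho *: (u - xt u y') - grad_x S x y' = - (D + rho *: d).
  by rewrite /D (prox_opt u y) -/x /d; apply/rowP => i; rewrite !mxE; ring.
clearbody D d; rewrite dotNl dotDl dotZl => h.
have := dot_enorm (- D) d; rewrite enormN dotNl => h2.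
by have := enorm_sqr d; nra.
Qed.

End Prox.

(** * The Moreau envelope and its gradient *)

Section Envelope.
Context {R : realType} {n m : nat}.
Variables (S : 'rV[R]_n -> 'rV[R]_m -> R) (rho mu : R).
Hypotheses (hcc : convex_concave S) (hC1 : continuously_differentiable S).
Hypotheses (hrho : 0 < rho) (hmu : 0 < mu).
Hypothesis ha_sc : forall y, strongly_convex mu (fun x => S x y).
Local Notation T := (prox_envelope rho S).
Local Notation xt := (prox_point rho S).
Local Notation obj := (prox_objective rho S).

Let envE u y : T u y = obj u y (xt u y) := envelopeE hC1 hrho hmu ha_sc u y.
Let env_le u y z : T u y <= obj u y z := envelope_le hC1 hrho hmu ha_sc u y z.
Let opt u y : grad_x S (xt u y) y = rho *: (u - xt u y) :=
  prox_opt hC1 hrho hmu ha_sc u y.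

Lemma cvg_grad_x {U : Type} {F : set_system U} {FF : Filter F} (f : U -> 'rV[R]_n)
    (g : U -> 'rV[R]_m) (x : 'rV[R]_n) (y : 'rV[R]_m) : f @ F --> x -> g @ F --> y ->
  grad_x S (f z) (g z) @[z --> F] --> grad_x S x y.
Proof.
move=> fx gy.
have c : (fun w => grad_x S w.1 w.2) @ nbhs (x, y) --> grad_x S x y.
  exact: (continuous_grad_x hC1 (x := (x, y))).
exact: (cvg_comp _ _ (cvg_pair fx gy) c).
Qed.

Lemma cvg_grad_y {U : Type} {F : set_system U} {FF : Filter F} (f : U -> 'rV[R]_n)
    (g : U -> 'rV[R]_m) (x : 'rV[R]_n) (y : 'rV[R]_m) : f @ F --> x -> g @ F --> y ->
  grad_y S (f z) (g z) @[z --> F] --> grad_y S x y.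
Proof.
move=> fx gy.
have c : (fun w => grad_y S w.1 w.2) @ nbhs (x, y) --> grad_y S x y.
  exact: (continuous_grad_y hC1 (x := (x, y))).
exact: (cvg_comp _ _ (cvg_pair fx gy) c).
Qed.

(* Compare with the point [xt u y - (l + rho)^-1 *: D], where [D] is the increment of
   [grad_x S]. *)
Lemma envelope_gap (l : R) u y y' : 0 < l ->
  (forall y, lipschitz_gradient l (fun x => S x y)) ->
  T u y' <= T u y + dot (grad_y S (xt u y) y) (y' - y) -
    enorm (grad_x S (xt u y) y' - grad_x S (xt u y) y) ^+ 2 / (2 * (l + rho)).
Proof.
move=> l0 lip; rewrite enorm_sqr; set D := (grad_x S _ y' - _); pose x := xt u y.
pose d := - (l + rho)^-1 *: D.
have lr0 : 0 < l + rho by exact: addr_gt0.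
apply: (le_trans (env_le u y' (x + d))).
have h1 := descent_gradient x d (differentiable_left hC1 y') (ltW l0) (lip y').
have h2 := right_le hcc hC1 x y y'.
rewrite envE /prox_objective -/x !enorm_sqr.
have gE : grad_x S x y' = D + rho *: (u - x).
  by rewrite /D opt -/x subrK.
move: h1; rewrite -/(grad_x S x y') gE.
have -> : x + d - u = d - (u - x) by apply/rowP => i; rewrite !mxE; ring.
have -> : x - u = - (u - x) by rewrite opprB.
have dE : dot d d = (l + rho)^-1 ^+ 2 * dot D D.
  by rewrite /d dotZl dotZr; ring.
have DE : dot D d = - ((l + rho)^-1 * dot D D) by rewrite /d dotZr mulNr.
have kE : dot D D / (2 * (l + rho)) = (l + rho)^-1 * dot D D / 2.
  by field; rewrite gt_eqF.
have k2 : (l + rho) * ((l + rho)^-1 ^+ 2 * dot D D) = (l + rho)^-1 * dot D D.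
  by field; rewrite gt_eqF.
rewrite kE; move: (u - x) h2 k2 dE DE => e; move: (dot (grad_y _ _ _) _) => h3.
move: ((l + rho)^-1 ^+ 2 * dot D D) => A; move: ((l + rho)^-1 * dot D D) => B.
clearbody d D => h2 k2 dE DE; rewrite !dotE (dotC e d) DE dE => h1.
by lra.
Qed.

(** The modulus is the minimum over [d] of [mu * dot d d + rho * dot (d - q) (d - q)] for a unit
    vector [q]; after multiplication by [mu + rho] the excess is the square of
    [(mu + rho) *: d - rho *: q]. *)
Lemma envelope_strongly_convex u u' y :
  T u y + rho * dot (u - xt u y) (u' - u) +
    (mu * rho / (mu + rho)) / 2 * dot (u' - u) (u' - u) <= T u' y.
Proof.
rewrite !envE /prox_objective !enorm_sqr.
set x := xt u y; set z := xt u' y.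
have := left_ge hC1 ha_sc x z y; rewrite opt -/x.
have -> : z - u' = (z - x) - (u' - u) - (u - x).
  by apply/rowP => i; rewrite !mxE; ring.
have -> : x - u = - (u - x) by rewrite opprB.
move: (z - x) (u' - u) (u - x) => d q e.
have mr0 : 0 < mu + rho by exact: addr_gt0.
have key : mu * rho / (mu + rho) * dot q q <= mu * dot d d + rho * dot (d - q) (d - q).
  rewrite mulrAC ler_pdivrMr// -subr_ge0.
  have := dot_ge0 ((mu + rho) *: d - rho *: q).
  rewrite !dotE (dotC q d); lra.
move: key; rewrite !dotE (dotC q d) (dotC e d) (dotC e q) => key.
by lra.
Qed.

Lemma envelope_upper u u' y :
  T u' y <= T u y + rho * dot (u - xt u y) (u' - u) + rho / 2 * dot (u' - u) (u' - u).
Proof.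
apply: (le_trans (env_le u' y (xt u y))).
rewrite envE /prox_objective !enorm_sqr; set x := xt u y.
have -> : x - u' = - (u' - u) - (u - x) by apply/rowP => i; rewrite !mxE; ring.
have -> : x - u = - (u - x) by rewrite opprB.
move: (u' - u) (u - x) => q e.
by rewrite !dotE (dotC q e); lra.
Qed.

Lemma prox_continuous_y (u : 'rV[R]_n) (y : 'rV[R]_m) : xt u z @[z --> nbhs y] --> xt u y.
Proof.
have FF : Filter (nbhs y) := nbhs_filter y.
apply/cvg_enorm0.
have gc : grad_x S (xt u y) z @[z --> nbhs y] --> grad_x S (xt u y) y.
  have hid : z @[z --> nbhs y] --> y by exact: cvg_id.
  exact: cvg_grad_x (cvg_cst (xt u y)) hid.
move/cvg_enorm0 : gc => gc.
have mr0 : 0 < mu + rho by exact: addr_gt0.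
have gc' : (mu + rho)^-1 * enorm (grad_x S (xt u y) z - grad_x S (xt u y) y)
    @[z --> nbhs y] --> (0 : R).
  by rewrite -[X in _ --> X](mulr0 (mu + rho)^-1); apply: cvgMl_tmp.
apply: (squeeze_cvgr _ (cvg_cst 0) gc'); apply: nearW => z /=.
rewrite enorm_ge0/= ler_pdivlMl//.
exact: prox_lipschitz_y.
Qed.

Lemma prox_continuous_u (u : 'rV[R]_n) (y : 'rV[R]_m) : xt v y @[v --> nbhs u] --> xt u y.
Proof.
have FF : Filter (nbhs u) := nbhs_filter u.
apply/cvg_enorm0.
have /cvg_enorm0 h : v @[v --> nbhs u] --> u by exact: cvg_id.
apply: (squeeze_cvgr _ (cvg_cst 0) h); apply: nearW => v /=.
rewrite enorm_ge0/= enorm_le_dot ?enorm_ge0// enorm_sqr.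
exact: (prox_nonexpansive hC1 hrho hmu ha_sc).
Qed.

(** By [is_derive_envelope_line], the derivative of the envelope along a line; its decrease in [b]
    measures concavity. *)
Definition slope (y v : 'rV[R]_m) u (b : R) : R :=
  dot (grad_y S (xt u (y + b *: v)) (y + b *: v)) v.

Lemma line_continuous (y v : 'rV[R]_m) (b : R) :
  y + h *: v @[h --> nbhs b] --> y + b *: v.
Proof.
have FF : Filter (nbhs b) := nbhs_filter b.
apply/cvg_enorm0.
rewrite (_ : (fun _ => _) = (fun h : R => `|h - b| * enorm v)); last first.
  apply/funext => h; rewrite opprD addrACA subrr add0r -scalerBl enormZ.
  by [].
rewrite -[X in _ --> X](mul0r (enorm v)); apply: cvgMr_tmp.
rewrite -[X in _ --> X](normr0 R) -(subrr b); apply: cvg_norm.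
by apply: cvgB; [exact: cvg_id|exact: cvg_cst].
Qed.

Lemma slope_continuous_b y v u : continuous (slope y v u).
Proof.
move=> b; have FF : Filter (nbhs b) := nbhs_filter b.
apply: cvg_dot; last exact: cvg_cst.
have hl := @line_continuous y v b.
have hx := cvg_comp _ _ hl (@prox_continuous_y u (y + b *: v)).
exact: cvg_grad_y hx hl.
Qed.

Lemma slope_continuous_u y v b : continuous (fun u => slope y v u b).
Proof.
move=> u; have FF : Filter (nbhs u) := nbhs_filter u.
apply: cvg_dot; last exact: cvg_cst.
have hx := @prox_continuous_u u (y + b *: v).
exact: cvg_grad_y hx (cvg_cst (y + b *: v)).
Qed.

Lemma envelope_line_le y v u a b :
  T u (y + b *: v) <= T u (y + a *: v) + slope y v u a * (b - a).
Proof.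
set x := xt u (y + a *: v).
apply: (le_trans (env_le u _ x)); rewrite envE /prox_objective -/x.
have := right_le hcc hC1 x (y + a *: v) (y + b *: v).
have -> : y + b *: v - (y + a *: v) = (b - a) *: v.
  by rewrite opprD addrACA subrr add0r scalerBl.
by rewrite dotZr /slope -/x; lra.
Qed.

(** Danskin's argument: [envelope_line_le] from both ends squeezes the increment over [h] between
    [h] times the slopes at the two ends, and the slope is continuous. *)
Lemma is_derive_envelope_line y v u (b : R) :
  is_derive b 1 (fun b => T u (y + b *: v)) (slope y v u b).
Proof.
apply/is_derive_epsP => e e0.
have /cvgrPdist_le/(_ e e0) := @slope_continuous_b y v u b.
rewrite -nbhs_ballE => -[r /= r0 rH]; exists r => // h hr.
have /rH {rH} : ball b r (b + h).
  by rewrite /ball/= opprD addrA subrr sub0r normrN.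
rewrite /= [h *: 1]mulr1.
have := envelope_line_le y v u b (b + h); rewrite addrAC subrr add0r.
have := envelope_line_le y v u (b + h) b; rewrite opprD addrA subrr sub0r.
move: (T _ _) (T _ _) (slope _ _ _ _) (slope _ _ _ _) => T1 T2 s1 s2 h1 h2 h3.
have : `|(s2 - s1) * h| <= e * `|h| by rewrite normrM ler_wpM2r// distrC.
have hh : `|T1 - T2 - s1 * h| <= `|(s2 - s1) * h|.
  rewrite ler_norml; apply/andP.
  have := ler_norm ((s2 - s1) * h); have := lerNnormlW (lexx `|(s2 - s1) * h|).
  by move=> k1 k2; split; lra.
exact: le_trans.
Qed.

Lemma gradient_is_derive {k} (f : 'rV[R]_k -> R) z (g : 'rV[R]_k) :
  (forall v, is_derive z v f (dot g v)) -> gradient f z = g.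
Proof.
move=> df; apply/rowP => j; rewrite mxE.
by rewrite (@derive_val _ _ _ _ _ _ _ (df _)) dot_delta.
Qed.

Lemma grad_y_envelope u y : grad_y T u y = grad_y S (xt u y) y.
Proof.
apply: gradient_is_derive => v; apply/is_derive_epsP => e e0.
have /is_derive_epsP/(_ e e0)[r r0 rH] := is_derive_envelope_line y v u 0.
exists r => // h /rH; rewrite add0r [h *: 1]mulr1 scale0r addr0.
by rewrite /slope scale0r addr0.
Qed.

(** The bounds [envelope_strongly_convex] from below and [envelope_upper] from above leave only an
    error quadratic in [h]. *)
Lemma grad_x_envelope u y : grad_x T u y = rho *: u - rho *: xt u y.
Proof.
rewrite -scalerBr; apply: gradient_is_derive => v; apply/is_derive_epsP => e e0.
have k0 : 0 < rho / 2 * dot v v + 1.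
  by rewrite ltr_wpDl// mulr_ge0 ?dot_ge0// divr_ge0// ltW.
exists (e / (rho / 2 * dot v v + 1)); first by rewrite divr_gt0.
move=> h; rewrite ltr_pdivlMr// => hr.
have := envelope_strongly_convex u (u + h *: v) y.
have := envelope_upper u (u + h *: v) y.
have -> : u + h *: v - u = h *: v by rewrite addrAC subrr add0r.
rewrite !dotE; move: (mu * rho / (mu + rho)) (divr_ge0 (mulr_ge0 (ltW hmu) (ltW hrho))
  (ltW (addr_gt0 hmu hrho))) => c c0.
move: (T _ _) (T _ _) => T1 T2.
set B := dot v v in k0 hr *.
have B0 : 0 <= B by exact: dot_ge0.
move=> h1 h2; have h3 : 0 <= c / 2 * (h * (h * B)).
  by rewrite mulr_ge0 ?divr_ge0// mulrA mulr_ge0// -expr2 sqr_ge0.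
have h4 : rho / 2 * (h * (h * B)) <= e * `|h|.
  have -> : rho / 2 * (h * (h * B)) = rho / 2 * B * `|h| * `|h|.
    by rewrite -[RHS]mulrA -expr2 real_normK ?num_real//; ring.
  rewrite ler_wpM2r//; apply: le_trans (ltW hr).
  by rewrite mulrC ler_wpM2l// lerDl.
have e1 : 0 <= e * `|h| by rewrite mulr_ge0// ltW.
by rewrite ler_norml; apply/andP; split; lra.
Qed.

End Envelope.

(** * Mixed partial derivatives *)

Section Derivability.
Context {R : realType} {n : nat}.

Lemma invS_lt (r : R) : 0 < r -> exists N : nat, forall k, (N <= k)%N -> k.+1%:R^-1 < r.
Proof.
move=> r0; exists (Num.bound r^-1) => k Nk; rewrite invf_plt ?posrE// ?ltr0n//.
have r1 : 0 <= r^-1 by rewrite invr_ge0 ltW.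
by rewrite (lt_le_trans (archi_boundP r1))// ler_nat leqW.
Qed.

(* Rational increments suffice in the Cauchy criterion, which makes the set of points
   of derivability measurable. *)
Lemma derivable_cauchyP (f : 'rV[R]_n -> R) (x v : 'rV[R]_n) :
  continuous f ->
  derivable f x v <-> forall k : nat, exists N : nat, forall s t : rat,
    s != 0 -> `|ratr s| < N.+1%:R^-1 :> R -> t != 0 -> `|ratr t| < N.+1%:R^-1 :> R ->
    `|(ratr s)^-1 * (f (x + ratr s *: v) - f x) - (ratr t)^-1 * (f (x + ratr t *: v) - f x)|
      <= k.+1%:R^-1.
Proof.
move=> cf; pose q (h : R) : R := h^-1 * (f (x + h *: v) - f x).
have inv0 k : 0 < k.+1%:R^-1 :> R by rewrite invr_gt0 ltr0n.
split.
  move=> fd k.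
  have [d /is_derive_epsP D] : exists d, is_derive x v f d by exists ('D_v f x); split.
  have e0 : 0 < k.+1%:R^-1 / 2 :> R by rewrite divr_gt0.
  have [r r0 rH] := D _ e0; have [N /(_ _ (leqnn N)) Nr] := invS_lt r0; exists N => s t s0 sN t0 tN.
  have qd (h : rat) : h != 0 -> `|ratr h| < N.+1%:R^-1 :> R ->
      `|q (ratr h) - d| <= k.+1%:R^-1 / 2.
    move=> h0 hN; have hr0 : ratr h != 0 :> R by rewrite fmorph_eq0.
    have := rH (ratr h) (lt_trans hN Nr).
    have -> : f (x + ratr h *: v) - f x - d * ratr h = (q (ratr h) - d) * ratr h.
      by rewrite /q; field.
    by rewrite normrM ler_pM2r// normr_gt0.
  rewrite -/(q _) -/(q (ratr t)) -(subrKA d) (le_trans (ler_normD _ _))//.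
  by rewrite [leRHS]splitr lerD ?qd// distrC qd.
move=> H.
have -> : derivable f x v = cvg (q @ 0^').
  rewrite /derivable (_ : (fun h : R => _) = q)//.
  by apply/funext => h; rewrite /q /= (addrC _ x).
have FF : ProperFilter (dnbhs (0 : R)) by exact: Proper_dnbhs_numFieldType.
apply/cauchy_cvgP/cauchy_exP => e e0.
have [k /(_ _ (leqnn k)) ke] := invS_lt e0; have [N NH] := H k.
have rat_near (a b : R) : a < b -> exists s : rat, a < ratr s < b.
  by move=> /rat_in_itvoo[s]; rewrite in_itv/= => sab; exists s.
have [s /andP[s0 sN]] := rat_near _ _ (inv0 N).
have s0' : s != 0 by move: s0; rewrite ltr0q => s0; rewrite gt_eqF.
exists (q (ratr s)).
suff : \forall h \near dnbhs (0 : R), `|q (ratr s) - q h| < e by [].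
rewrite near_withinE -nbhs_ballE; exists N.+1%:R^-1 => //= h.
rewrite /ball/= sub0r normrN => hN h0; apply: le_lt_trans ke.
have qc : q z @[z --> nbhs h] --> q h.
  have FF' : Filter (nbhs h) := nbhs_filter h.
  apply: cvgM; first by apply: cvgV => //; exact: cvg_id.
  apply: cvgB; last exact: cvg_cst.
  have c : f @ nbhs (x + h *: v) --> f (x + h *: v) by exact: cf.
  exact: (cvg_comp _ _ (line_continuous (y := x) (v := v) (b := h)) c).
apply/ler_addgt0Pr => e' e'0.
move/cvgrPdist_le : qc => /(_ _ e'0) qc.
have h0N : 0 < N.+1%:R^-1 - `|h| by rewrite subr_gt0.
have hh : 0 < `|h| by rewrite normr_gt0.
move: qc; rewrite -nbhs_ballE => -[r /= r0 rH].
(* This radius keeps the rational [t] within the continuity radius of [h], below [1 / (N + 1)] in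
   absolute value, and away from 0. *)
pose d := Num.min r (Num.min (N.+1%:R^-1 - `|h|) `|h|).
have d0 : 0 < d by rewrite !lt_min r0 h0N hh.
have [t /andP[t1 t2]] := rat_near h (h + d) (ltr_pwDr d0 (lexx h)).
have td : `|h - ratr t| < d by rewrite ltr_norml; apply/andP; split; lra.
move: (td); rewrite /d !lt_min => /and3P[tr tN th].
have t0 : ratr t != 0 :> R.
  by apply/eqP => t0; move: th; rewrite t0 subr0 ltxx.
have tN' : `|ratr t : R| < N.+1%:R^-1.
  rewrite -(subrK h (ratr t)) (le_lt_trans (ler_normD _ _))// distrC.
  by rewrite -ltrBrDr.
have := NH s t; rewrite -/(q _) -/(q (ratr t)).
move=> /(_ s0' _ _ tN'); rewrite gtr0_norm// => /(_ sN).
rewrite fmorph_eq0 in t0; move=> /(_ t0) h1.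
have h2 := rH _ tr.
have -> : q (ratr s) - q h = (q (ratr s) - q (ratr t)) - (q h - q (ratr t)).
  by rewrite opprB addrA subrK.
by rewrite (le_trans (ler_normB _ _))// lerD.
Qed.
Lemma continuous_translate (f : 'rV[R]_n * R -> R) (a : 'rV[R]_n) : continuous f ->
  continuous (fun p : 'rV[R]_n * R => f (p.1 + a, p.2)).
Proof.
move=> cf p; have FF : Filter (nbhs p) := nbhs_filter p.
have h1 : q.1 @[q --> nbhs p] --> p.1 by exact: cvg_fst.
have h2 : q.2 @[q --> nbhs p] --> p.2 by exact: cvg_snd.
have c : f @ nbhs (p.1 + a, p.2) --> f (p.1 + a, p.2) by exact: cf.
exact: (cvg_comp _ _ (cvg_pair (cvgD h1 (cvg_cst a)) h2) c).
Qed.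

Lemma measurable_sublevel {d} {T : measurableType d} (f : 'rV[R]_n * R -> R)
    (phi : T -> 'rV[R]_n) (beta : T -> R) (r : R) : continuous f ->
  (forall i, measurable_fun setT (fun w => phi w 0 i)) ->
  measurable_fun setT beta -> measurable [set w | f (phi w, beta w) <= r].
Proof.
move=> cf mphi mbeta.
rewrite (_ : [set w | _] = (fun w => f (phi w, beta w)) @^-1` `]-oo, r]%classic).
  rewrite -[X in measurable X]setTI.
  apply: (measurable_fun_continuous_vec cf mphi mbeta) => //.
by apply/seteqP; split => w /=; rewrite in_itv.
Qed.

Lemma measurable_derivable {d} {T : measurableType d} (f : 'rV[R]_n * R -> R)
    (phi : T -> 'rV[R]_n) (beta : T -> R) (v : 'rV[R]_n) : continuous f ->
  (forall i, measurable_fun setT (fun w => phi w 0 i)) ->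
  measurable_fun setT beta ->
  measurable [set w | derivable (fun z => f (z, beta w)) (phi w) v].
Proof.
move=> cf mphi mbeta.
pose Q (s t : rat) (p : 'rV[R]_n * R) := `|(ratr s)^-1 * (f (p.1 + ratr s *: v, p.2) - f p)
  - (ratr t)^-1 * (f (p.1 + ratr t *: v, p.2) - f p)|.
pose c (s : rat) N := (s != 0) && (`|ratr s| < N.+1%:R^-1 :> R).
(* Where the side conditions on the increments fail, [C] is the whole space, so that one can
   intersect over all rationals. *)
pose C (k N : nat) (s t : rat) := if c s N && c t N then
  [set w | Q s t (phi w, beta w) <= k.+1%:R^-1] else setT.
have -> : [set w | derivable (fun z => f (z, beta w)) (phi w) v] =
    \bigcap_k \bigcup_N \bigcap_s \bigcap_t C k N s t.
  have cfb w : continuous (fun z => f (z, beta w)).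
    move=> z; have FF : Filter (nbhs z) := nbhs_filter z.
    have h : f @ nbhs (z, beta w) --> f (z, beta w) by exact: cf.
    have hid : y @[y --> nbhs z] --> z by exact: cvg_id.
    exact: (cvg_comp _ _ (cvg_pair hid (cvg_cst (beta w))) h).
  apply/seteqP; split => w /=.
    move=> /(derivable_cauchyP _ _ (cfb w)) H k _; have [N NH] := H k.
    exists N => // s _ t _; rewrite /C; case: ifPn => // /andP[/andP[s0 sN] /andP[t0 tN]].
    exact: NH.
  move=> H; apply/(derivable_cauchyP _ _ (cfb w)) => k; have [N _ NH] := H k Logic.I.
  exists N => s t s0 sN t0 tN; have := NH s Logic.I t Logic.I.
  by rewrite /C /c s0 sN t0 tN.
do 4 (apply: countType_bigcap_measurable || apply: countType_bigcup_measurable) => ?.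
rewrite /C; case: ifP => // _.
have cQ s t : continuous (Q s t).
  move=> p; have FF : Filter (nbhs p) := nbhs_filter p.
  have cT (a : rat) : (fun p : 'rV[R]_n * R => f (p.1 + ratr a *: v, p.2)) @ nbhs p -->
      f (p.1 + ratr a *: v, p.2).
    by have H := @continuous_translate f (ratr a *: v) cf; exact: H.
  have c0 : f @ nbhs p --> f p by exact: cf.
  by apply: cvg_norm; apply: cvgB; apply: cvgMl_tmp; apply: cvgB.
exact: (measurable_sublevel _ (cQ _ _)).
Qed.

End Derivability.

(** * Partial derivatives exist almost everywhere *)

Section MixedPartials.
Context {R : realType} {n m : nat}.
Variable F : 'rV[R]_n -> R -> 'rV[R]_m.
Hypothesis Fcont : continuous (fun p : 'rV[R]_n * R => F p.1 p.2).
Hypothesis FAC : forall x z b i, absolutely_continuous 0 1 (fun t : R => F (x + t *: (z - x)) b 0 i).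
Local Notation mu := (@lebesgue_measure R).
Local Notation E j := (delta_mx 0 j : 'rV[R]_n).
Local Notation pdef x b := (partials_defined (F^~ b) x).

Lemma vec_shift_coord (j : 'I_n) s (w : n.-tuple R) t :
  vec (shift_coord j s w t) = vec w + (s * t) *: E j.
Proof.
apply/rowP => i; rewrite !mxE tnth_shift; congr (_ + _).
have -> : (i == j :> nat) = (i == j) by [].
by rewrite eqxx /=; case: eqP => _; rewrite ?mulr1 ?mulr0.
Qed.

Lemma component_continuous i : continuous (fun p : 'rV[R]_n * R => F p.1 p.2 0 i).
Proof. by move=> p; apply: cvg_coord; exact: Fcont. Qed.

Lemma measurable_partials_defined {d} {T : measurableType d} (phi : T -> 'rV[R]_n)
    (beta : T -> R) : (forall i, measurable_fun setT (fun w => phi w 0 i)) ->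
  measurable_fun setT beta -> measurable [set w | pdef (phi w) (beta w)].
Proof.
move=> mphi mbeta.
rewrite (_ : [set w | _] = \bigcap_i \bigcap_j
    [set w | derivable (fun z => F z (beta w) 0 i : R) (phi w) (E j)]); last first.
  by apply/seteqP; split => w /= h i; [move=> _ j _; exact: h|move=> j; exact: h].
apply: countType_bigcap_measurable => i; apply: countType_bigcap_measurable => j.
exact: (measurable_derivable (f := fun p => F p.1 p.2 0 i) (E j) (@component_continuous i)).
Qed.

Lemma derivable_along (f : 'rV[R]_n -> R) (x e : 'rV[R]_n) (s t : R) : s != 0 ->
  derivable (fun u : R => f (x + (s * u) *: e)) t 1 -> derivable f (x + (s * t) *: e) e.
Proof.
move=> s0 fd; set g := fun u : R => f (x + (s * u) *: e).
have [d /is_derive_epsP D] : exists d, is_derive t 1 g d by exists ('D_1 g t); split.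
suff : is_derive (x + (s * t) *: e) e f (s^-1 * d) by case.
apply/is_derive_epsP => eps eps0.
have sp : 0 < `|s| by rewrite normr_gt0.
have [r r0 rH] := D (eps * `|s|) (mulr_gt0 eps0 sp).
exists (r * `|s|) => [|h hr]; first by rewrite mulr_gt0.
have : `|s^-1 * h| < r by rewrite normrM normfV mulrC ltr_pdivrMr.
move=> /rH; rewrite [_ *: 1]mulr1 /g normrM normfV mulrDr mulVKf// scalerDl addrA.
by rewrite -[eps * _ * _]mulrA mulVKf ?gt_eqF// mulrA (mulrC d).
Qed.

(** Each component of [F] is absolutely continuous along the coordinate segment, hence derivable at
    almost all of its points. *)
Lemma line_partials_null b (w : n.-tuple R) (z : 'rV[R]_n) (i : 'I_m) (j : 'I_n) s : s != 0 ->
  unif01 (R := R) [set t | ~ derivable (fun x => F x b 0 i : R) (vec (shift_coord j s w t) + z) (E j)] = 0%E.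
Proof.
move=> s0; set A := [set t | _].
pose g t := F (vec w + z + (s * t) *: E j) b 0 i.
have vE t : vec (shift_coord j s w t) + z = vec w + z + (s * t) *: E j.
  by rewrite vec_shift_coord addrAC.
have -> : A = ~` [set t | derivable (fun x => F x b 0 i : R) (vec w + z + (s * t) *: E j) (E j)].
  by apply/seteqP; split => t; rewrite /A /= vE.
apply: unif01_ae_null.
  apply: measurableC.
  apply: (measurable_derivable (T := measurableTypeR R) (f := fun p => F p.1 p.2 0 i)
    (beta := fun=> b) (E j) (@component_continuous i)) => // k.
  rewrite (_ : (fun _ => _) = (fun t : measurableTypeR R => (vec w + z) 0 k + s * E j 0 k * t)).
    by apply: measurable_funD => //; apply: measurable_funM.
  by apply/funext => t; rewrite !mxE; ring.
have := abs_continuous_ae_derivable (FAC (vec w + z) (vec w + z + s *: E j) b i).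
apply: filterS => t h /h; rewrite addrAC subrr add0r => h'.
apply: (derivable_along (f := fun x => F x b 0 i) s0).
rewrite (_ : (fun u : R => _) = (fun t : R => F (vec w + z + t *: (s *: E j)) b 0 i))//.
by apply/funext => u; rewrite scalerA mulrC.
Qed.

(* The translation by [z] is used with [z = (t * r) *: E j], to reach whole lines. *)
Lemma partials_null b (a : n.-tuple R) s (z : 'rV[R]_n) : s != 0 ->
  box_prob a s n [set w | ~ pdef (vec w + z) b] = 0%E.
Proof.
move=> s0.
have mphi k : measurable_fun setT (fun w : n.-tuple R => (vec w + z) 0 k).
  rewrite (_ : (fun _ => _) = (fun w : n.-tuple R => tnth w k + z 0 k)); last first.
    by apply/funext => w; rewrite !mxE.
  by apply: measurable_funD => //; exact: measurable_tnth.
have mD : measurable [set w : n.-tuple R | ~ pdef (vec w + z) b].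
  by apply: measurableC; apply: (measurable_partials_defined (beta := fun=> b)).
apply: measure_negligible => //.
suff [N [mN N0 sN]] : {ae box_prob a s n, forall w, pdef (vec w + z) b} by exists N.
have FF := ae_filter_ringOfSetsType (box_prob a s n).
apply: filter_forall => i; apply: filter_forall => j.
exists [set w | ~ derivable (fun x => F x b 0 i : R) (vec w + z) (E j)]; split => //.
  apply: measurableC.
  exact: (measurable_derivable (f := fun p => F p.1 p.2 0 i) (beta := fun=> b)
    (E j) (@component_continuous i)).
apply: (@box_prob_null _ _ _ _ j) => //.
  apply: measurableC.
  exact: (measurable_derivable (f := fun p => F p.1 p.2 0 i) (beta := fun=> b)
    (E j) (@component_continuous i)).
by move=> w; exact: line_partials_null.
Qed.

End MixedPartials.

Section Slope.
Context {R : realType} {n m : nat}.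
Variable F : 'rV[R]_n -> R -> 'rV[R]_m.
Hypothesis Fcont : continuous (fun p : 'rV[R]_n * R => F p.1 p.2).
Hypothesis FAC : forall x z b i, absolutely_continuous 0 1 (fun t : R => F (x + t *: (z - x)) b 0 i).
Local Notation mu := (@lebesgue_measure R).
Local Notation E j := (delta_mx 0 j : 'rV[R]_n).
Local Notation pdef x b := (partials_defined (F^~ b) x).

Lemma is_derive_along (f : 'rV[R]_n -> R) (x e : 'rV[R]_n) (s t d : R) :
  is_derive (x + (t * s) *: e) e f d ->
  is_derive t 1 (fun u : R => f (x + (u * s) *: e)) (s * d).
Proof.
move=> /is_derive_epsP D; apply/is_derive_epsP => eps eps0.
have sp : 0 < `|s| + 1 by rewrite ltr_wpDl.
have [r r0 rH] := D (eps / (`|s| + 1)) (divr_gt0 eps0 sp).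
exists (r / (`|s| + 1)) => [|h]; first by rewrite divr_gt0.
rewrite ltr_pdivlMr// => hr.
have /rH : `|h * s| < r.
  by rewrite normrM (le_lt_trans _ hr)// ler_wpM2l// lerDl.
rewrite [h *: 1]mulr1 mulrDl scalerDl addrA (mulrC s d) -(mulrA d) (mulrC s h).
move=> /le_trans; apply; rewrite normrM -mulrA (mulrC _ (`|h| * _)) mulrA.
rewrite ler_pdivrMr// -mulrA ler_wpM2l ?(ltW eps0)// ler_wpM2l//.
by rewrite lerDl.
Qed.

(** Fubini for the pair of a random point [w] and the parameter [t]: for each [t] the bad [w] form a
    null set, so almost every [w] has a good segment. The box at [x] has probability 1, hence
    contains such a [w]. *)
Lemma exists_line_partials (x : 'rV[R]_n) b j r e : 0 < e ->
  exists w : 'rV[R]_n, (forall i, `|w 0 i - x 0 i| <= e) /\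
   {ae mu, forall t : R, 0 < t < 1 -> pdef (w + (t * r) *: E j) b}.
Proof.
move=> e0; pose a : n.-tuple R := [tuple x 0 i | i < n].
pose A := [set p : n.-tuple R * measurableTypeR R | ~ pdef (vec p.1 + (p.2 * r) *: E j) b].
have mA : measurable A.
  apply: measurableC; apply: (measurable_partials_defined Fcont (beta := fun=> b)) => // k.
  rewrite (_ : (fun _ => _) = (fun p : n.-tuple R * measurableTypeR R =>
      tnth p.1 k + p.2 * (r * E j 0 k))); last first.
    by apply/funext => p; rewrite !mxE mulrA.
  apply: measurable_funD; first exact: (measurableT_comp (measurable_tnth k)).
  by apply: measurable_funM.
have A0 : (box_prob a e n \x unif01)%E A = 0%E.
  apply: product_null_ysection => // t.
  rewrite -[RHS](partials_null Fcont FAC b a ((t * r) *: E j) (lt0r_neq0 e0)).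
  by congr (box_prob _ _ _ _); apply/seteqP; split => w; rewrite /ysection/= inE.
have [N [mN N0 sN]] := ae_xsection_null mA A0.
have [w [wb wN]] : exists w, box a e w /\ ~ N w.
  apply: contrapT => /forallNP H.
  have sub : box a e `<=` N.
    by move=> w wb; apply: contrapT => wN; apply: (H w).
  have := @box_prob_box_ge R n a e a e n (leqnn n) e0 e0.
  have h (i : 'I_n) : if (i < n)%N then tnth a i <= tnth a i /\ tnth a i + e <= tnth a i + e
      else tnth a i <= tnth a i < tnth a i + e by rewrite ltn_ord.
  move=> /(_ h); rewrite divff ?gt_eqF// expr1n leNgt => /negP; apply.
  rewrite (le_lt_trans (y := box_prob a e n N))//; last by rewrite N0.
  by rewrite le_measure ?inE//; exact: measurable_box.
exists (vec w); split => [i|].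
  have := wb i; rewrite /a tnth_mktuple mxE => /andP[h1 h2].
  by rewrite ler_norml; apply/andP; split; lra.
have U0 : unif01 (xsection A w) = 0%E.
  by apply: contrapT => h; exact/wN/sN.
have mX : measurable (xsection A w) by exact: measurable_xsection.
exists (xsection A w `&` `[0, 1]%classic); split.
- by apply: measurableI => //; exact: measurable_itv.
- by rewrite -unif01E.
move=> t /= /not_implyP[/andP[t0 t1] h]; split.
  by rewrite /xsection/= inE.
by rewrite /= in_itv/= (ltW t0) (ltW t1).
Qed.

Variables (v : 'rV[R]_m) (L : R).
Local Notation h x b := (dot (F x b) v).
Hypothesis hAC : forall x z b, absolutely_continuous 0 1 (fun t : R => h (x + t *: (z - x)) b).
Hypothesis L0 : 0 <= L.
Local Notation Dh x b := (gradient (fun z => h z b) x).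
Hypothesis h_le : forall x b, pdef x b -> dot (Dh x b) (Dh x b) <= L ^+ 2.

Lemma is_derive_slope x b j : pdef x b -> is_derive x (E j) (fun z => h z b) (Dh x b 0 j).
Proof.
move=> pd; rewrite mxE; split => //.
have -> : (fun z => h z b) = \sum_i (fun z => F z b 0 i * v 0 i).
  by apply/funext => z; rewrite /dot fct_sumE.
apply: derivable_sum => i; apply: derivableM; first exact: pd.
exact: derivable_cst.
Qed.

(** The derivative bound is available only where the partials exist, and the segment at [x] may
    avoid all such points. A parallel segment, arbitrarily close, meets them almost everywhere, and
    continuity of [F] brings the bound back to [x]. *)
Lemma slope_lipschitz (x : 'rV[R]_n) b j r : `|h (x + r *: E j) b - h x b| <= L * `|r|.
Proof.
have hc (z : 'rV[R]_n) : (fun z => h z b) @ nbhs z --> h z b.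
  have FF : Filter (nbhs z) := nbhs_filter z.
  apply: cvg_dot; last exact: cvg_cst.
  have c : (fun p => F p.1 p.2) @ nbhs (z, b) --> F z b by exact: (Fcont (x := (z, b))).
  have hid : y @[y --> nbhs z] --> z by exact: cvg_id.
  exact: (cvg_comp _ _ (cvg_pair hid (cvg_cst b)) c).
apply/ler_addgt0Pr => e e0; have e2 : 0 < e / 2 by rewrite divr_gt0.
move/cvgrPdist_le : (hc x) => /(_ _ e2); rewrite -nbhs_ballE => -[d1 /= d10 H1].
move/cvgrPdist_le : (hc (x + r *: E j)) => /(_ _ e2); rewrite -nbhs_ballE => -[d2 /= d20 H2].
pose d := Num.min d1 d2 / 2.
have d0 : 0 < d by rewrite divr_gt0// lt_min d10.
have [w [wx wae]] := exists_line_partials x b j r d0.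
have wn : `|x - w| <= d.
  by apply: rnorm_le; [exact: ltW|move=> i; rewrite !mxE distrC].
have dd : d < Num.min d1 d2 by rewrite ltr_pdivrMr// ltr_pMr ?lt_min ?d10//; lra.
have [wd1 wd2] : `|x - w| < d1 /\ `|x - w| < d2.
  by move: (le_lt_trans wn dd); rewrite lt_min => /andP.
have K1 : `|h x b - h w b| <= e / 2 by apply: H1; rewrite -ball_normE.
have K2 : `|h (x + r *: E j) b - h (w + r *: E j) b| <= e / 2.
  by apply: H2; rewrite -ball_normE /ball_/= opprD addrACA subrr addr0.
have K3 : `|h (w + r *: E j) b - h w b| <= L * `|r|.
  have := abs_continuous_derive_bound (mulr_ge0 L0 (normr_ge0 r)) (hAC w (w + r *: E j) b).
  rewrite scale1r scale0r addr0 [w + (w + _ - w)]addrC subrK; apply.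
  apply: filterS wae => t H /H pd.
  have := is_derive_along (is_derive_slope j pd).
  have -> : (fun u : R => h (w + (u * r) *: E j) b) =
      (fun t : R => h (w + t *: (w + r *: E j - w)) b).
    by apply/funext => u; rewrite addrAC subrr add0r scalerA.
  move=> [_ ->]; rewrite normrM mulrC ler_wpM2r//.
  rewrite -ler_sqr ?nnegrE// real_normK ?num_real//.
  apply: le_trans (h_le pd); rewrite -enorm_sqr -real_normK ?num_real//.
  by rewrite ler_sqr ?nnegrE ?enorm_ge0// coord_le_enorm.
rewrite -(subrKA (h (w + r *: E j) b)) (le_trans (ler_normD _ _))//.
rewrite -(subrKA (h w b) (h (w + _) b)).
have := ler_normD (h (w + r *: E j) b - h w b) (h w b - h x b).
by rewrite (distrC (h w b)); lra.
Qed.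

End Slope.

Lemma cvg_enorm {R : realType} {n : nat} {U : Type} {A : set_system U} {FF : Filter A}
    (f : U -> 'rV[R]_n) (a : 'rV[R]_n) : f @ A --> a -> enorm (f x) @[x --> A] --> enorm a.
Proof.
move=> fa; have enE (x : 'rV[R]_n) : enorm x = Num.sqrt (dot x x).
  by rewrite /enorm /dot; congr Num.sqrt; apply: eq_bigr => i _; rewrite expr2.
rewrite enE (_ : (fun _ => _) = (fun x => Num.sqrt (dot (f x) (f x)))); last first.
  by apply/funext => x; rewrite enE.
have c : @Num.sqrt R @ nbhs (dot a a) --> Num.sqrt (dot a a) by exact: sqrt_continuous.
exact: (cvg_comp _ _ (cvg_dot fa fa) c).
Qed.

(** * Exchange of mixed partial derivatives *)

Section MixedGradient.
Context {R : realType} {n m : nat}.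
Variable F : 'rV[R]_n -> R -> 'rV[R]_m.
Hypothesis Fcont : continuous (fun p : 'rV[R]_n * R => F p.1 p.2).
Hypothesis FAC : forall x z b i, absolutely_continuous 0 1 (fun t : R => F (x + t *: (z - x)) b 0 i).
Local Notation mu := (@lebesgue_measure R).
Local Notation E j := (delta_mx 0 j : 'rV[R]_n).
Local Notation pdef x b := (partials_defined (F^~ b) x).
Variables (v : 'rV[R]_m) (L : R).
Local Notation h x b := (dot (F x b) v).
Hypothesis hAC : forall x z b, absolutely_continuous 0 1 (fun t : R => h (x + t *: (z - x)) b).
Hypothesis L0 : 0 <= L.
Local Notation Dh x b := (gradient (fun z => h z b) x).
Hypothesis h_le : forall x b, pdef x b -> dot (Dh x b) (Dh x b) <= L ^+ 2.
Variables (f : 'rV[R]_n -> R -> R) (G : 'rV[R]_n -> R -> 'rV[R]_n).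
Hypothesis df_time : forall x (b : R), is_derive b 1 (f x) (h x b).
Hypothesis df_space : forall x b j, is_derive x (E j) (f^~ b) (G x b 0 j).
Hypothesis Gcont : continuous (fun p : 'rV[R]_n * R => G p.1 p.2).

Lemma quotient_seq_cvg (g : 'rV[R]_n -> R) (x e : 'rV[R]_n) d : is_derive x e g d ->
  k.+1%:R * (g (x + k.+1%:R^-1 *: e) - g x) @[k --> \oo] --> d.
Proof.
move=> /is_derive_epsP D; apply/cvgrPdist_le => eps eps0.
have [r r0 rH] := D eps eps0; have [N Nr] := invS_lt r0.
exists N => // k Nk /=.
have k0 : 0 < k.+1%:R :> R by rewrite ltr0n.
have := rH k.+1%:R^-1; rewrite ger0_norm ?invr_ge0// => /(_ (Nr k Nk)).
rewrite distrC -(ler_pM2l k0) mulrCA divff ?gt_eqF// mulr1.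
by rewrite -{1}(gtr0_norm k0) -normrM mulrBr mulrCA divff ?gt_eqF// mulr1.
Qed.

(** Difference quotients of [f] in direction [E j], tending to [G x b 0 j]. Their derivatives in [b]
    are the [dphi], difference quotients of [h] that are bounded by [L] everywhere and tend to
    [Dh x b 0 j] where the partials exist. *)
Let phi x j k b := k.+1%:R * (f (x + k.+1%:R^-1 *: E j) b - f x b).
Let dphi x j k b := k.+1%:R * (h (x + k.+1%:R^-1 *: E j) b - h x b).

Lemma quotient_derive x j k (b : R) : is_derive b 1 (phi x j k) (dphi x j k b).
Proof. by apply: is_deriveZ; apply: is_deriveB. Qed.

Lemma quotient_derive_le x j k b : `|dphi x j k b| <= L.
Proof.
have k0 : 0 < k.+1%:R :> R by rewrite ltr0n.
rewrite /dphi normrM gtr0_norm// mulrC -ler_pdivlMr//.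
have := slope_lipschitz Fcont FAC hAC L0 h_le x b j k.+1%:R^-1.
by rewrite (ger0_norm (_ : 0 <= k.+1%:R^-1)) ?invr_ge0.
Qed.

Lemma quotient_derive_continuous x j k : continuous (dphi x j k).
Proof.
have hc y : continuous (fun b => h y b).
  move=> b; have FF : Filter (nbhs b) := nbhs_filter b.
  apply: cvg_dot; last exact: cvg_cst.
  have c : (fun p => F p.1 p.2) @ nbhs (y, b) --> F y b by exact: (Fcont (x := (y, b))).
  have hid : z @[z --> nbhs b] --> b by exact: cvg_id.
  exact: (cvg_comp _ _ (cvg_pair (cvg_cst y) hid) c).
by move=> b; apply: cvgMl_tmp; apply: cvgB; exact: hc.
Qed.

(** The quotients [phi] are [L]-Lipschitz in [b] by the mean value theorem, and so is their
    pointwise limit; no exceptional point remains. *)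
Lemma gradient_lipschitz_time x b b' j : `|G x b' 0 j - G x b 0 j| <= L * `|b' - b|.
Proof.
wlog bb : b b' / b <= b'.
  by move=> H; have [/H//|/ltW/H] := leP b b'; rewrite distrC (distrC b).
have c1 := quotient_seq_cvg (df_space x b j).
have c2 := quotient_seq_cvg (df_space x b' j).
have c : `|phi x j k b' - phi x j k b| @[k --> \oo] --> `|G x b' 0 j - G x b 0 j|.
  by apply: cvg_norm; apply: cvgB.
rewrite -(cvg_lim (@Rhausdorff R) c); apply: limr_le.
  by apply/cvg_ex; exists `|G x b' 0 j - G x b 0 j|.
apply: nearW => k.
have [|t _ ->] := @MVT_segment R (phi x j k) (dphi x j k) b b' bb
    (fun t _ => quotient_derive x j k t).
  apply: derivable_within_continuous => t _.
  exact: (@ex_derive _ _ _ _ _ _ _ (quotient_derive x j k t)).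
by rewrite normrM ler_wpM2r// quotient_derive_le.
Qed.

(** Symmetry of second derivatives along the time line of [x]: [limit_ae_is_derive] is applied to
    the quotients [phi]. *)
Lemma gradient_ae_derive x : {ae mu, forall b : R, 0 < b < 1 -> pdef x b} ->
  {ae mu, forall b : R, 0 < b < 1 -> forall j, is_derive b 1 (fun b => G x b 0 j) (Dh x b 0 j)}.
Proof.
move=> aed.
have dc j b : pdef x b -> dphi x j k b @[k --> \oo] --> Dh x b 0 j.
  by move=> pd; exact: (quotient_seq_cvg (is_derive_slope v j pd)).
have H j : {ae mu, forall b : R, 0 < b < 1 -> is_derive b 1 (fun b => G x b 0 j) (Dh x b 0 j)}.
  have cp (b : R) : phi x j k b @[k --> \oo] --> G x b 0 j.
    exact: (quotient_seq_cvg (df_space x b j)).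
  have cv : {ae mu, forall b : R, 0 < b < 1 -> cvgn (dphi x j ^~ b)}.
    by apply: filterS aed => b + b01 => /(_ b01) pd; apply/cvg_ex; exists (Dh x b 0 j); exact: dc.
  have := @limit_ae_is_derive R (phi x j) (dphi x j) (fun b => G x b 0 j) L
    (quotient_derive x j) (@quotient_derive_continuous x j) (quotient_derive_le x j) cp cv.
  apply: filterS2 aed => b + + b01 => /(_ b01) pd /(_ b01).
  by rewrite (cvg_lim (@Rhausdorff R) (dc j b pd)).
have : {ae mu, forall b : R, forall j, 0 < b < 1 -> is_derive b 1 (fun b => G x b 0 j) (Dh x b 0 j)}.
  exact: filter_forall.
by apply: filterS => b Hb b01 j; exact: Hb.
Qed.

(** The two signs serve the two ends of a time step; a point is good when both of its increments are
    large. *)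
Definition small_increment k (al : R) x b :=
  enorm (G x (b + k.+1%:R^-1) - G x b) <= al * k.+1%:R^-1 \/
  enorm (G x (b - k.+1%:R^-1) - G x b) <= al * k.+1%:R^-1.

Lemma eventually_large_increment x (b al : R) (d : 'rV[R]_n) : 0 <= al -> al < enorm d ->
  (forall j, is_derive b 1 (fun b => G x b 0 j) (d 0 j)) ->
  exists N, forall k, (N <= k)%N -> ~ small_increment k al x b.
Proof.
move=> al0 ald dG.
(* The coordinatewise error grows by a factor of at most [n] in the Euclidean norm; dividing the
   margin by [n + 1] leaves a positive part. *)
pose e := (enorm d - al) / (n%:R + 1).
have n1 : 0 < n%:R + 1 :> R by rewrite ltr_wpDl.
have e0 : 0 < e by rewrite divr_gt0 ?subr_gt0.
have near_j : \forall h \near nbhs (0 : R), forall j : 'I_n,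
    `|G x (b + h) 0 j - G x b 0 j - d 0 j * h| <= e * `|h|.
  apply: filter_forall => j; have /is_derive_epsP/(_ e e0)[r r0 rH] := dG j.
  rewrite -nbhs_ballE; exists r => // h; rewrite /ball/= sub0r normrN => /rH.
  by rewrite [h *: 1]mulr1.
move: near_j; rewrite -nbhs_ballE => -[r /= r0 rH].
have key (h : R) : h != 0 -> `|h| < r -> al * `|h| < enorm (G x (b + h) - G x b).
  move=> h0 hr; have hp : 0 < `|h| by rewrite normr_gt0.
  have Hj j : `|(G x (b + h) - G x b - h *: d) 0 j| <= e * `|h|.
    by rewrite !mxE (mulrC h); apply: rH; rewrite /ball/= sub0r normrN.
  have rn := rnorm_le (mulr_ge0 (ltW e0) (ltW hp)) Hj.
  have en : enorm (G x (b + h) - G x b - h *: d) <= n%:R * (e * `|h|).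
    by apply: (le_trans (enorm_le_rnorm _)); rewrite ler_wpM2l.
  have := enorm_le_add (G x (b + h) - G x b) (- (G x (b + h) - G x b - h *: d)).
  rewrite enormN opprB addrC subrK enormZ => tri.
  have eE : e * (n%:R + 1) = enorm d - al by rewrite /e divfK ?gt_eqF.
  have h1 := mulr_gt0 e0 hp.
  have : (e * (n%:R + 1)) * `|h| = (enorm d - al) * `|h| by rewrite eE.
  by nra.
have [N Nr] := invS_lt r0; exists N => k Nk.
have k0 : 0 < k.+1%:R^-1 :> R by rewrite invr_gt0 ltr0n.
have kn : `|k.+1%:R^-1 : R| = k.+1%:R^-1 by rewrite gtr0_norm.
case; apply/negP; rewrite -ltNge.
  by have := key k.+1%:R^-1; rewrite kn; apply; [rewrite gt_eqF|exact: Nr].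
by have := key (- k.+1%:R^-1); rewrite normrN kn oppr_eq0; apply; [rewrite gt_eqF|exact: Nr].
Qed.

Variable k0 : R.
Hypothesis h_ge : forall x b, pdef x b -> k0 <= dot (Dh x b) (Dh x b).

Lemma measurable_small_increment k al : measurable
  [set p : n.-tuple R * measurableTypeR R | small_increment k al (vec p.1) p.2].
Proof.
have c (t : R) : continuous (fun p : 'rV[R]_n * R => enorm (G p.1 (p.2 + t) - G p.1 p.2)).
  move=> p; have FF : Filter (nbhs p) := nbhs_filter p.
  have h1 : q.1 @[q --> nbhs p] --> p.1 by exact: cvg_fst.
  have h2 : q.2 @[q --> nbhs p] --> p.2 by exact: cvg_snd.
  have g1 : (fun p : 'rV[R]_n * R => G p.1 p.2) @ nbhs p --> G p.1 p.2 by exact: Gcont.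
  have g2' : (fun p : 'rV[R]_n * R => G p.1 p.2) @ nbhs (p.1, p.2 + t) --> G p.1 (p.2 + t).
    exact: (Gcont (x := (p.1, p.2 + t))).
  have h2t : q.2 + t @[q --> nbhs p] --> p.2 + t by apply: cvgD => //; exact: cvg_cst.
  have g2 : G q.1 (q.2 + t) @[q --> nbhs p] --> G p.1 (p.2 + t).
    exact: (cvg_comp _ _ (cvg_pair h1 h2t) g2').
  have g : G q.1 (q.2 + t) - G q.1 q.2 @[q --> nbhs p] --> G p.1 (p.2 + t) - G p.1 p.2.
    exact: cvgB.
  exact: cvg_enorm g.
have m1 (i : 'I_n) : measurable_fun setT
    (fun p : n.-tuple R * measurableTypeR R => vec p.1 0 i).
  rewrite (_ : (fun _ => _) = (fun p : n.-tuple R * measurableTypeR R => tnth p.1 i)).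
    exact: (measurableT_comp (measurable_tnth i)).
  by apply/funext => p; rewrite mxE.
rewrite (_ : [set p | _] =
  [set p : n.-tuple R * measurableTypeR R |
    enorm (G (vec p.1) (p.2 + k.+1%:R^-1) - G (vec p.1) p.2) <= al * k.+1%:R^-1] `|`
  [set p | enorm (G (vec p.1) (p.2 - k.+1%:R^-1) - G (vec p.1) p.2) <= al * k.+1%:R^-1])//.
apply: measurableU.
  by apply: (measurable_sublevel _ (c k.+1%:R^-1) m1); exact: measurable_snd.
by apply: (measurable_sublevel _ (c (- k.+1%:R^-1)) m1); exact: measurable_snd.
Qed.

(** Where the derivative exists its norm exceeds [al], so short steps have large increments and
    almost no point lies in infinitely many of the sets. Their upper limit is null, and by
    continuity from above the probabilities of the tails tend to 0. *)
Lemma small_increment_cvg0 (a : n.-tuple R) (s al del : R) : s != 0 ->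
  0 <= al -> al ^+ 2 < k0 -> 0 < del ->
  exists N, forall k, (N <= k)%N ->
   ((box_prob a s n \x unif01)
    [set p | small_increment k al (vec p.1) p.2] <= del%:E)%E.
Proof.
move=> s0 al0 alk del0; pose P := (box_prob a s n \x unif01)%E.
pose B k := [set p : n.-tuple R * measurableTypeR R | small_increment k al (vec p.1) p.2].
have mB k : measurable (B k) by exact: measurable_small_increment.
have mlim : measurable (lim_sup_set B).
  by apply: bigcap_measurable => // k _; exact: bigcup_measurable.
pose A := [set p : n.-tuple R * measurableTypeR R | ~ pdef (vec p.1) p.2].
have mA : measurable A.
  apply: measurableC; apply: (measurable_partials_defined Fcont) => // i.
  rewrite (_ : (fun _ => _) = (fun p : n.-tuple R * measurableTypeR R => tnth p.1 i)).
    exact: (measurableT_comp (measurable_tnth i)).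
  by apply/funext => p; rewrite mxE.
have A0 : (box_prob a s n \x unif01)%E A = 0%E.
  apply: product_null_ysection => // t.
  rewrite -[RHS](partials_null Fcont FAC t a 0 s0).
  congr (box_prob _ _ _ _); apply/seteqP; split => w; rewrite /ysection/= inE /A/=;
  by rewrite addr0.
have lim0 : P (lim_sup_set B) = 0%E.
  have FF := ae_filter_ringOfSetsType (box_prob a s n).
  have ae0 : {ae box_prob a s n, forall w, unif01 (xsection (lim_sup_set B) w) = 0%E}.
    apply: filterS (ae_xsection_null mA A0) => w Aw.
    have mX : measurable (xsection A w) by exact: measurable_xsection.
    have aed : {ae mu, forall b : R, 0 < b < 1 -> pdef (vec w) b}.
      exists (xsection A w `&` `[0, 1]%classic); split.
      - by apply: measurableI => //; exact: measurable_itv.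
      - by rewrite -unif01E.
      move=> t /= /not_implyP[/andP[t0 t1] ht]; split; first by rewrite /xsection/= inE.
      by rewrite /= in_itv/= (ltW t0) (ltW t1).
    have := gradient_ae_derive aed.
    have xE : xsection (lim_sup_set B) w = ~` [set t | ~ lim_sup_set B (w, t)].
      apply/seteqP; split => t; rewrite /xsection/= inE; first by move=> ? /(_ _).
      exact: contrapT.
    move=> aeG; rewrite xE; apply: unif01_ae_null.
      by rewrite -xE; exact: measurable_xsection.
    apply: filterS2 aed aeG => t + + t01 => /(_ t01) pd /(_ t01) dG lB.
    have [|N NH] := eventually_large_increment al0 _ dG.
      rewrite -ltr_sqr ?nnegrE ?enorm_ge0// enorm_sqr.
      exact: lt_le_trans (h_ge pd).
    have [k /= Nk Bk] := lB N Logic.I.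
    exact: (NH k Nk).
  have mx := measurable_fun_xsection unif01 mlim.
  rewrite /P /product_measure1 (ae_eq_integral (cst 0%E)) ?integral0//.
  by apply: filterS ae0 => w h _.
have cv := lim_sup_set_cvg (box_prob a s n \x unif01)%E B mB.
have Pfin : (P (\bigcup_(k >= 0) B k) < +oo)%E.
  rewrite (le_lt_trans (probability_le1 _ _))// ?ltry//.
  exact: bigcup_measurable.
have {}cv : P (\bigcup_(k >= N) B k) @[N --> \oo] --> (0 : \bar R).
  by rewrite -lim0; exact: cv.
have /cv : nbhs (0 : \bar R) [set z | (z < del%:E)%E].
  by apply: open_nbhs_nbhs; split; [exact: open_ereal_lt_ereal|rewrite /= lte_fin].
move=> [N _ NH]; exists N => k Nk.
have PN : (P (\bigcup_(k >= N) B k) <= del%:E)%E by apply/ltW/(NH N (leqnn N)).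
apply: le_trans PN; apply: le_measure; rewrite ?inE.
- exact: mB.
- by apply: bigcup_measurable => j _; exact: mB.
by move=> p Bp; exists k.
Qed.

End MixedGradient.

(** * Strong concavity of the envelope *)

Lemma sum_measure_disjoint_le {d} {T : measurableType d} {R : realType}
    (m : {measure set T -> \bar R}) (I : eqType) (s : seq I) (Q : I -> set T) (A : set T) :
  uniq s -> measurable A -> (forall i, i \in s -> measurable (Q i) /\ Q i `<=` A) ->
  (forall i j, i \in s -> j \in s -> i != j -> Q i `&` Q j = set0) ->
  (\sum_(i <- s) m (Q i) <= m A)%E.
Proof.
elim: s A => [|i s IH] A /=; first by rewrite big_nil.
move=> /andP[is_ us] mA mQ dQ; have [mQi QiA] := mQ i (mem_head _ _).
rewrite big_cons (measureDI m mA mQi) setIidr// addeC leeD2r//.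
apply: IH => //; first exact: measurableD.
  move=> j js; have [mQj QjA] := mQ j (mem_behead (s := i :: s) js); split => // x Qx.
  split; first exact: QjA.
  move=> Qix; have := dQ i j (mem_head _ _) (mem_behead (s := i :: s) js).
  have -> : i != j by apply: contra is_ => /eqP ->.
  by move=> /(_ isT)/seteqP[+ _] => /(_ x); apply.
by move=> j k js ks; apply: dQ; rewrite inE ?js ?ks orbT.
Qed.

(** * Counting the time steps with small increments *)

Section Counting.
Context {R : realType} {n : nat}.
Variables (G X : 'rV[R]_n -> R -> 'rV[R]_n) (P : 'rV[R]_n -> R -> R).
Variables (La Lg B cc k0 : R) (u0 : 'rV[R]_n).
Hypotheses (La0 : 0 < La) (Lg0 : 0 <= Lg) (B0 : 0 <= B) (cc0 : 0 < cc) (k00 : 0 <= k0).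
Hypothesis X_expand : forall (u u' : 'rV[R]_n) (b : R), enorm (u - u') <= La * enorm (X u b - X u' b).
Hypothesis X_bound : forall (u : 'rV[R]_n) (b : R), (forall i, `|u 0 i - u0 0 i| <= 1) -> 0 <= b <= 1 ->
  forall i, `|X u b 0 i| <= B.
Hypothesis G_lip : forall (x x' : 'rV[R]_n) (b b' : R),
  enorm (G x b - G x' b') <= Lg * (enorm (x - x') + `|b - b'|).
Hypothesis P_gap : forall (u : 'rV[R]_n) (b b' : R), (b' - b) * (P u b' - P u b) <=
  - cc * (enorm (G (X u b) b' - G (X u b) b) ^+ 2 + enorm (G (X u b') b - G (X u b') b') ^+ 2).
Hypothesis P_cont : forall b : R, P u b @[u --> nbhs u0] --> P u0 b.
Hypothesis measurable_bad : forall k al, measurable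
  [set p : n.-tuple R * measurableTypeR R | small_increment G k al (vec p.1) p.2].
Hypothesis small_bad : forall (a : n.-tuple R) (s al del : R), s != 0 ->
  0 <= al -> al ^+ 2 < k0 -> 0 < del ->
  exists N, forall k, (N <= k)%N -> ((box_prob a s n \x unif01)
    [set p | small_increment G k al (vec p.1) p.2] <= del%:E)%E.

(** In the application [X u b] is [xt u (y + b v)], [G] is [grad_x S] along the line and [P] is
    [slope]; [bad] marks the time nodes [tk k i] at which the increment of [G] at the proximal point
    is small. *)
Let tk (k i : nat) : R := i%:R / k.+1%:R.
Let bad k al u (i : nat) : bool := `[< small_increment G k al (X u (tk k i)) (tk k i) >].
Let nbad k al u : R := \sum_(i < k.+1) (bad k al u i)%:R.

(* Step [i] contributes through the forward increment at [tk i] and the backward one at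
   [tk i.+1]. *)
Lemma increment_few_bad k al u : 0 <= al ->
  P u 1 - P u 0 <= - (2 * cc) * al ^+ 2 * (1 - nbad k al u / k.+1%:R - k.+1%:R^-1).
Proof.
move=> al0; set K : R := k.+1%:R.
have K0 : 0 < K by rewrite ltr0n.
have tS i : tk k i.+1 - tk k i = K^-1.
  by rewrite /tk -/K -mulrBl -(natr1 i) addrAC subrr add0r mul1r.
pose cp (i : nat) : R := enorm (G (X u (tk k i)) (tk k i.+1) - G (X u (tk k i)) (tk k i)) ^+ 2.
pose cm (i : nat) : R := enorm (G (X u (tk k i.+1)) (tk k i) - G (X u (tk k i.+1)) (tk k i.+1)) ^+ 2.
pose g (i : nat) : R := (1 - (bad k al u i)%:R) * (al / K) ^+ 2.
have aK0 : 0 <= al / K by rewrite divr_ge0// ltW.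
have g0 i : 0 <= g i by rewrite mulr_ge0 ?sqr_ge0// subr_ge0 lern1 leq_b1.
have gc i : g i <= cp i.
  rewrite /g /bad; case: asboolP => h; first by rewrite subrr mul0r sqr_ge0.
  rewrite subr0 mul1r ler_sqr ?nnegrE ?enorm_ge0//; apply: contrapT => h'; apply: h; left.
  have -> : tk k i + k.+1%:R^-1 = tk k i.+1 by rewrite -/K -(tS i) addrC subrK.
  by move/negP : h'; rewrite -ltNge => /ltW.
have gm i : g i.+1 <= cm i.
  rewrite /g /bad; case: asboolP => h; first by rewrite subrr mul0r sqr_ge0.
  rewrite subr0 mul1r ler_sqr ?nnegrE ?enorm_ge0//; apply: contrapT => h'; apply: h; right.
  have -> : tk k i.+1 - k.+1%:R^-1 = tk k i by rewrite -/K -(tS i) opprB addrC subrK.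
  by move/negP : h'; rewrite -ltNge => /ltW.
have sumP : P u 1 - P u 0 = \sum_(i < k.+1) (P u (tk k i.+1) - P u (tk k i)).
  rewrite -(big_mkord xpredT (fun i => P u (tk k i.+1) - P u (tk k i))) telescope_sumr//.
  by rewrite /tk -/K mul0r divff ?gt_eqF.
have stepP i : P u (tk k i.+1) - P u (tk k i) <= - cc * K * (cp i + cm i).
  have := P_gap u (tk k i) (tk k i.+1); rewrite tS -/(cp i) -/(cm i) => h.
  by move: h; rewrite ler_pdivrMl// mulrA (mulrC K).
have sg : \sum_(i < k.+1) g i = (K - nbad k al u) * (al / K) ^+ 2.
  rewrite -mulr_suml; congr (_ * _).
  by rewrite big_split sumr_const card_ord sumrN.
have sgp : \sum_(i < k.+1) g i <= \sum_(i < k.+1) cp i by apply: ler_sum => i _; exact: gc.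
(* The sum of backward increments starts at node 1 and misses [g 0], which is worth at most
   [(al / K) ^+ 2]; hence the term [k.+1%:R^-1] in the statement. *)
have sgm : \sum_(i < k.+1) g i - (al / K) ^+ 2 <= \sum_(i < k.+1) cm i.
  rewrite big_ord_recl big_ord_recr/= lerBlDr.
  have h1 : \sum_(i < k) g (bump 0 i) <= \sum_(i < k) cm i.
    by apply: ler_sum => i _; exact: gm.
  have h2 : g 0%N <= (al / K) ^+ 2.
    by rewrite /g ler_piMl ?sqr_ge0// gerBl.
  have h3 : 0 <= cm k by exact: sqr_ge0.
  rewrite [leLHS]addrC; apply: lerD; last exact: h2.
  by apply: le_trans h1 _; rewrite lerDl.
have sumle : P u 1 - P u 0 <= \sum_(i < k.+1) (- cc * K * (cp i + cm i)).
  by rewrite sumP; apply: ler_sum => i _; exact: stepP.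
apply: (le_trans sumle).
rewrite -mulr_sumr big_split /=.
have cK : 0 <= cc * K by rewrite mulr_ge0 ?ltW.
rewrite sg in sgp sgm.
have aux : - cc * K * (\sum_(i < k.+1) cp i + \sum_(i < k.+1) cm i) <=
   - (cc * K * ((K - nbad k al u) * (al / K) ^+ 2 + ((K - nbad k al u) * (al / K) ^+ 2 - (al / K) ^+ 2))).
  by rewrite !mulNr lerN2 ler_wpM2l// lerD.
apply: (le_trans aux); rewrite -subr_ge0.
(* The statement concedes [1 / K] where only [1 / (2 K)] was lost; this is the surplus. *)
rewrite (_ : _ - _ = cc * al ^+ 2 / K); last first.
  field. rewrite gt_eqF//.
by rewrite divr_ge0 ?mulr_ge0 ?sqr_ge0 ?(ltW K0) ?(ltW cc0).
Qed.

Definition cube (c : n.-tuple R) (r b : R) : set (n.-tuple R * measurableTypeR R) :=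
  box c r `*` `[b, b + r[%classic.

Lemma measure_cube_ge (a c : n.-tuple R) (s r b : R) : 0 < s -> 0 < r ->
  (forall i, tnth a i <= tnth c i /\ tnth c i + r <= tnth a i + s) ->
  0 <= b -> b + r <= 1 ->
  ((((r / s) ^+ n) * r)%:E <= (box_prob a s n \x unif01)%E
    (cube c r b))%E.
Proof.
move=> s0 r0 ac b0 br1.
have mJ : measurable (`[b, b + r[%classic : set (measurableTypeR R)).
  exact: (measurable_itv `[b, b + r[).
rewrite product_measure1E//; last exact: measurable_box.
have UJ : unif01 (`[b, b + r[%classic : set (measurableTypeR R)) = r%:E.
  rewrite unif01E// setIidl.
    by rewrite lebesgue_measure_itv/= lte_fin ltrDl r0 -EFinB addrAC subrr add0r.
  move=> t /=; rewrite !in_itv/= => /andP[t1 t2].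
  by rewrite (le_trans b0)//= (le_trans (ltW t2)).
rewrite [X in (_ <= _ * X)%E]UJ EFinM lee_wpmul2r//; first by rewrite lee_fin ltW.
apply: box_prob_box_ge => // i; rewrite ltn_ord; exact: ac.
Qed.

(** The mesh is proportional to the time step: the [(k + 1)^(n + 1)] pairs of a grid point and a
    time node balance cubes whose volume is proportional to the inverse of that number. *)
Let grid k (r : R) (f : {ffun 'I_n -> 'I_k.+1}) : 'rV[R]_n :=
  \row_j (u0 0 j + r * (f j)%:R / k.+1%:R).

Lemma grid_bounds k r (f : {ffun 'I_n -> 'I_k.+1}) i : 0 <= r ->
  u0 0 i <= grid r f 0 i <= u0 0 i + r.
Proof.
move=> r0; have K0 : 0 < k.+1%:R :> R by rewrite ltr0n.
rewrite mxE lerDl lerD2l divr_ge0 ?mulr_ge0 ?(ltW K0)//= ler_pdivrMr//.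
by rewrite ler_wpM2l// ler_nat ltnW.
Qed.

Lemma grid_separated k r (f g : {ffun 'I_n -> 'I_k.+1}) : 0 <= r -> f != g ->
  r / k.+1%:R <= enorm (grid r f - grid r g).
Proof.
move=> r0 fg; have K0 : 0 < k.+1%:R :> R by rewrite ltr0n.
have [j fgj] : exists j, f j != g j.
  apply: contrapT => /forallNP H; move/negP : fg; apply; apply/eqP/ffunP => j.
  by apply/eqP; apply: contrapT => h; apply: (H j); exact/negP.
apply: le_trans (coord_le_enorm _ j); rewrite !mxE.
have -> : u0 0 j + r * (f j)%:R / k.+1%:R - (u0 0 j + r * (g j)%:R / k.+1%:R) =
   r / k.+1%:R * ((f j)%:R - (g j)%:R) by ring.
have rK : 0 <= r / k.+1%:R by rewrite divr_ge0// ltW.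
rewrite normrM (ger0_norm rK) ler_peMr//.
wlog fgl : f g fg fgj / (f j < g j)%N.
  move=> H; have : (f j < g j)%N || (g j < f j)%N by rewrite -neq_ltn.
  by case/orP => h; [|rewrite distrC]; apply: H => //; rewrite eq_sym.
by rewrite distrC -natrB ?(ltnW fgl)// normr_nat ler1n subn_gt0.
Qed.

(* The cubes of side [th / K] around the bad points are disjoint and contained in the
   set of small increments at the larger level [al + 2 Lg (n + 1) th]. *)
Lemma exists_few_bad (th r al lam : R) : 0 < th <= 1 -> La * (n%:R * th) < r -> r <= 1 ->
  0 <= al -> (al + 2 * Lg * (n%:R + 1) * th) ^+ 2 < k0 -> 0 < lam ->
  exists N, forall k, (N <= k)%N -> exists u : 'rV[R]_n,
    (forall i, u0 0 i <= u 0 i <= u0 0 i + r) /\ nbad k al u <= lam * k.+1%:R.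
Proof.
move=> /andP[th0 th1] Lr r1 al0; set al' := al + _ => al'k lam0.
have r0 : 0 < r.
  by apply: le_lt_trans Lr; rewrite !mulr_ge0// ltW.
have al'0 : 0 <= al'.
  by rewrite addr_ge0// !mulr_ge0 ?(ltW th0)// addr_ge0.
(* The box [[- B, B + 1]^n] holds all the points [X u b] in play together with the cubes of side
   [q <= 1] placed at them. *)
pose s := 2 * B + 1.
have s0 : 0 < s by rewrite ltr_wpDl// mulr_ge0.
pose a : n.-tuple R := [tuple - B | i < n].
(* A cube has measure at least [(q / s) ^+ n * q], and there are [K ^+ n.+1] of them; [del] is [lam]
   times the product of the two. *)
pose del := lam * (th / s) ^+ n * th.
have del0 : 0 < del by rewrite !mulr_gt0// exprn_gt0// divr_gt0.
have [N NH] := small_bad a (lt0r_neq0 s0) al'0 al'k del0.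
exists N => k /NH {NH}; set K : R := k.+1%:R; set P1 := (_ \x _)%E => smallP.
have K0 : 0 < K by rewrite ltr0n.
have K1 : 1 <= K by rewrite ler1n.
pose q := th / K.
have q0 : 0 < q by rewrite divr_gt0.
have qi : q <= K^-1 by rewrite ler_pdivrMr// mulVf ?gt_eqF.
have q1 : q <= 1 by rewrite (le_trans qi)// invf_le1.
pose I := ({ffun 'I_n -> 'I_k.+1} * 'I_k.+1)%type.
pose x (p : I) : 'rV[R]_n := X (grid r p.1) (tk k p.2).
pose c (p : I) : n.-tuple R := [tuple x p 0 i | i < n].
pose Q (p : I) : set (n.-tuple R * measurableTypeR R) :=
  cube (c p) q (tk k p.2).
pose badp (p : I) := bad k al (grid r p.1) p.2.
pose A := [set p : n.-tuple R * measurableTypeR R | small_increment G k al' (vec p.1) p.2].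
have t01 (i : 'I_k.+1) : 0 <= tk k i /\ tk k i + K^-1 <= 1.
  split; first by rewrite divr_ge0// ltW.
  rewrite /tk -/K -{2}(mul1r K^-1) -mulrDl ler_pdivrMr// mul1r natr1 ler_nat.
  exact: ltn_ord.
have xB p i : `|x p 0 i| <= B.
  have [h1 h2] := t01 p.2.
  apply: X_bound => [j|]; last first.
    by rewrite h1 (le_trans _ h2)// lerDl invr_ge0 ltW.
  have /andP[g1 g2] := grid_bounds p.1 j (ltW r0).
  by rewrite ler_norml; apply/andP; split; lra.
have Qge p : ((((q / s) ^+ n) * q)%:E <= P1 (Q p))%E.
  have [h1 h2] := t01 p.2.
  apply: measure_cube_ge => // [i|]; last by rewrite (le_trans _ h2)// lerD2l.
  rewrite !tnth_mktuple; have := xB p i; rewrite ler_norml => /andP[h3 h4].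
  by split; rewrite // /s; lra.
have mQ p : measurable (Q p).
  apply: measurableX; first exact: measurable_box.
  exact: (measurable_itv `[tk k p.2, tk k p.2 + q[).
have Qdist p z : Q p z -> enorm (vec z.1 - x p) <= n%:R * q /\ `|z.2 - tk k p.2| <= q.
  move=> [/= bz]; rewrite in_itv/= => /andP[z1 z2]; split; last first.
    by rewrite ler_norml; apply/andP; split; lra.
  apply: (le_trans (enorm_le_rnorm _)); rewrite ler_wpM2l//.
  apply: rnorm_le => [|i]; first exact: ltW.
  have := bz i; rewrite !mxE tnth_mktuple => /andP[h1 h2].
  by rewrite ler_norml; apply/andP; split; lra.
have QA p : badp p -> Q p `<=` A.
  move=> /asboolP bp z /Qdist[zx zt].
  have G1 t : enorm (G (vec z.1) (z.2 + t) - G (vec z.1) z.2) <=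
      enorm (G (x p) (tk k p.2 + t) - G (x p) (tk k p.2)) + 2 * (Lg * ((n%:R + 1) * q)).
    have e1 : enorm (G (vec z.1) (z.2 + t) - G (x p) (tk k p.2 + t)) <= Lg * ((n%:R + 1) * q).
      apply: (le_trans (G_lip _ _ _ _)); rewrite ler_wpM2l// mulrDl mul1r lerD//.
      by rewrite opprD addrACA subrr addr0.
    have e2 : enorm (G (x p) (tk k p.2) - G (vec z.1) z.2) <= Lg * ((n%:R + 1) * q).
      apply: (le_trans (G_lip _ _ _ _)); rewrite ler_wpM2l// mulrDl mul1r lerD//.
        by rewrite enorm_sub_sym.
      by rewrite distrC.
    have := enorm_le_add (G (vec z.1) (z.2 + t) - G (x p) (tk k p.2 + t))
      (G (x p) (tk k p.2 + t) - G (vec z.1) z.2); rewrite subrKA => e3.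
    have := enorm_le_add (G (x p) (tk k p.2 + t) - G (x p) (tk k p.2))
      (G (x p) (tk k p.2) - G (vec z.1) z.2); rewrite subrKA => e4.
    by lra.
  have alE : al' * K^-1 = al * K^-1 + 2 * (Lg * ((n%:R + 1) * q)).
    by rewrite /al' /q; ring.
  case: bp => bp; [left|right]; rewrite -/K alE; apply: (le_trans (G1 _)); exact: lerD.
(* Cubes of different times are disjoint because [q <= K^-1]. At equal times the grid points are at
   least [r / K] apart, so by [X_expand] their images are at least [r / (La K)] apart, more than the
   [n q] that a common point would allow. *)
have Qdisj p p' : p != p' -> Q p `&` Q p' = set0.
  move=> pp'; apply/seteqP; split => // z [Qz Qz'].
  have [h1 h2] := Qdist _ _ Qz; have [h1' h2'] := Qdist _ _ Qz'.
  have tle (o o' : 'I_k.+1) : tk k o <= z.2 -> z.2 < tk k o' + q -> (o <= o')%N.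
    move=> l1 l2; have : tk k o < tk k o' + K^-1.
      by apply: le_lt_trans l1 _; apply: lt_le_trans l2 _; rewrite lerD2l.
    rewrite /tk -/K -[X in _ + X]mul1r -mulrDl ltr_pM2r ?invr_gt0// natr1 ltr_nat.
    by rewrite ltnS.
  have ii : p.2 = p'.2.
    move: Qz Qz' => [_ /=] + [_ /=]; rewrite !in_itv/= => /andP[l1 l2] /andP[l3 l4].
    by apply/val_inj/eqP; rewrite eqn_leq !tle.
  have [ff|ff] := eqVneq p.1 p'.1.
    by move/negP : pp'; apply; rewrite (surjective_pairing p) (surjective_pairing p') ff ii.
  have := grid_separated (ltW r0) ff; rewrite -/K => sep.
  have xx : enorm (x p - x p') <= n%:R * q.
    apply: (le_trans (enorm_le_rnorm _)); rewrite ler_wpM2l//.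
    apply: rnorm_le => [|o]; first exact: ltW.
    move: Qz Qz' => [/= /(_ o) + _] [/= /(_ o) + _]; rewrite !mxE !tnth_mktuple.
    by move=> /andP[l1 l2] /andP[l3 l4]; rewrite ler_norml; apply/andP; split; lra.
  have := le_trans sep (X_expand _ _ (tk k p.2)).
  have -> : X (grid r p'.1) (tk k p.2) = x p' by rewrite /x ii.
  rewrite -/(x p) leNgt => /negP; apply.
  apply: (le_lt_trans (ler_wpM2l (ltW La0) xx)).
  by rewrite ltr_pdivlMr// /q -mulrA -(mulrA n%:R) divfK ?gt_eqF.
pose C := (q / s) ^+ n * q.
have cnt : C * \sum_p (badp p)%:R <= del.
  rewrite mulr_sumr.
  have -> : \sum_p C * (badp p)%:R = \sum_(p | badp p) C.
    rewrite [RHS]big_mkcond; apply: eq_bigr => p _.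
    by case: (badp p); rewrite ?mulr1 ?mulr0.
  rewrite -lee_fin -sumEFin; apply: le_trans smallP.
  have := @sum_measure_disjoint_le _ _ _ P1 _ [seq p <- index_enum I | badp p] Q A
    (filter_uniq _ (index_enum_uniq I)) (measurable_bad k al').
  rewrite big_filter => H; apply: le_trans (H _ _); last first.
  - by move=> p p' _ _; exact: Qdisj.
  - by move=> p; rewrite mem_filter => /andP[bp _]; split; [exact: mQ|exact: QA].
  by apply: lee_sum => p _; exact: Qge.
have sumE : \sum_p (badp p)%:R = \sum_(f : {ffun 'I_n -> 'I_k.+1}) nbad k al (grid r f).
  by rewrite /nbad pair_bigA; apply: eq_bigr.
have CE : C * K ^+ n.+1 = (th / s) ^+ n * th.
  rewrite /C /q exprS; have -> : th / K / s = th / s / K by rewrite mulrAC.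
  rewrite [(_ / K) ^+ n]expr_div_n; field.
  by rewrite expf_neq0 gt_eqF.
have Cp : 0 < C by rewrite mulr_gt0// exprn_gt0// divr_gt0.
have tot : \sum_(f : {ffun 'I_n -> 'I_k.+1}) nbad k al (grid r f) <= lam * K ^+ n.+1.
  rewrite -sumE -(ler_pM2l Cp); apply: (le_trans cnt).
  by rewrite mulrCA CE /del mulrA.
(* Pigeonhole: if each of the [(k + 1)^n] grid points had more than [lam * K] bad nodes, the total
   would exceed the bound [tot]. *)
apply: contrapT => /forallNP H; move: tot; rewrite leNgt => /negP; apply.
have nb f : lam * K < nbad k al (grid r f).
  rewrite ltNge; apply/negP => h; apply: (H (grid r f)); split => // o.
  exact: grid_bounds (ltW r0).
have -> : lam * K ^+ n.+1 = \sum_(f : {ffun 'I_n -> 'I_k.+1}) lam * K.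
  by rewrite sumr_const card_ffun !card_ord exprS mulrA -mulr_natr natrX.
apply: ltr_sum => //; apply/hasP; exists [ffun=> ord0] => //; exact: mem_index_enum.
Qed.

Lemma small_parameter (c t th : R) : 0 <= c -> 0 < t -> 0 < th -> th <= t / (c + 1) -> c * th < t.
Proof.
move=> c0 t0 th0; have c1 : 0 < c + 1 by rewrite ltr_wpDl.
by rewrite ler_pdivlMr// mulrDr mulr1 mulrC => h; lra.
Qed.

(** The level [al] approaches the square root of [k0] as [lam] shrinks, while the proportion of bad
    steps is at most [lam]. The error [e] is split into two quarters for the continuity of [P] in
    [u] and one half for the loss in the constant. *)
Theorem slope_decrement : P u0 1 - P u0 0 <= - (2 * cc) * k0.
Proof.
(* For [k0 = 0] no level satisfies [al ^+ 2 < k0], and the claim is the monotonicity contained in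
   [P_gap]. *)
move: k00; rewrite le_eqVlt => /predU1P[<-|kp].
  have := P_gap u0 0 1; rewrite subr0 mul1r mulr0 => /le_trans; apply.
  rewrite mulNr oppr_le0; apply: mulr_ge0; first exact: ltW.
  by rewrite addr_ge0// sqr_ge0.
pose q := Num.sqrt k0.
have q0 : 0 < q by rewrite sqrtr_gt0.
have qE : q ^+ 2 = k0 by rewrite sqr_sqrtr.
apply/ler_addgt0Pr => e e0.
have e4 : 0 < e / 4 by rewrite divr_gt0.
pose lam := Num.min (1 / 4) (e / 2 / (8 * cc * k0 + 1)).
have ck0 : 0 <= 8 * cc * k0 by rewrite !mulr_ge0// ltW.
have lam0 : 0 < lam by rewrite lt_min !divr_gt0// ltr_wpDl.
have lam4 : lam <= 1 / 4 by rewrite /lam ge_min lexx.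
have lame : 8 * cc * k0 * lam < e / 2.
  by apply: small_parameter; rewrite ?divr_gt0// /lam ge_min lexx orbT.
have pc0 : P u 0 @[u --> nbhs u0] --> P u0 0 by exact: P_cont.
move/cvgrPdist_le : pc0 => /(_ _ e4); rewrite -nbhs_ballE => -[d1 /= d10 H1].
have pc1 : P u 1 @[u --> nbhs u0] --> P u0 1 by exact: P_cont.
move/cvgrPdist_le : pc1 => /(_ _ e4); rewrite -nbhs_ballE => -[d2 /= d20 H2].
pose r := Num.min 1 (Num.min (d1 / 2) (d2 / 2)).
have r0 : 0 < r by rewrite !lt_min ltr01 !divr_gt0.
have r1 : r <= 1 by rewrite /r ge_min lexx.
have rd1 : r < d1.
  have : r <= d1 / 2 by rewrite /r !ge_min lexx !orbT.
  by lra.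
have rd2 : r < d2.
  have : r <= d2 / 2 by rewrite /r !ge_min lexx !orbT.
  by lra.
pose c1 := La * n%:R; pose c2 := 2 * Lg * (n%:R + 1).
have c10 : 0 <= c1 by rewrite mulr_ge0// ltW.
have c20 : 0 <= c2 by rewrite !mulr_ge0// addr_ge0.
have t20 : 0 < q * lam / 2 by rewrite divr_gt0 ?mulr_gt0.
pose th := Num.min 1 (Num.min (r / (c1 + 1)) (q * lam / 2 / (c2 + 1))).
have th0 : 0 < th by rewrite !lt_min ltr01 !divr_gt0// ?ltr_wpDl// mulr_gt0.
have th1 : th <= 1 by rewrite /th ge_min lexx.
have thr : La * (n%:R * th) < r.
  rewrite mulrA; apply: small_parameter => //.
  by rewrite /th !ge_min lexx orbT.
have thq : c2 * th < q * lam / 2.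
  by apply: small_parameter => //; rewrite /th !ge_min lexx !orbT.
(* Enlarging this level for the cubes adds less than [q * lam / 2], which keeps it below [q], the
   square root of [k0]. *)
pose al := q * (1 - lam).
have al0 : 0 <= al by rewrite mulr_ge0 ?(ltW q0)// subr_ge0; lra.
have al'k : (al + 2 * Lg * (n%:R + 1) * th) ^+ 2 < k0.
  rewrite -qE ltr_sqr ?nnegrE ?(ltW q0)//; last by rewrite addr_ge0// mulr_ge0// ltW.
  by rewrite -/c2 /al; have := mulr_gt0 q0 lam0; lra.
have thI : 0 < th <= 1 by rewrite th0.
have [N1 H] := exists_few_bad thI thr r1 al0 al'k lam0.
have [N2 HN2] := invS_lt lam0.
have [u [uI nb]] := H (maxn N1 N2) (leq_maxl _ _).
have /HN2 Kl := leq_maxr N1 N2.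
move: (maxn N1 N2) nb Kl => k nb Kl.
have K0 : 0 < k.+1%:R :> R by rewrite ltr0n.
have uu : `|u0 - u| <= r.
  apply: rnorm_le => [|i]; first exact: ltW.
  by have /andP[l1 l2] := uI i; rewrite !mxE ler_norml; apply/andP; split; lra.
have P0 : `|P u0 0 - P u 0| <= e / 4.
  by apply: H1; rewrite -ball_normE /ball_/=; exact: le_lt_trans rd1.
have P1 : `|P u0 1 - P u 1| <= e / 4.
  by apply: H2; rewrite -ball_normE /ball_/=; exact: le_lt_trans rd2.
have := increment_few_bad k u al0.
have nbK : nbad k al u / k.+1%:R <= lam by rewrite ler_pdivrMr.
have alE : al ^+ 2 = k0 * (1 - lam) ^+ 2 by rewrite exprMn qE.
have cal0 : 0 <= 2 * cc * al ^+ 2.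
  by apply: mulr_ge0; [apply: mulr_ge0; rewrite // ltW|exact: sqr_ge0].
have main : 2 * cc * al ^+ 2 * (1 - lam - lam) <=
    2 * cc * al ^+ 2 * (1 - nbad k al u / k.+1%:R - k.+1%:R^-1).
  by rewrite ler_wpM2l// lerB ?lerB// ltW.
have ckp : 0 < cc * k0 by rewrite mulr_gt0.
(* This is [(1 - lam)^2 (1 - 2 lam) >= 1 - 4 lam], scaled by [2 cc k0]. *)
have low : 2 * cc * k0 - 8 * cc * k0 * lam <= 2 * cc * al ^+ 2 * (1 - lam - lam).
  rewrite alE -subr_ge0.
  have -> : 2 * cc * (k0 * (1 - lam) ^+ 2) * (1 - lam - lam) - (2 * cc * k0 - 8 * cc * k0 * lam)
     = (cc * k0) * (2 * lam ^+ 2 * (5 - 2 * lam)) by ring.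
  apply: mulr_ge0; first exact: ltW.
  by apply: mulr_ge0; [apply: mulr_ge0 => //; exact: sqr_ge0|lra].
move: P0 P1; rewrite !ler_norml => /andP[a1 a2] /andP[b1 b2].
move: (le_trans low main); rewrite !mulNr; move: (_ * (1 - nbad _ _ _ / _ - _)) => M.
by lra.
Qed.

End Counting.

Lemma abs_continuous_lipschitz {R : realType} {V W : normedModType R} (a b C : R)
    (f : R -> V) (g : R -> W) : 0 <= C ->
  (forall s t, `|g t - g s| <= C * `|f t - f s|) ->
  absolutely_continuous a b f -> absolutely_continuous a b g.
Proof.
move=> C0 gf fAC e e0; have C1 : 0 < C + 1 by rewrite ltr_wpDl.
have [d d0 H] := fAC (e / (C + 1)) (divr_gt0 e0 C1); exists d => // k I Iab Itriv Isum.
have := H k I Iab Itriv Isum; rewrite ltr_pdivlMr//; apply: le_lt_trans.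
rewrite mulr_suml; apply: ler_sum => i _; apply: (le_trans (gf _ _)).
by rewrite mulrC ler_wpM2l// lerDl.
Qed.

(** * Decrease of the slope of the envelope *)

Section StrongConcavity.
Context {R : realType} {n m : nat}.
Variables (S : 'rV[R]_n -> 'rV[R]_m -> R) (rho mu l sigma kappa : R).
Hypotheses (hcc : convex_concave S) (hC1 : continuously_differentiable S).
Hypothesis hAC : abs_continuous_along_segments (full_gradient S).
Hypotheses (hrho : 0 < rho) (hmu : 0 < mu) (hl : 0 < l) (hsigma : 0 < sigma) (hkappa : 0 < kappa).
Hypothesis ha_sc : forall y, strongly_convex mu (fun x => S x y).
Hypothesis ha_lip : forall y, lipschitz_gradient l (fun x => S x y).
Hypothesis hb : forall u y, J_mixed_defined rho S u y ->
     row_free (J_mixed rho S u y) /\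
     loewner_le kappa%:M (J_mixed rho S u y *m (J_mixed rho S u y)^T) /\
     loewner_le (J_mixed rho S u y *m (J_mixed rho S u y)^T) sigma%:M.
Local Notation T := (prox_envelope rho S).
Local Notation xt := (prox_point rho S).

Section Line.
Variables (y v : 'rV[R]_m).
Let F (x : 'rV[R]_n) (b : R) := grad_y S x (y + b *: v).
Let G (x : 'rV[R]_n) (b : R) := grad_x S x (y + b *: v).
Let f (x : 'rV[R]_n) (b : R) := S x (y + b *: v).

Lemma line_pair_continuous (p : 'rV[R]_n * R) :
  q.1 @[q --> nbhs p] --> p.1 /\ y + q.2 *: v @[q --> nbhs p] --> y + p.2 *: v.
Proof.
have FF : Filter (nbhs p) := nbhs_filter p; split; first exact: cvg_fst.
have h2 : q.2 @[q --> nbhs p] --> p.2 by exact: cvg_snd.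
exact: (cvg_comp _ _ h2 (line_continuous (y := y) (v := v) (b := p.2))).
Qed.

Lemma grad_y_line_continuous : continuous (fun p : 'rV[R]_n * R => F p.1 p.2).
Proof.
move=> p; have FF : Filter (nbhs p) := nbhs_filter p.
have [h1 h2] := line_pair_continuous p; exact: (cvg_grad_y hC1 h1 h2).
Qed.

Lemma grad_x_line_continuous : continuous (fun p : 'rV[R]_n * R => G p.1 p.2).
Proof.
move=> p; have FF : Filter (nbhs p) := nbhs_filter p.
have [h1 h2] := line_pair_continuous p; exact: (cvg_grad_x hC1 h1 h2).
Qed.

Lemma grad_y_abs_continuous x z b : absolutely_continuous 0 1 (fun t : R => F (x + t *: (z - x)) b).
Proof.
apply: (abs_continuous_lipschitz (C := 1) ler01 _ (hAC (x, y + b *: v) (z, y + b *: v))).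
move=> s t; rewrite mul1r /F.
have E r : full_gradient S ((x, y + b *: v) + r *: ((z, y + b *: v) - (x, y + b *: v))) =
    (grad_x S (x + r *: (z - x)) (y + b *: v), grad_y S (x + r *: (z - x)) (y + b *: v)).
  by rewrite /full_gradient /= subrr scaler0 addr0.
by rewrite !E prod_normE /= le_max lexx orbT.
Qed.

Lemma grad_y_component_abs_continuous x z b i :
  absolutely_continuous 0 1 (fun t : R => F (x + t *: (z - x)) b 0 i).
Proof.
apply: (abs_continuous_lipschitz (C := 1) ler01 _ (grad_y_abs_continuous x z b)) => s t.
have := coord_le_rnorm (F (x + t *: (z - x)) b - F (x + s *: (z - x)) b) i.
by rewrite !mxE mul1r.
Qed.

Lemma slope_abs_continuous x z b :
  absolutely_continuous 0 1 (fun t : R => dot (F (x + t *: (z - x)) b) v).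
Proof.
have C0 : 0 <= m%:R * enorm v by rewrite mulr_ge0 ?enorm_ge0.
apply: (abs_continuous_lipschitz C0 _ (grad_y_abs_continuous x z b)) => s t.
rewrite -dotBl; set d := F _ b - _.
have d1 : enorm d * enorm v <= m%:R * enorm v * `|d|.
  by rewrite mulrAC ler_wpM2r ?enorm_ge0// enorm_le_rnorm.
rewrite ler_norml; apply/andP; split; last by apply: le_trans d1; exact: dot_enorm.
rewrite lerNl -dotNl; apply: le_trans d1; rewrite -(enormN d); exact: dot_enorm.
Qed.

(** By [prox_surj] the hypothesis on the mixed derivatives can be used at an arbitrary [x]. The
    gradient in question is [v *m J], whose squared norm is the quadratic form of [J J^T] at [v]. *)
Lemma gradient_slope_bounds x b : partials_defined (F^~ b) x ->
  kappa * dot v v <= dot (gradient (fun z => dot (F z b) v) x) (gradient (fun z => dot (F z b) v) x)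
    <= sigma * dot v v.
Proof.
move=> pd; set yb := y + b *: v.
have := @hb (x + rho^-1 *: grad_x S x yb) yb.
rewrite /J_mixed_defined /J_mixed (prox_surj hC1 hrho hmu ha_sc) => /(_ pd)[_ [h1 h2]].
have := h1 v; have := h2 v.
set J := partials_mx _ _.
have DE : gradient (fun z => dot (F z b) v) x = v *m J.
  apply/rowP => j; rewrite !mxE.
  have -> : (fun z => dot (F z b) v) = \sum_i (fun z => F z b 0 i * v 0 i).
    by apply/funext => z; rewrite /dot fct_sumE.
  rewrite derive_sum; last by move=> i; apply: derivableM; [exact: pd|exact: derivable_cst].
  apply: eq_bigr => i _; rewrite !mxE deriveM; [|exact: pd|exact: derivable_cst].
  by rewrite derive_cst scaler0 add0r.
have JE : (v *m (J *m J^T) *m v^T) 0 0 = dot (v *m J) (v *m J).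
  by rewrite mulmxA -mulmxA -trmx_mul mxE /dot; apply: eq_bigr => i _; rewrite [_^T _ _]mxE.
have cE (c : R) : (v *m c%:M *m v^T) 0 0 = c * dot v v.
  by rewrite mul_mx_scalar -scalemxAl mxE mxE /dot; congr (_ * _); apply: eq_bigr => i _; rewrite mxE.
rewrite DE !mulmxBr !mulmxBl.
have BE (A A' : 'M[R]_1) : (A - A') 0 0 = A 0 0 - A' 0 0 by rewrite !mxE.
by rewrite !BE JE !cE !subr_ge0 => -> ->.
Qed.

Let L : R := Num.sqrt sigma * enorm v.

Lemma slope_bound_ge0 : 0 <= L.
Proof. by rewrite mulr_ge0 ?sqrtr_ge0 ?enorm_ge0. Qed.

Lemma gradient_slope_le x b : partials_defined (F^~ b) x ->
  dot (gradient (fun z => dot (F z b) v) x) (gradient (fun z => dot (F z b) v) x) <= L ^+ 2.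
Proof.
move=> /gradient_slope_bounds /andP[_]; rewrite /L exprMn sqr_sqrtr ?(ltW hsigma)//.
by rewrite enorm_sqr.
Qed.

Lemma gradient_slope_ge x b : partials_defined (F^~ b) x ->
  kappa * dot v v <=
  dot (gradient (fun z => dot (F z b) v) x) (gradient (fun z => dot (F z b) v) x).
Proof. by move=> /gradient_slope_bounds /andP[]. Qed.

Lemma is_derive_line_time x (b : R) : is_derive b 1 (f x) (dot (F x b) v).
Proof. by apply: is_derive_line; exact: differentiable_right. Qed.

Lemma is_derive_line_space x b j : is_derive x (delta_mx 0 j : 'rV[R]_n) (f^~ b) (G x b 0 j).
Proof.
by rewrite /G mxE; split => //; apply: diff_derivable; exact: differentiable_left.
Qed.

(** The factor [n] comes from passing from the sup norm to the Euclidean one; it enters only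
    auxiliary constants of the counting and leaves the rate intact. *)
Lemma grad_x_lipschitz_time x b b' : enorm (G x b' - G x b) <= n%:R * L * `|b' - b|.
Proof.
apply: (le_trans (enorm_le_rnorm _)); rewrite -mulrA ler_wpM2l//.
apply: rnorm_le => [|j]; first by rewrite mulr_ge0 ?slope_bound_ge0.
have E (A A' : 'rV[R]_n) : (A - A') 0 j = A 0 j - A' 0 j by rewrite !mxE.
rewrite E.
exact: (gradient_lipschitz_time grad_y_line_continuous grad_y_component_abs_continuous slope_abs_continuous
  slope_bound_ge0 gradient_slope_le is_derive_line_time is_derive_line_space).
Qed.

(** In the sum of [envelope_gap] from [b] to [b'] and back the values of [T] cancel, and the
    increments of [G] at both ends remain. *)
Lemma slope_gap (u : 'rV[R]_n) b b' : (b' - b) * (slope S rho y v u b' - slope S rho y v u b) <=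
  - (2 * (l + rho))^-1 * (enorm (G (xt u (y + b *: v)) b' - G (xt u (y + b *: v)) b) ^+ 2 +
    enorm (G (xt u (y + b' *: v)) b - G (xt u (y + b' *: v)) b') ^+ 2).
Proof.
have E c c' : y + c *: v - (y + c' *: v) = (c - c') *: v.
  by rewrite opprD addrACA subrr add0r scalerBl.
have arith (T1 T2 d1 d2 A1 A2 q : R) : T2 <= T1 + (b' - b) * d1 - A1 / q ->
    T1 <= T2 + (b - b') * d2 - A2 / q -> (b' - b) * (d2 - d1) <= - q^-1 * (A1 + A2) by lra.
have gap a a' : T u (y + a' *: v) <= T u (y + a *: v) + (a' - a) * slope S rho y v u a -
    enorm (G (xt u (y + a *: v)) a' - G (xt u (y + a *: v)) a) ^+ 2 / (2 * (l + rho)).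
  rewrite /slope -dotZr -E.
  exact: (envelope_gap hcc hC1 hrho hmu ha_sc u (y + a *: v) (y + a' *: v) hl ha_lip).
exact: arith (gap b b') (gap b' b).
Qed.

(** The inverse [x |-> x + rho^-1 *: grad_x S x y] of the proximal map has Lipschitz constant
    [1 + l / rho]. *)
Lemma prox_expand (u u' : 'rV[R]_n) b :
  enorm (u - u') <= (1 + l / rho) * enorm (xt u (y + b *: v) - xt u' (y + b *: v)).
Proof.
set yb := y + b *: v.
have uE w : w = xt w yb + rho^-1 *: grad_x S (xt w yb) yb.
  by rewrite (prox_opt hC1 hrho hmu ha_sc) scalerA mulVf ?gt_eqF// scale1r addrC subrK.
rewrite {1}(uE u) {1}(uE u') opprD addrACA -scalerBr mulrDl mul1r.
apply: (le_trans (enorm_le_add _ _)); rewrite lerD2l enormZ.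
rewrite gtr0_norm ?invr_gt0// mulrC mulrAC ler_pM2r ?invr_gt0//.
exact: ha_lip.
Qed.

Lemma prox_line_bound (u0 u : 'rV[R]_n) b : (forall i, `|u 0 i - u0 0 i| <= 1) -> 0 <= b <= 1 ->
  forall i, `|xt u (y + b *: v) 0 i| <= enorm (xt u0 y) + n%:R + n%:R * L / (mu + rho).
Proof.
move=> uu /andP[b0 b1] i; have mr0 : 0 < mu + rho by exact: addr_gt0.
apply: (le_trans (coord_le_enorm _ _)).
have h1 : enorm (xt u (y + b *: v) - xt u0 (y + b *: v)) <= n%:R.
  apply: (@le_trans _ _ (enorm (u - u0))).
    rewrite enorm_le_dot ?enorm_ge0// enorm_sqr.
    exact: (prox_nonexpansive hC1 hrho hmu ha_sc).
  apply: (le_trans (enorm_le_rnorm _)); rewrite ler_piMr//.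
  by apply: rnorm_le => // j; rewrite !mxE.
have h2 : enorm (xt u0 (y + b *: v) - xt u0 y) <= n%:R * L / (mu + rho).
  rewrite ler_pdivlMr// mulrC.
  apply: (le_trans (prox_lipschitz_y hC1 hrho hmu ha_sc _ _ _)).
  have := grad_x_lipschitz_time (xt u0 y) 0 b; rewrite /G scale0r addr0 subr0 => /le_trans; apply.
  by rewrite ger0_norm// ler_piMr// mulr_ge0 ?slope_bound_ge0.
have := enorm_le_add (xt u (y + b *: v) - xt u0 (y + b *: v)) (xt u0 (y + b *: v)).
have := enorm_le_add (xt u0 (y + b *: v) - xt u0 y) (xt u0 y).
rewrite !subrK => e1 e2; apply: (le_trans (le_trans e2 (lerD h1 (le_trans e1 (lerD h2 (lexx _)))))).
by rewrite -(addrA (enorm _)) [leRHS]addrC -addrA.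
Qed.

(** The counting theorem with [cc] the inverse of [2 * (l + rho)] and [k0 = kappa * dot v v], so
    that [2 * cc * k0] is the asserted decrement. *)
Lemma slope_decrement_prox u :
  slope S rho y v u 1 - slope S rho y v u 0 <= - (kappa / (l + rho)) * dot v v.
Proof.
have lr0 : 0 < l + rho by exact: addr_gt0.
have La0 : 0 < 1 + l / rho by rewrite addr_gt0// divr_gt0.
have Lg0 : 0 <= l + n%:R * L by rewrite addr_ge0 ?(ltW hl)// mulr_ge0 ?slope_bound_ge0.
have B0 : 0 <= enorm (xt u y) + n%:R + n%:R * L / (mu + rho).
  apply: addr_ge0; first by rewrite addr_ge0 ?enorm_ge0.
  apply: divr_ge0; last exact/ltW/addr_gt0.
  by apply: mulr_ge0 => //; exact: slope_bound_ge0.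
have cc0 : 0 < (2 * (l + rho))^-1 by rewrite invr_gt0 mulr_gt0.
have k00 : 0 <= kappa * dot v v by rewrite mulr_ge0 ?dot_ge0// ltW.
have G_lip x x' b b' : enorm (G x b - G x' b') <= (l + n%:R * L) * (enorm (x - x') + `|b - b'|).
  have e1 : enorm (G x b - G x' b) <= l * enorm (x - x') by exact: ha_lip.
  have e2 := grad_x_lipschitz_time x' b' b.
  have e3 : enorm (G x b - G x' b') <= enorm (G x b - G x' b) + enorm (G x' b - G x' b').
    by rewrite -(subrKA (G x' b) (G x b)); exact: enorm_le_add.
  apply: (le_trans e3); apply: (le_trans (lerD e1 e2)); rewrite mulrDr lerD//.
    by rewrite ler_wpM2r ?enorm_ge0// lerDl mulr_ge0 ?slope_bound_ge0.
  by rewrite ler_wpM2r// lerDr ltW.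
have P_cont b : slope S rho y v w b @[w --> nbhs u] --> slope S rho y v u b.
  exact: (slope_continuous_u hC1 hrho hmu ha_sc).
have mbad := measurable_small_increment grad_x_line_continuous.
have sbad := small_increment_cvg0 grad_y_line_continuous grad_y_component_abs_continuous slope_abs_continuous
  slope_bound_ge0 gradient_slope_le is_derive_line_time is_derive_line_space grad_x_line_continuous gradient_slope_ge.
have := slope_decrement La0 Lg0 B0 cc0 k00 prox_expand (prox_line_bound (u0 := u)) G_lip
  slope_gap P_cont mbad (fun a s al del => @sbad a s al del).
move=> /le_trans; apply; rewrite le_eqVlt; apply/orP; left; apply/eqP.
by field; rewrite gt_eqF.
Qed.

End Line.
End StrongConcavity.

(** * Saddle points and decay *)

Section Saddle.
Context {R : realType} {n m : nat}.
Variables (S : 'rV[R]_n -> 'rV[R]_m -> R) (rho mu l sigma kappa : R).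
Hypotheses (hcc : convex_concave S) (hC1 : continuously_differentiable S).
Hypothesis hAC : abs_continuous_along_segments (full_gradient S).
Hypotheses (hrho : 0 < rho) (hmu : 0 < mu) (hl : 0 < l) (hsigma : 0 < sigma) (hkappa : 0 < kappa).
Hypothesis ha_sc : forall y, strongly_convex mu (fun x => S x y).
Hypothesis ha_lip : forall y, lipschitz_gradient l (fun x => S x y).
Hypothesis hb : forall u y, J_mixed_defined rho S u y ->
     row_free (J_mixed rho S u y) /\
     loewner_le kappa%:M (J_mixed rho S u y *m (J_mixed rho S u y)^T) /\
     loewner_le (J_mixed rho S u y *m (J_mixed rho S u y)^T) sigma%:M.
Local Notation T := (prox_envelope rho S).
Local Notation xt := (prox_point rho S).
Let c1 := mu * rho / (mu + rho).
Let c2 := kappa / (l + rho).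
Let gx (u : 'rV[R]_n) (y : 'rV[R]_m) : 'rV[R]_n := rho *: (u - xt u y).
Let gy (u : 'rV[R]_n) (y : 'rV[R]_m) : 'rV[R]_m := grad_y S (xt u y) y.

Lemma envelope_strongly_concave (u : 'rV[R]_n) (y y' : 'rV[R]_m) :
  T u y' <= T u y + dot (gy u y) (y' - y) - c2 / 2 * dot (y' - y) (y' - y).
Proof.
set v := y' - y.
pose s b := slope S rho y v u b.
pose psi (b : R) := T u (y + b *: v) + (- s 0 * b + c2 / 2 * dot v v * b ^+ 2).
have dpsi (b : R) : is_derive b 1 psi (s b + (- s 0 + 2 * (c2 / 2 * dot v v) * b)).
  apply: is_deriveD; first exact: (is_derive_envelope_line hcc hC1 hrho hmu ha_sc).
  exact: is_derive_quadratic.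
have [c /andP[c0 c1'] h] := mvt01 dpsi.
(* The mean value theorem yields a [c] that cannot be prescribed; the direction [c *: v] turns the
   decrement over [[0, 1]] into one over [[0, c]]. *)
have := slope_decrement_prox hcc hC1 hAC hrho hmu hl hsigma hkappa ha_sc ha_lip hb y (c *: v) u.
have sE b : slope S rho y (c *: v) u b = c * s (b * c).
  by rewrite /s /slope !scalerA dotZr.
rewrite !sE mul1r mul0r dotZl dotZr -mulrBr -/c2 => h2.
have h3 : s c - s 0 <= - c2 * (c * dot v v).
  by rewrite -(ler_pM2l c0); apply: (le_trans h2); rewrite mulrCA.
have s0E : s 0 = dot (gy u y) v by rewrite /s /slope scale0r addr0.
have vE : y + v = y' by rewrite /v addrC subrK.
move: h; rewrite /psi scale1r vE scale0r addr0 -s0E.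
move: h3; move: (T _ _) (T _ _) (s c) (s 0) (dot v v) => T1 T2 sc s0 D h3.
by lra.
Qed.

(** In [u], a gradient step of length [rho^-1] lowers [T] by [envelope_upper] unless the gradient
    vanishes; in [y], the derivative in the direction of the gradient itself is nonpositive at a
    maximum. *)
Lemma saddle_critical (w : 'rV[R]_n * 'rV[R]_m) : saddle_point T w ->
  gx w.1 w.2 = 0 /\ gy w.1 w.2 = 0.
Proof.
case: w => u y /= sp; split; apply/dot_eq0/eqP; rewrite eq_le dot_ge0 andbT.
  have := envelope_upper hC1 hrho hmu ha_sc u (u - rho^-1 *: gx u y) y.
  have [_ /le_trans] := sp (u - rho^-1 *: gx u y) y; move=> /[apply].
  have -> : u - rho^-1 *: gx u y - u = - (rho^-1 *: gx u y) by rewrite addrAC subrr add0r.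
  rewrite /= -dotZl -/(gx u y) !(dotNr, dotNl) !(dotZr, dotZl) opprK.
  move: (dot _ _) (T _ _) => D t h.
  have -> : D = 2 * rho * (rho^-1 * D - rho / 2 * (rho^-1 * (rho^-1 * D))).
    by field; rewrite gt_eqF.
  by rewrite pmulr_rle0 ?mulr_gt0//; lra.
have d := is_derive_envelope_line hcc hC1 hrho hmu ha_sc y (gy u y) u 0.
have := derive_le0_right_max d; rewrite /slope !scale0r addr0 -/(gy u y); apply.
by move=> t _; have [h _] := sp u (y + t *: gy u y).
Qed.

(** The strong convexity and concavity inequalities are used from [w] and from [ws]: the values of
    [T] at the four corners cancel, the gradients at [ws] vanish, and the halves of the moduli add
    up. *)
Lemma saddle_strongly_monotone (ws w : 'rV[R]_n * 'rV[R]_m) : saddle_point T ws ->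
  c1 * dot (w.1 - ws.1) (w.1 - ws.1) + c2 * dot (w.2 - ws.2) (w.2 - ws.2) <=
  dot (gx w.1 w.2) (w.1 - ws.1) - dot (gy w.1 w.2) (w.2 - ws.2).
Proof.
move=> sp; have [gx0 gy0] := saddle_critical sp.
case: ws w sp gx0 gy0 => us ys [u y] /= sp gx0 gy0.
have h1 := envelope_strongly_convex hC1 hrho hmu ha_sc u us y.
have h2 := envelope_strongly_concave u y ys.
have h3 := envelope_strongly_convex hC1 hrho hmu ha_sc us u ys.
have h4 := envelope_strongly_concave us ys y.
move: h3 h4 h1; rewrite -!dotZl -/(gx us ys) gx0 gy0 !dot0l -/c1 -/(gx u y) => h3 h4 h1.
have uE : us - u = - (u - us) by rewrite opprB.
have yE : ys - y = - (y - ys) by rewrite opprB.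
move: h1 h2 h3 h4; rewrite uE yE; move: (gx u y) (gy u y) => a b.
rewrite !(dotZl, dotNr, dotNl) !opprK.
by lra.
Qed.

Lemma rates_gt0 : 0 < c1 /\ 0 < c2.
Proof. by rewrite /c1 /c2 !divr_gt0 ?mulr_gt0 ?addr_gt0. Qed.

Lemma saddle_unique ws w : saddle_point T ws -> saddle_point T w -> ws = w.
Proof.
move=> sps sp; have [gx0 gy0] := saddle_critical sp.
have := saddle_strongly_monotone w sps; rewrite gx0 gy0 !dot0l subr0 => h.
have [c10 c20] := rates_gt0.
have h1 := mulr_ge0 (ltW c10) (dot_ge0 (w.1 - ws.1)).
have h2 := mulr_ge0 (ltW c20) (dot_ge0 (w.2 - ws.2)).
have e1 : w.1 - ws.1 = 0.
  apply/dot_eq0/eqP; rewrite eq_le dot_ge0 andbT -(pmulr_rle0 _ c10); lra.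
have e2 : w.2 - ws.2 = 0.
  apply/dot_eq0/eqP; rewrite eq_le dot_ge0 andbT -(pmulr_rle0 _ c20); lra.
rewrite (surjective_pairing ws) (surjective_pairing w).
by rewrite (subr0_eq e1) (subr0_eq e2).
Qed.

(** The same point works: [T z b <= S z b] always, and [S x y <= T a y] because [x] minimizes [S] at
    [y]. *)
Lemma saddle_envelope w : saddle_point S w -> saddle_point T w.
Proof.
case: w => x y sp u y' /=.
have obj_ge z : S z y' <= prox_objective rho S u y' z.
  by rewrite /prox_objective lerDl mulr_ge0 ?sqr_ge0// divr_ge0// ltW.
have objE z b : prox_objective rho S z b z = S z b.
  by rewrite /prox_objective subrr enorm_sqr dot0l mulr0 addr0.
have le_obj (z b : _) (a : 'rV[R]_n) : S z b <= prox_objective rho S a b z.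
  by rewrite /prox_objective lerDl mulr_ge0 ?sqr_ge0// divr_ge0// ltW.
have ge_T b z : T z b <= S z b by rewrite -objE; exact: (envelope_le hC1 hrho hmu ha_sc).
have T_ge a : S x y <= T a y.
  rewrite (envelopeE hC1 hrho hmu ha_sc); apply: le_trans (le_obj _ _ _).
  by have [_] := sp (xt a y) y.
split; last exact: le_trans (ge_T _ _) (T_ge _).
apply: (le_trans (ge_T _ _)); apply: le_trans (T_ge _).
by have [h _] := sp x y'.
Qed.

End Saddle.

(** * Exponential decay along a strongly monotone flow *)

Section Decay.
Context {R : realType} {n m : nat}.
Local Notation V := ('rV[R]_n * 'rV[R]_m)%type.

(** The condition on [phi] is linearity in the form met by difference quotients; the lemma serves
    the coordinate functionals of the product space. *)
Lemma is_derive_functional (U : normedModType R) (phi : U -> R) (w : R -> U) (t : R) d :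
  (forall (a : R) x y, phi (a *: (x - y)) = a * (phi x - phi y)) -> continuous phi ->
  is_derive t 1 w d -> is_derive t 1 (phi \o w) (phi d).
Proof.
move=> lphi cphi [dw dE]; have FF : ProperFilter (dnbhs (0 : R)) by exact: Proper_dnbhs_numFieldType.
have c : (fun h : R => h^-1 *: ((w \o shift t) (h *: 1) - w t)) @ 0^' --> d.
  by rewrite -dE; exact: dw.
have cp : phi @ nbhs d --> phi d by exact: cphi.
have c2 := cvg_comp _ _ c cp.
have c3 : (fun h : R => h^-1 *: (((phi \o w) \o shift t) (h *: 1) - (phi \o w) t)) @ 0^' --> phi d.
  rewrite (_ : (fun h : R => _) = phi \o (fun h : R => h^-1 *: ((w \o shift t) (h *: 1) - w t)))//.
  by apply/funext => h /=; rewrite lphi.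
split; first by apply/cvg_ex; exists (phi d).
by apply: (cvg_lim (@Rhausdorff R)).
Qed.

Lemma is_derive_expR_lin (a t : R) :
  is_derive t 1 (fun s => expR (a * s)) (a * expR (a * t)).
Proof.
have d1 : is_derive t 1 (fun s : R => a * s) a.
  have d := is_deriveZ a (is_derive_id t (1 : R)).
  by apply: (is_derive_eq d); rewrite [_ *: _]mulr1.
have d := is_derive1_comp (is_derive_expR (a * t)) d1.
by apply: (is_derive_eq d); rewrite mulrC.
Qed.

Lemma is_derive_sqdist_coord k (f : R -> 'rV[R]_k) (t : R) (a d : 'rV[R]_k) :
  (forall i, is_derive t 1 (fun s => f s 0 i : R) (d 0 i)) ->
  is_derive t 1 (fun s => dot (f s - a) (f s - a)) (2 * dot (f t - a) d).
Proof.
move=> df.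
have -> : (fun s => dot (f s - a) (f s - a)) =
    \sum_i (fun s => (f s 0 i - a 0 i) * (f s 0 i - a 0 i)).
  by apply/funext => s; rewrite fct_sumE; apply: eq_bigr => i _; rewrite !mxE.
have di i : is_derive t 1 (fun s => (f s 0 i - a 0 i) * (f s 0 i - a 0 i))
    (2 * ((f t 0 i - a 0 i) * d 0 i)).
  have d1 : is_derive t 1 (fun s => f s 0 i - a 0 i) (d 0 i - 0).
    by apply: is_deriveB.
  have d2 := is_deriveM d1 d1.
  by apply: (is_derive_eq d2); rewrite subr0 -mulr2n [_ *: _]/(_ * _) mulr_natl.
have ds := is_derive_sum (fun i => di i).
apply: (is_derive_eq ds); rewrite /dot mulr_sumr; apply: eq_bigr => i _.
by rewrite !mxE.
Qed.

Variables (F : V -> V) (ws : V) (c : R).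
Hypothesis F_monotone : forall w, dot (w.1 - ws.1) (F w).1 + dot (w.2 - ws.2) (F w).2 <=
  - c * (dot (w.1 - ws.1) (w.1 - ws.1) + dot (w.2 - ws.2) (w.2 - ws.2)).
Let sq (w : V) := dot (w.1 - ws.1) (w.1 - ws.1) + dot (w.2 - ws.2) (w.2 - ws.2).

Lemma enorm_pair_sq w : enorm_pair (w - ws) = Num.sqrt (sq w).
Proof. by rewrite /enorm_pair !enorm_sqr. Qed.

Lemma sq_ge0 w : 0 <= sq w. Proof. by rewrite addr_ge0 ?dot_ge0. Qed.

Lemma trajectory_sq_derive w (t : R) : trajectory F w -> 0 < t ->
  is_derive t 1 (fun s => sq (w s))
    (2 * (dot ((w t).1 - ws.1) (F (w t)).1 + dot ((w t).2 - ws.2) (F (w t)).2)).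
Proof.
move=> [_ dw] t0; have d := dw t t0.
rewrite mulrDr; apply: is_deriveD; apply: is_derive_sqdist_coord => i.
- apply: (is_derive_functional (phi := fun w : V => w.1 0 i) _ _ d).
    by move=> a x y; rewrite !mxE.
  move=> x; have FF : Filter (nbhs x) := nbhs_filter x.
  by apply: cvg_coord; exact: cvg_fst.
- apply: (is_derive_functional (phi := fun w : V => w.2 0 i) _ _ d).
    by move=> a x y; rewrite !mxE.
  move=> x; have FF : Filter (nbhs x) := nbhs_filter x.
  by apply: cvg_coord; exact: cvg_snd.
Qed.

(** The squared distance times [expR (2 * c * s)] is nonincreasing for [s > 0], since its derivative
    is nonpositive by [F_monotone]; a square root then halves the exponent. *)
Lemma trajectory_decay (w : R -> V) (t : R) : trajectory F w -> 0 <= t ->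
  enorm_pair (w t - ws) <= enorm_pair (w 0 - ws) * expR (- c * t).
Proof.
move=> wF; rewrite le_eqVlt => /predU1P[<-|t0]; first by rewrite mulr0 expR0 mulr1.
pose g (s : R) := expR (2 * c * s) * sq (w s).
have [w0 _] := wF.
have dg (s : R) : 0 < s -> is_derive s 1 g
   (expR (2 * c * s) * (2 * (dot ((w s).1 - ws.1) (F (w s)).1 + dot ((w s).2 - ws.2) (F (w s)).2)
      + 2 * c * sq (w s))).
  move=> s0; have d1 := trajectory_sq_derive wF s0.
  have d2 := @is_derive_expR_lin (2 * c) s.
  have d3 := is_deriveM d2 d1.
  have scE (a b : R) : a *: (b : R^o) = a * b by [].
  apply: (is_derive_eq d3); rewrite !scE.
  by move: (dot _ _) (dot _ _) (sq _) (expR _) => *; ring.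
have g_le (s : R) : 0 < s -> s < t -> g t <= g s.
  move=> s0 st; rewrite -subr_le0.
  pose dg' (r : R) := expR (2 * c * r) * (2 * (dot ((w r).1 - ws.1) (F (w r)).1 +
    dot ((w r).2 - ws.2) (F (w r)).2) + 2 * c * sq (w r)).
  have dI (r : R) : r \in `]s, t[ -> is_derive r 1 g (dg' r).
    by rewrite in_itv/= => /andP[sr _]; apply: dg; exact: lt_trans sr.
  have cI : {within `[s, t], continuous g}.
    apply: derivable_within_continuous => r; rewrite in_itv/= => /andP[sr _].
    exact: (@ex_derive _ _ _ _ _ _ _ (dg r (lt_le_trans s0 sr))).
  have [r _ ->] := MVT_segment (ltW st) dI cI.
  rewrite mulr_le0_ge0 ?subr_ge0 ?(ltW st)// /dg' pmulr_rle0 ?expR_gt0//.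
  have := F_monotone (w r); rewrite -/(sq (w r)).
  by move: (dot _ _) (dot _ _) (sq _) => a b q; lra.
(* Trajectories are differentiable at positive times only, so the comparison with time 0 goes
   through the limit from the right. *)
have gc : g s @[s --> 0^'+] --> g 0.
  apply: cvgM; last first.
    have h1 : (w s).1 - ws.1 @[s --> 0^'+] --> (w 0).1 - ws.1.
      apply: cvgB; last exact: cvg_cst.
      exact: (cvg_comp _ _ w0 (@cvg_fst _ _ (nbhs (w 0).1) (nbhs (w 0).2) _)).
    have h2 : (w s).2 - ws.2 @[s --> 0^'+] --> (w 0).2 - ws.2.
      apply: cvgB; last exact: cvg_cst.
      exact: (cvg_comp _ _ w0 (@cvg_snd _ _ (nbhs (w 0).1) (nbhs (w 0).2) _)).
    by apply: cvgD; exact: cvg_dot.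
  apply: cvg_at_right_filter.
  have h1 : 2 * c * s @[s --> nbhs (0 : R)] --> 2 * c * 0 by apply: cvgMl_tmp; exact: cvg_id.
  have h2 : @expR R @ nbhs (2 * c * 0) --> expR (2 * c * 0) by exact: continuous_expR.
  exact: (cvg_comp _ _ h1 h2).
have gt0 : g t <= g 0.
  rewrite -(cvg_lim (@Rhausdorff R) gc); apply: limr_ge; first by apply/cvg_ex; exists (g 0).
  near=> s; apply: g_le; near: s.
  - exact: nbhs_right_gt.
  - exact: nbhs_right_lt.
rewrite !enorm_pair_sq.
have e2 : expR (- c * t) ^+ 2 * expR (2 * c * t) = 1.
  by rewrite expr2 -!expRD -[RHS]expR0; congr expR; ring.
rewrite -ler_sqr ?nnegrE ?mulr_ge0 ?sqrtr_ge0 ?expR_ge0// exprMn !sqr_sqrtr ?sq_ge0//.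
move: gt0; rewrite /g mulr0 expR0 mul1r => h.
rewrite -[leLHS]mul1r -e2 -mulrA mulrC ler_wpM2r ?exprn_ge0 ?expR_ge0//.
Unshelve. all: by end_near. Qed.

End Decay.

Theorem proposition11 (R : realType) (n m : nat)
  (S : 'rV[R]_n -> 'rV[R]_m -> R)
  (hcc : convex_concave S)
  (hC1 : continuously_differentiable S)
  (hsaddle : exists w : 'rV[R]_n * 'rV[R]_m, saddle_point S w)
  (hAC : abs_continuous_along_segments (full_gradient S))
  (rho : R) (hrho : 0 < rho)
  (mu l sigma kappa : R)
  (hmu : 0 < mu) (hl : 0 < l) (hsigma : 0 < sigma) (hkappa : 0 < kappa)
  (ha_sc : forall y, strongly_convex mu (fun x => S x y))
  (ha_lip : forall y, lipschitz_gradient l (fun x => S x y))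
  (ha_hess : forall x y,
     partials_defined (fun x' => grad_x S x' y) x ->
     loewner_le mu%:M (partials_mx (fun x' => grad_x S x' y) x) /\
     loewner_le (partials_mx (fun x' => grad_x S x' y) x) l%:M)
  (hb : forall u y, J_mixed_defined rho S u y ->
     row_free (J_mixed rho S u y) /\
     loewner_le kappa%:M (J_mixed rho S u y *m (J_mixed rho S u y)^T) /\
     loewner_le (J_mixed rho S u y *m (J_mixed rho S u y)^T) sigma%:M) :
  let T := prox_envelope rho S in
  let xt := prox_point rho S in
  let c := Num.min (mu * rho / (mu + rho)) (kappa / (l + rho)) in
  [/\ 0 < c,
      (forall u y, grad_x T u y = rho *: u - rho *: xt u y /\
                   grad_y T u y = grad_y S (xt u y) y),
      (exists! w : 'rV[R]_n * 'rV[R]_m, saddle_point T w) &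
      forall wstar : 'rV[R]_n * 'rV[R]_m, saddle_point T wstar ->
        globally_exponentially_stable (saddle_flow T) wstar /\
        (forall w : R -> 'rV[R]_n * 'rV[R]_m, trajectory (saddle_flow T) w ->
         forall t : R, 0 <= t ->
           enorm_pair (w t - wstar) <=
             enorm_pair (w 0 - wstar) * expR (- c * t))].
Proof.
move=> T xt c.
have lr0 : 0 < l + rho by exact: addr_gt0.
have mr0 : 0 < mu + rho by exact: addr_gt0.
have c0 : 0 < c by rewrite lt_min !divr_gt0// mulr_gt0.
have gxE u y : grad_x T u y = rho *: u - rho *: xt u y by exact: (grad_x_envelope hC1 hrho hmu ha_sc).
have gyE u y : grad_y T u y = grad_y S (xt u y) y by exact: (grad_y_envelope hcc hC1 hrho hmu ha_sc).
(* The flow reverses the sign of the [u]-gradient only, which turns strong monotonicity into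
   dissipation; the smaller of the two rates serves both blocks. *)
have monotone (ws : 'rV[R]_n * 'rV[R]_m) : saddle_point T ws -> forall w : 'rV[R]_n * 'rV[R]_m,
    dot (w.1 - ws.1) (saddle_flow T w).1 + dot (w.2 - ws.2) (saddle_flow T w).2 <=
    - c * (dot (w.1 - ws.1) (w.1 - ws.1) + dot (w.2 - ws.2) (w.2 - ws.2)).
  move=> sp w.
  have := saddle_strongly_monotone hcc hC1 hAC hrho hmu hl hsigma hkappa ha_sc ha_lip hb w sp.
  rewrite /saddle_flow /= gxE gyE -scalerBr dotNr !(dotC (_ - _) (_ *: _)) (dotC (_ - ws.2)).
  have h1 : c * dot (w.1 - ws.1) (w.1 - ws.1) <=
      mu * rho / (mu + rho) * dot (w.1 - ws.1) (w.1 - ws.1).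
    by rewrite ler_wpM2r ?dot_ge0// /c ge_min lexx.
  have h2 : c * dot (w.2 - ws.2) (w.2 - ws.2) <=
      kappa / (l + rho) * dot (w.2 - ws.2) (w.2 - ws.2).
    by rewrite ler_wpM2r ?dot_ge0// /c ge_min lexx orbT.
  move: h1 h2; rewrite -/xt mulrDr !mulNr => h1 h2 h3.
  rewrite -opprD -[leLHS]opprK lerN2 opprD opprK (dotC (w.2 - ws.2) (grad_y _ _ _)).
  exact: le_trans (lerD h1 h2) h3.
have decay (ws : 'rV[R]_n * 'rV[R]_m) : saddle_point T ws -> forall w : R -> 'rV[R]_n * 'rV[R]_m,
    trajectory (saddle_flow T) w -> forall t : R, 0 <= t ->
    enorm_pair (w t - ws) <= enorm_pair (w 0 - ws) * expR (- c * t).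
  by move=> sp w wF t t0; have := trajectory_decay (monotone ws sp) wF t0.
split => //.
- have [w0 sp0] := hsaddle; exists w0; split.
    exact: (saddle_envelope hC1 hrho hmu ha_sc sp0).
  move=> w sp; apply: (saddle_unique hcc hC1 hAC hrho hmu hl hsigma hkappa ha_sc ha_lip hb) => //.
  exact: (saddle_envelope hC1 hrho hmu ha_sc sp0).
- move=> ws sp; split; last exact: decay.
  split.
    have [gx0 gy0] := saddle_critical hcc hC1 hrho hmu ha_sc sp.
    by rewrite /saddle_flow gxE gyE -scalerBr gx0 gy0 oppr0.
  exists 1, c; split=> //; split=> // w wF t t0.
  by rewrite mul1r; exact: decay.
Qed.
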